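(* Let $\Gamma$ and $\Gamma'$ be compact Hausdorff abelian groups, let $G$ be a locally compact Hausdorff groupoid with a Haar system $\{\lambda^u\}_{u\in G^{(0)}}$, let $(\Sigma,\iota,\pi)$ be a $\Gamma$-twist over $G$ and let $(\Sigma',\iota',\pi')$ be a $\Gamma'$-twist over $G$. Suppose that $\theta:\Gamma\to\Gamma'$ is a continuous group homomorphism and that $\theta_1:\Sigma\to\Sigma'$ is a continuous groupoid homomorphism such that $$\theta_1\circ\iota=\iota'\circ(\mathrm{id}_{G^{(0)}}\times\theta)\quad\text{and}\quad \pi'\circ\theta_1=\pi .$$ Let $\chi'$ be a character on $\Gamma'$ and set $\chi:=\chi'\circ\theta$, a character on $\Gamma$. Then for each $f\in\mathcal{C}_c(\Sigma;G;\chi)$ there is a unique $f'\in\mathcal{C}_c(\Sigma';G;\chi')$ such that $f'\circ\theta_1=f$. The mapping $f\mapsto f'$ defines a $*$-isomorphism $\Upsilon:\mathcal{C}_c(\Sigma;G;\chi)\to\mathcal{C}_c(\Sigma';G;\chi')$, which extends to a $*$-isomorphism $\mathcal{C}^*(\Sigma;G;\chi)\to\mathcal{C}^*(\Sigma';G;\chi')$ of the full $C^*$-algebras and to a $*$-isomorphism $\mathcal{C}^*_r(\Sigma;G;\chi)\to\mathcal{C}^*_r(\Sigma';G;\chi')$ of the reduced $C^*$-algebras.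
   Context: A locally compact Hausdorff groupoid is a topological groupoid (continuous multiplication and inversion) whose topology is locally compact Hausdorff; $G^{(0)}$ is the unit space, $r,s$ the range and source maps, $G^u=r^{-1}(u)$, $G_u=s^{-1}(u)$. A character is a continuous homomorphism into the circle group $\mathbb{T}$. $\Gamma$-twist: let $\Gamma$ be a locally compact Hausdorff abelian group with identity $e$, and regard $G^{(0)}\times\Gamma$ as the trivial group bundle with fibres $\Gamma$ (so $(u,\alpha)(u,\beta)=(u,\alpha\beta)$, unit space $G^{(0)}\times\{e\}\equiv G^{(0)}$). A $\Gamma$-twist $(\Sigma,\iota,\pi)$ over $G$ is a locally compact Hausdorff groupoid $\Sigma$ with unit space $\Sigma^{(0)}=\iota(G^{(0)}\times\{e\})$ and maps $\iota:G^{(0)}\times\Gamma\to\Sigma$, $\pi:\Sigma\to G$ such that: (i) $\iota,\pi$ are continuous groupoid homomorphisms, $\iota$ a topological embedding and $\pi$ a quotient map, which restrict to homeomorphisms of unit spaces; one identifies $\Sigma^{(0)}=G^{(0)}$ via $\pi|_{\Sigma^{(0)}}$; (ii) $\iota$ is injective, $\pi$ is surjective and $\iota(G^{(0)}\times\Gamma)=\pi^{-1}(G^{(0)})$; (iii) for all $\sigma\in\Sigma$, $\alpha\in\Gamma$, $\iota(r(\sigma),\alpha)\sigma=\sigma\iota(s(\sigma),\alpha)$ (in particular these products are defined). The action of $\Gamma$ on $\Sigma$ is $\alpha\cdot\sigma:=\iota(r(\sigma),\alpha)\sigma$. Haar system on $G$: Radon measures $\lambda^u$ on $G$, $u\in G^{(0)}$,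 with $\operatorname{supp}\lambda^u=G^u$, with $u\mapsto\int f\,d\lambda^u$ continuous for all $f\in\mathcal{C}_c(G)$, and $\int f(\gamma\eta)\,d\lambda^{s(\gamma)}(\eta)=\int f(\eta)\,d\lambda^{r(\gamma)}(\eta)$ for $\gamma\in G$, $f\in\mathcal{C}_c(G)$. The Haar measure $\lambda$ on the compact group $\Gamma$ is normalised, $\lambda(\Gamma)=1$. With $\mathfrak{s}:G\to\Sigma$ any (not necessarily continuous) section of $\pi$, the induced Haar system on $\Sigma$ consists of the Radon measures $\mu^u$ with $$\int_\Sigma f\,d\mu^u=\int_{G^u}\int_\Gamma f(\alpha\cdot\mathfrak{s}(\gamma))\,d\lambda(\alpha)\,d\lambda^u(\gamma)\quad(f\in\mathcal{C}_c(\Sigma)),$$ and $\mu_u$ is defined by $\int f(\sigma)\,d\mu_u(\sigma)=\int f(\sigma^{-1})\,d\mu^u(\sigma)$; its support is $\Sigma_u=s^{-1}(u)$. $\mathcal{C}_c(\Sigma)$ is a $*$-algebra with $f*g(\sigma)=\int_\Sigma f(\tau)g(\tau^{-1}\sigma)\,d\mu^{r(\sigma)}(\tau)$ and $f^*(\sigma)=\overline{f(\sigma^{-1})}$. For a character $\chi$ of $\Gamma$, $$\mathcal{C}_c(\Sigma;G;\chi)=\{f\in\mathcal{C}_c(\Sigma): f(\alpha\cdot\sigma)=\chi(\alpha)f(\sigma)\ \forall\sigma\in\Sigma,\alpha\in\Gamma\},$$ a $*$-subalgebra of $\mathcal{C}_c(\Sigma)$. Put $\|f\|_{I,r}=\sup_u\int|f|\,d\mu^u$,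 $\|f\|_{I,s}=\sup_u\int|f|\,d\mu_u$, $\|f\|_I=\max\{\|f\|_{I,s},\|f\|_{I,r}\}$. The full norm on $\mathcal{C}_c(\Sigma;G;\chi)$ is $\|f\|=\sup\|L(f)\|$ over all $*$-representations $L$ of $\mathcal{C}_c(\Sigma;G;\chi)$ on Hilbert spaces with $\|L(g)\|\le\|g\|_I$ for all $g\in\mathcal{C}_c(\Sigma;G;\chi)$; $\mathcal{C}^*(\Sigma;G;\chi)$ is the completion. For $u\in\Sigma^{(0)}$, $\operatorname{Ind}\delta_u$ is the $I$-norm bounded representation of $\mathcal{C}_c(\Sigma)$ on $L^2(\Sigma_u,\mu_u)$ obtained by extending continuously $\operatorname{Ind}\delta_u(f)(g)=f*g$ ($f,g\in\mathcal{C}_c(\Sigma)$, as functions on $\Sigma_u$). The reduced norm is $\|f\|_r=\sup_{u}\|\operatorname{Ind}\delta_u(f)\|_{\mathcal{B}(L^2(\Sigma_u,\mu_u))}$ and $\mathcal{C}^*_r(\Sigma;G;\chi)$ is the completion of $\mathcal{C}_c(\Sigma;G;\chi)$ in it. The corresponding objects for $(\Sigma',\iota',\pi')$ and $\chi'$ are defined in the same way, using the same Haar system $\{\lambda^u\}$ on $G$ and the normalised Haar measure on $\Gamma'$. *)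

(* Defs.v *)
(* Written for MathComp and MathComp-Analysis. *)
From HB Require Import structures.
From mathcomp Require Import all_boot all_order all_algebra.
From mathcomp Require Import complex.
From mathcomp Require Import all_classical all_reals all_analysis.

Set Implicit Arguments.
Unset Strict Implicit.
Unset Printing Implicit Defensive.

Import Order.TTheory GRing.Theory Num.Theory.
Import numFieldNormedType.Exports.

Local Open Scope classical_set_scope.
Local Open Scope ring_scope.

(* The complex numbers, with the topology that MathComp-Analysis puts on every
   [numClosedFieldType]; norms of complex normed modules take values in this
   field, and [complex.Re] brings them back to [R]. *)
Definition Cplx (R : realType) : numClosedFieldType := R[i].

(* A supremum of elements of [0, +oo], with sup set0 = 0. *)
Definition esup0 (R : realType) (A : set (\bar R)) : \bar R :=
  ereal_sup ([set 0%E] `|` A).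

(* ---- Borel measures ---------------------------------------------------- *)

(* Measurable types are pointed in MathComp-Analysis and topological spaces are
   not.  [borel t] is T with its Borel sigma-algebra and with t as the point;
   the choice of t is immaterial. *)
Definition pointed_at (T : topologicalType) (t : T) : Type := T.
HB.instance Definition _ (T : topologicalType) (t : T) :=
  Topological.on (pointed_at t).
HB.instance Definition _ (T : topologicalType) (t : T) :=
  isPointed.Build (pointed_at t) t.

Notation borel t := (g_sigma_algebraType (@open (pointed_at t))).

Definition cintegral (R : realType) (T : topologicalType) (t : T)
    (mu : set (borel t) -> \bar R) (D : set T) (f : T -> Cplx R) : Cplx R :=
  Complex (fine (integral mu D (fun x : borel t => (complex.Re (f x))%:E)))
          (fine (integral mu D (fun x : borel t => (complex.Im (f x))%:E))).

Record radon (R : realType) (T : topologicalType) (t : T)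
    (mu : set (borel t) -> \bar R) : Prop := Radon {
  radon_finite : forall K : set T, compact K -> (mu K < +oo)%E ;
  radon_outer : forall A : set (borel t), measurable A ->
    mu A = ereal_inf [set mu U | U in [set U : set T | open U /\ A `<=` U]] ;
  radon_inner : forall U : set T, open U ->
    mu U = ereal_sup [set mu K | K in [set K : set T | compact K /\ K `<=` U]]
}.

Definition msupport (R : realType) (T : topologicalType) (t : T)
    (mu : set (borel t) -> \bar R) : set T :=
  [set x | forall U : set T, open U -> U x -> (0 < mu U)%E].

Definition Cc (R : realType) (T : topologicalType) : set (T -> Cplx R) :=
  [set f | continuous f /\ compact (closure [set x | f x != 0])].

(* Abelian groups are written additively. *)
Record normalized_haar (R : realType) (Gam : topologicalZmodType)
    (h : set (borel (0 : Gam)) -> \bar R) : Prop := NormalizedHaar {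
  haar_radon : radon h ;
  haar_total : h setT = 1%E ;
  haar_invariant : forall (a : Gam) (A : set (borel (0 : Gam))), measurable A ->
    h [set a + x | x in (A : set Gam)] = h A
}.

Record character (R : realType) (Gam : topologicalZmodType)
    (chi : Gam -> Cplx R) : Prop := Character {
  char_continuous : continuous chi ;
  char_norm : forall a, `|chi a| = 1 ;
  char_mul : forall a b, chi (a + b) = chi a * chi b
}.

(* ---- Locally compact Hausdorff groupoids ------------------------------- *)

(* A groupoid is given by its arrows, its units being the arrows fixed by the
   range map; [gmul x y] is meaningful only if the source of x is the range
   of y. *)
Record lcgroupoid := LCGroupoid {
  garrow :> topologicalType ;
  grange : garrow -> garrow ;
  gsource : garrow -> garrow ;
  gmul : garrow -> garrow -> garrow ;
  ginv : garrow -> garrow ;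
  grange_range : forall x, grange (grange x) = grange x ;
  gsource_range : forall x, gsource (grange x) = grange x ;
  grange_source : forall x, grange (gsource x) = gsource x ;
  gsource_source : forall x, gsource (gsource x) = gsource x ;
  grange_mul : forall x y, gsource x = grange y ->
    grange (gmul x y) = grange x ;
  gsource_mul : forall x y, gsource x = grange y ->
    gsource (gmul x y) = gsource y ;
  gmulA : forall x y z, gsource x = grange y -> gsource y = grange z ->
    gmul x (gmul y z) = gmul (gmul x y) z ;
  gmul_range : forall x, gmul (grange x) x = x ;
  gmul_source : forall x, gmul x (gsource x) = x ;
  grange_inv : forall x, grange (ginv x) = gsource x ;
  gsource_inv : forall x, gsource (ginv x) = grange x ;
  gmulV : forall x, gmul x (ginv x) = grange x ;
  gmulVx : forall x, gmul (ginv x) x = gsource x ;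
  gmul_continuous :
    {within [set p : garrow * garrow | gsource p.1 = grange p.2],
      continuous (fun p : garrow * garrow => gmul p.1 p.2)} ;
  ginv_continuous : continuous ginv ;
  garrow_hausdorff : hausdorff_space garrow ;
  garrow_locally_compact : locally_compact [set: garrow]
}.

Definition units (G : lcgroupoid) : set G := [set u | grange u = u].
Definition rfib (G : lcgroupoid) (u : G) : set G := [set x | grange x = u].
Definition sfib (G : lcgroupoid) (u : G) : set G := [set x | gsource x = u].

Definition groupoid_hom (G H : lcgroupoid) (phi : G -> H) : Prop :=
  forall x y : G, gsource x = grange y ->
    gsource (phi x) = grange (phi y) /\
    phi (gmul x y) = gmul (phi x) (phi y).

(* Only the measures [lam u] with u a unit are relevant. *)
Record haar_system (R : realType) (G : lcgroupoid)
    (lam : forall u : G, {measure set (borel u) -> \bar R}) : Prop :=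
  HaarSystem {
  haar_system_radon : forall u, units u -> radon (lam u) ;
  haar_system_support : forall u, units u -> msupport (lam u) = rfib u ;
  haar_system_continuous : forall f : G -> Cplx R, Cc f ->
    {within @units G, continuous (fun u => cintegral (lam u) setT f)} ;
  haar_system_invariant : forall (x : G) (f : G -> Cplx R), Cc f ->
    cintegral (lam (gsource x)) (rfib (gsource x)) (fun y => f (gmul x y)) =
    cintegral (lam (grange x)) setT f
}.

(* ---- Twists ------------------------------------------------------------ *)

Definition embedding_on (X Y : topologicalType) (A : set X) (f : X -> Y)
    : Prop :=
  [/\ {within A, continuous f},
      set_inj A f &
      forall U : set X, open U ->
        exists2 V : set Y, open V & f @` (A `&` U) = (f @` A) `&` V].

Definition homeo_on (X Y : topologicalType) (A : set X) (B : set Y)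
    (f : X -> Y) : Prop :=
  embedding_on A f /\ f @` A = B.

(* [tiota] is meaningful only on [twist_bundle G Gam], i.e. on G^(0) x Gam.
   The units of G and of S are identified by the restriction of [tpi]. *)
Definition twist_bundle (G : lcgroupoid) (Gam : topologicalZmodType) :
  set (G * Gam) := [set p | units p.1].

Record twist (G S : lcgroupoid) (Gam : topologicalZmodType) := Twist {
  tiota : G * Gam -> S ;
  tpi : S -> G ;
  tiota_hom : forall (u : G) (a b : Gam), units u ->
    gsource (tiota (u, a)) = grange (tiota (u, b)) /\
    tiota (u, a + b) = gmul (tiota (u, a)) (tiota (u, b)) ;
  tiota_embedding : embedding_on (@twist_bundle G Gam) tiota ;
  tiota_units :
    homeo_on [set p : G * Gam | units p.1 /\ p.2 = 0] (@units S) tiota ;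
  tpi_hom : groupoid_hom tpi ;
  tpi_continuous : continuous tpi ;
  tpi_quotient : forall V : set G, open (tpi @^-1` V) -> open V ;
  tpi_surjective : forall x, exists y, tpi y = x ;
  tpi_units : homeo_on (@units S) (@units G) tpi ;
  tiota_image : tiota @` (@twist_bundle G Gam) = tpi @^-1` (@units G) ;
  tcentral_l : forall (x : S) (a : Gam),
    gsource (tiota (tpi (grange x), a)) = grange x ;
  tcentral_r : forall (x : S) (a : Gam),
    gsource x = grange (tiota (tpi (gsource x), a)) ;
  tcentral : forall (x : S) (a : Gam),
    gmul (tiota (tpi (grange x), a)) x = gmul x (tiota (tpi (gsource x), a))
}.

Definition tact (G S : lcgroupoid) (Gam : topologicalZmodType)
    (E : twist G S Gam) (a : Gam) (x : S) : S :=
  gmul (tiota E (tpi E (grange x), a)) x.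

(* The measures mu^u are indexed by the units of S. *)
Record induced_haar (R : realType) (G S : lcgroupoid)
    (Gam : topologicalZmodType) (E : twist G S Gam)
    (lam : forall u : G, {measure set (borel u) -> \bar R})
    (h : {measure set (borel (0 : Gam)) -> \bar R})
    (mu : forall x : S, {measure set (borel x) -> \bar R}) : Prop :=
  InducedHaar {
  induced_radon : forall x, units x -> radon (mu x) ;
  induced_integral : forall sec : G -> S, cancel sec (tpi E) ->
    forall (x : S) (f : S -> Cplx R), units x -> Cc f ->
      cintegral (mu x) setT f =
      cintegral (lam (tpi E x)) (rfib (tpi E x))
        (fun y => cintegral h setT (fun a => f (tact E a (sec y))))
}.

Definition Cchi (R : realType) (G S : lcgroupoid) (Gam : topologicalZmodType)
    (E : twist G S Gam) (chi : Gam -> Cplx R) : set (S -> Cplx R) :=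
  [set f | Cc f /\ forall (x : S) (a : Gam), f (tact E a x) = chi a * f x].

(* ---- The convolution *-algebra of a groupoid, and its I-norm ----------- *)

Section convolution.
Variables (R : realType) (S : lcgroupoid).
Variable mu : forall x : S, {measure set (borel x) -> \bar R}.
Implicit Types (f g : S -> Cplx R) (u : S).

(* The integrand is meaningful only on the fibre over the range of x, on which
   the measure is concentrated. *)
Definition gconv f g : S -> Cplx R := fun x =>
  cintegral (mu (grange x)) (rfib (grange x))
    (fun y => f y * g (gmul (ginv y) x)).

Definition gstar f : S -> Cplx R := fun x => (f (ginv x))^*.

Definition mu_source u : set (borel u) -> \bar R :=
  pushforward (mu u) (@ginv S : borel u -> borel u).

Definition abs_integral u (nu : set (borel u) -> \bar R) f : \bar R :=
  integral nu setT (fun x : borel u => (complex.Re `|f x|)%:E).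

Definition Inorm_r f : \bar R :=
  esup0 [set abs_integral (mu u) f | u in @units S].
Definition Inorm_s f : \bar R :=
  esup0 [set abs_integral (@mu_source u) f | u in @units S].
Definition Inorm f : \bar R := maxe (Inorm_s f) (Inorm_r f).

End convolution.

(* ---- Hilbert spaces, C*-algebras, *-homomorphisms ---------------------- *)

Record hilbertSpace (R : realType) := HilbertSpace {
  hcarrier :> completeNormedModType (Cplx R) ;
  hinner : hcarrier -> hcarrier -> Cplx R ;
  hinner_linear : forall (a : Cplx R) (x y z : hcarrier),
    hinner (a *: x + y) z = a * hinner x z + hinner y z ;
  hinner_conj : forall x y, hinner y x = (hinner x y)^* ;
  hinner_norm : forall x, hinner x x = `|x| ^+ 2
}.

Definition opnorm (R : realType) (H : hilbertSpace R) (T : H -> H) : \bar R :=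
  esup0 [set (complex.Re `|T x|)%:E | x in [set x : H | `|x| <= 1]].

Record cstarAlgebra (R : realType) := CStarAlgebra {
  acarrier :> completeNormedModType (Cplx R) ;
  amul : acarrier -> acarrier -> acarrier ;
  astar : acarrier -> acarrier ;
  amulA : forall x y z, amul x (amul y z) = amul (amul x y) z ;
  amul_linear_l : forall (a : Cplx R) x y z,
    amul (a *: x + y) z = a *: amul x z + amul y z ;
  amul_linear_r : forall (a : Cplx R) x y z,
    amul z (a *: x + y) = a *: amul z x + amul z y ;
  astarK : forall x, astar (astar x) = x ;
  astar_linear : forall (a : Cplx R) x y,
    astar (a *: x + y) = a^* *: astar x + astar y ;
  astarM : forall x y, astar (amul x y) = amul (astar y) (astar x) ;
  anormM : forall x y, `|amul x y| <= `|x| * `|y| ;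
  anorm_star : forall x, `|amul (astar x) x| = `|x| ^+ 2
}.

(* The *-algebras of functions below are subsets V of a module carrying a
   product and an involution, so that *-homomorphisms are relative to V. *)
Record star_hom_on (R : realType) (M N : lmodType (Cplx R))
    (mulM : M -> M -> M) (starM : M -> M)
    (mulN : N -> N -> N) (starN : N -> N)
    (V : set M) (phi : M -> N) : Prop := StarHomOn {
  star_hom_linear : forall (a : Cplx R) x y, V x -> V y ->
    phi (a *: x + y) = a *: phi x + phi y ;
  star_hom_mul : forall x y, V x -> V y -> phi (mulM x y) = mulN (phi x) (phi y) ;
  star_hom_star : forall x, V x -> phi (starM x) = starN (phi x)
}.

Definition star_iso_on (R : realType) (M N : lmodType (Cplx R))
    (mulM : M -> M -> M) (starM : M -> M)
    (mulN : N -> N -> N) (starN : N -> N)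
    (V : set M) (W : set N) (phi : M -> N) : Prop :=
  set_bij V W phi /\ star_hom_on mulM starM mulN starN V phi.

Definition cstar_iso (R : realType) (A B : cstarAlgebra R) (Phi : A -> B)
    : Prop :=
  star_iso_on (@amul R A) (@astar R A) (@amul R B) (@astar R B)
    setT setT Phi.

(* (A, i) is the C*-completion of the *-algebra V in the norm [N]. *)
Record completion (R : realType) (M : lmodType (Cplx R))
    (mulM : M -> M -> M) (starM : M -> M) (V : set M) (N : M -> \bar R)
    (A : cstarAlgebra R) (i : M -> A) : Prop := Completion {
  completion_hom : star_hom_on mulM starM (@amul R A) (@astar R A) V i ;
  completion_norm : forall x, V x -> (complex.Re `|i x|)%:E = N x ;
  completion_dense : dense (i @` V)
}.

(* ---- The full norm ----------------------------------------------------- *)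

Section full_norm.
Variables (R : realType) (S : lcgroupoid).
Variable mu : forall x : S, {measure set (borel x) -> \bar R}.
Variable V : set (S -> Cplx R).

Record star_rep (H : hilbertSpace R) (L : (S -> Cplx R) -> H -> H) : Prop :=
  StarRep {
  star_rep_operator : forall f, V f -> linear (L f) ;
  star_rep_bounded : forall f, V f -> (opnorm (L f) < +oo)%E ;
  star_rep_linear : forall (a : Cplx R) f g, V f -> V g ->
    forall x, L (a *: f + g) x = a *: L f x + L g x ;
  star_rep_mul : forall f g, V f -> V g ->
    forall x, L (gconv mu f g) x = L f (L g x) ;
  star_rep_star : forall f, V f ->
    forall x y, hinner (L f x) y = hinner x (L (gstar f) y)
}.

Definition full_norm (f : S -> Cplx R) : \bar R :=
  esup0 [set c | exists (H : hilbertSpace R) (L : (S -> Cplx R) -> H -> H),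
    [/\ star_rep L,
        forall g, V g -> (opnorm (L g) <= Inorm mu g)%E &
        c = opnorm (L f)]].

End full_norm.

(* ---- The reduced norm -------------------------------------------------- *)

Section reduced_norm.
Variables (R : realType) (S : lcgroupoid).
Variable mu : forall x : S, {measure set (borel x) -> \bar R}.
Implicit Types (f g : S -> Cplx R) (u : S).

(* Square-integrable functions on S_u, represented by functions on S of which
   only the values on S_u matter; two of them are equal in L^2(S_u, mu_u) when
   the norm of their difference vanishes. *)
Definition L2norm u g : \bar R :=
  (integral (@mu_source R S mu u) (sfib u)
     (fun x : borel u => ((complex.Re `|g x|) ^+ 2)%:E) `^ 2^-1)%E.

Definition L2 u : set (S -> Cplx R) :=
  [set g | [/\ measurable_fun (sfib u : set (borel u))
                 (fun x : borel u => complex.Re (g x)),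
               measurable_fun (sfib u : set (borel u))
                 (fun x : borel u => complex.Im (g x)) &
               (L2norm u g < +oo)%E]].

Definition L2eq u g1 g2 : Prop := L2norm u (g1 - g2) = 0%E.

(* T is the operator Ind delta_u (f): the continuous linear extension to
   L^2(S_u, mu_u) of g |-> f * g.  It is unique up to [L2eq] because C_c(S) is
   dense. *)
Record is_Ind_delta u f (T : (S -> Cplx R) -> S -> Cplx R) : Prop :=
  IsIndDelta {
  Ind_L2 : forall g, L2 u g -> L2 u (T g) ;
  Ind_linear : forall (a : Cplx R) g1 g2, L2 u g1 -> L2 u g2 ->
    L2eq u (T (a *: g1 + g2)) (a *: T g1 + T g2) ;
  Ind_bounded : exists c : R, forall g, L2 u g ->
    (L2norm u (T g) <= c%:E * L2norm u g)%E ;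
  Ind_conv : forall g, Cc g -> L2eq u (T g) (gconv mu f g)
}.

Definition Ind_delta_norm u f : \bar R :=
  esup0 [set c | exists T g,
    [/\ is_Ind_delta u f T, L2 u g, (L2norm u g <= 1)%E &
        c = L2norm u (T g)]].

Definition reduced_norm f : \bar R :=
  esup0 [set Ind_delta_norm u f | u in @units S].

End reduced_norm.

(* Main.v *)
(* A continuous chi-equivariant f on S is determined by its values on a (not
   necessarily continuous) section sec of pi; since theta1 \o sec is a section
   of pi', f' |-> f' \o theta1 is a bijection of the twisted functions on S'
   onto those on S.  Its inverse takes f to the function whose value at
   b . theta1 x is chi' b * f x; it is continuous because pi is open and
   Gam' is compact.  In convolutions, I-norms and L^2-norms of twisted
   functions the integral over Gam is trivial, so that on both sides they are
   the same integrals over G^u with respect to lam.  Hence representations, and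
   the full norms, correspond.

   For the reduced norm, Ind delta_u (f) acts on all of L^2(S_u).  The map
   P g x = \int chi a * g ((- a) . x) is a contraction of L^2 onto twisted
   functions with f * g = f * P g for twisted f; so the least c with
   |f * g| <= c |g| on C_c(S) only depends on twisted g, and it is the norm of
   Ind delta_u (f) because C_c(S) is dense and L^2 is complete.  Finally an
   isometric isomorphism of dense *-subalgebras extends to the completions. *)
Require Import Defs.
From HB Require Import structures.
From mathcomp Require Import all_boot all_order all_algebra.
From mathcomp Require Import complex.
From mathcomp Require Import all_classical all_reals all_analysis.
From mathcomp Require Import measurable_realfun.
From mathcomp Require Import ring lra.

Set Implicit Arguments.
Unset Strict Implicit.
Unset Printing Implicit Defensive.

Import Order.TTheory GRing.Theory Num.Theory.
Import numFieldNormedType.Exports.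

Local Open Scope classical_set_scope.
Local Open Scope ring_scope.

(** * Complex numbers and compactly supported functions *)

Section complex_topology.
Variable R : realType.
Local Notation C := (Cplx R).

(** The induced measures are known only through integrals of compactly supported continuous
    functions on the whole groupoid, whereas convolution integrands live on a single fibre. Most of
    the groundwork bridges this gap: the measures are null off their fibres, integrals of a fixed
    function vary continuously with the unit, and fibrewise data are extended to, or approximated
    by, functions in C_c. No continuous section of pi is available, hence no local product
    structure; continuity and compactness are instead obtained by lifting cluster points of filters
    along the orbits of the compact group. The reduced norm is a supremum over all realisations of
    Ind delta_u (f), each determined only up to null functions. It is rewritten as the infimum of
    the constants b with |f * g| <= b |g| on C_c(S), and as 0, the value of an empty supremum, when
    there is no such b. Both alternatives transfer, because the set of such b is the same for the
    two twists. *)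

Lemma cnormE (z : C) : `|z| = ((complex.Re `|z|)%:C)%C.
Proof. by rewrite normc_def. Qed.

Lemma Re_norm (z : C) : complex.Re `|z| = Num.sqrt (complex.Re z ^+ 2 + complex.Im z ^+ 2).
Proof. by rewrite normc_def. Qed.

Lemma Re_norm_ge0 (z : C) : 0 <= complex.Re `|z|.
Proof. by rewrite Re_norm sqrtr_ge0. Qed.

Lemma sqr_Re_norm (z : C) :
  complex.Re `|z| ^+ 2 = complex.Re z ^+ 2 + complex.Im z ^+ 2.
Proof. by rewrite Re_norm sqr_sqrtr// addr_ge0// sqr_ge0. Qed.

Lemma Re_normM (z w : C) :
  complex.Re `|z * w| = complex.Re `|z| * complex.Re `|w|.
Proof. by rewrite normrM (cnormE z) (cnormE w) /= mulr0 subr0. Qed.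

Lemma Re_normD (z w : C) :
  complex.Re `|z + w| <= complex.Re `|z| + complex.Re `|w|.
Proof. by have := ler_normD z w; rewrite lecE => /andP[_]. Qed.

Lemma le_Re_norm (z : C) : `|complex.Re z| <= complex.Re `|z|.
Proof. by have := normc_ge_Re z; rewrite lecE => /andP[_]. Qed.

Lemma le_Im_norm (z : C) : `|complex.Im z| <= complex.Re `|z|.
Proof.
rewrite Re_norm -sqrtr_sqr ler_wsqrtr// lerDr sqr_ge0 //.
Qed.

Lemma norm_real_complex (r : R) : `|(r%:C)%C : C| = ((`|r|)%:C)%C.
Proof. by rewrite normc_def /= expr0n/= addr0 sqrtr_sqr. Qed.

Lemma cReD (z w : C) : complex.Re (z + w) = complex.Re z + complex.Re w.
Proof. by case: z w => [a b] [c d]. Qed.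

Lemma cImD (z w : C) : complex.Im (z + w) = complex.Im z + complex.Im w.
Proof. by case: z w => [a b] [c d]. Qed.

Lemma cReN (z : C) : complex.Re (- z) = - complex.Re z.
Proof. by case: z. Qed.

Lemma cImN (z : C) : complex.Im (- z) = - complex.Im z.
Proof. by case: z. Qed.

Lemma cReM (z w : C) :
  complex.Re (z * w) = complex.Re z * complex.Re w - complex.Im z * complex.Im w.
Proof. by case: z w => [a b] [c d]. Qed.

Lemma cImM (z w : C) :
  complex.Im (z * w) = complex.Re z * complex.Im w + complex.Im z * complex.Re w.
Proof. by case: z w => [a b] [c d]. Qed.

Lemma cRe_conj (z : C) : complex.Re z^* = complex.Re z.
Proof. by case: z. Qed.

Lemma cIm_conj (z : C) : complex.Im z^* = - complex.Im z.
Proof. by case: z. Qed.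

Lemma complex_eq (z w : C) :
  complex.Re z = complex.Re w -> complex.Im z = complex.Im w -> z = w.
Proof. by case: z w => [a b] [c d] /= -> ->. Qed.

Lemma complex_gt0P (e : C) : 0 < e -> exists2 r : R, 0 < r & e = (r%:C)%C.
Proof.
case: e => a b; rewrite ltcE /= => /andP[/eqP b0 a0].
by exists a => //; rewrite b0.
Qed.

Lemma real_complex_gt0 (r : R) : 0 < r -> 0 < ((r%:C)%C : C).
Proof. by move=> r0; rewrite ltcE /= eqxx. Qed.

(** Positive elements of [Cplx R] are exactly the positive reals, so convergence in a complex normed
    module can be tested with real tolerances; later estimates then become real inequalities about
    [complex.Re] of a norm. *)
Lemma cvg_normcP (V : normedModType C) T (F : set_system T) (FF : Filter F)
    (f : T -> V) (l : V) :
  f @ F --> l <->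
  (forall e : R, 0 < e -> \forall x \near F, complex.Re `|l - f x| < e).
Proof.
split => [/cvgrPdist_lt fl e e0|fl].
  have := fl _ (real_complex_gt0 e0); apply: filterS => x.
  by rewrite ltcE /= => /andP[].
apply/cvgrPdist_lt => _/complex_gt0P[e e0 ->].
apply: filterS (fl e e0) => x; have : `|l - f x| \is Num.real by rewrite realE normr_ge0.
rewrite ltcE /= => h ->; rewrite andbT.
by move: (normr_ge0 (l - f x)); rewrite lecE => /andP[/eqP/= ->].
Qed.

Lemma cvg_Re T (F : set_system T) (FF : Filter F) (f : T -> C) (l : C) :
  f @ F --> l -> complex.Re (f x) @[x --> F] --> complex.Re l.
Proof.
move=> /(@cvg_normcP C _ _ FF) fl; apply/cvgrPdist_lt => e /fl.
by apply: filterS => x; apply: le_lt_trans; rewrite -cReN -cReD; exact: le_Re_norm.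
Qed.

Lemma cvg_Im T (F : set_system T) (FF : Filter F) (f : T -> C) (l : C) :
  f @ F --> l -> complex.Im (f x) @[x --> F] --> complex.Im l.
Proof.
move=> /(@cvg_normcP C _ _ FF) fl; apply/cvgrPdist_lt => e /fl.
by apply: filterS => x; apply: le_lt_trans; rewrite -cImN -cImD; exact: le_Im_norm.
Qed.

Lemma cvg_Complex T (F : set_system T) (FF : Filter F) (f g : T -> R) (a b : R) :
  f @ F --> a -> g @ F --> b -> (Complex (f x) (g x) : C) @[x --> F] --> (Complex a b : C).
Proof.
move=> /cvgrPdist_lt fa /cvgrPdist_lt gb.
apply/(@cvg_normcP C _ _ FF) => e e0; have e20 : 0 < e / 2 by rewrite divr_gt0.
apply: filterS2 (fa _ e20) (gb _ e20) => x fx gx.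
have -> : (Complex a b - Complex (f x) (g x) : C) =
    Complex (a - f x) 0 + Complex 0 (b - g x).
  by apply: complex_eq; rewrite !(cReD, cImD, cReN, cImN)/= ?addr0 ?add0r.
rewrite (le_lt_trans (Re_normD _ _))// [ltRHS]splitr ltrD// Re_norm /=.
  by rewrite expr0n/= addr0 sqrtr_sqr.
by rewrite expr0n/= add0r sqrtr_sqr.
Qed.

Lemma cvg_norm_Re T (F : set_system T) (FF : Filter F) (f : T -> C) (l : C) :
  f @ F --> l -> complex.Re `|f x| @[x --> F] --> complex.Re `|l|.
Proof. by move=> fl; apply: cvg_Re; exact: cvg_norm. Qed.

Lemma cvg_real_complex T (F : set_system T) (FF : Filter F) (f : T -> R) (l : R) :
  f @ F --> l -> ((f x)%:C)%C @[x --> F] --> ((l%:C)%C : C).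
Proof. by move=> fl; apply: cvg_Complex => //; exact: cvg_cst. Qed.

Lemma cvg_conj T (F : set_system T) (FF : Filter F) (f : T -> C) (l : C) :
  f @ F --> l -> (f x)^* @[x --> F] --> l^*.
Proof.
move=> fl; have -> : (fun x => (f x)^*) =
    (fun x => Complex (complex.Re (f x)) (- complex.Im (f x))).
  by apply/funext => x; apply: complex_eq; rewrite ?cRe_conj ?cIm_conj.
have -> : l^* = Complex (complex.Re l) (- complex.Im l).
  by apply: complex_eq; rewrite ?cRe_conj ?cIm_conj.
by apply: cvg_Complex; [exact: cvg_Re|apply: cvgN; exact: cvg_Im].
Qed.

End complex_topology.

Lemma compact_closureS (X : topologicalType) (A B : set X) :
  compact (closure B) -> A `<=` B -> compact (closure A).
Proof.
move=> cB AB; exact: (@subclosed_compact _ _ _ (@closed_closure _ A) cB (closureS AB)).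
Qed.

(** * Urysohn and Tietze theorems with compact supports *)

Section locally_compact.
Variables (R : realType) (X : topologicalType).
Hypothesis lcX : locally_compact [set: X].
Hypothesis hX : hausdorff_space X.
Local Notation Y := (one_point_compactification X).

Lemma opc_normal : normal_space Y.
Proof.
apply: compact_normal; first exact: one_point_compactification_hausdorff.
exact: one_point_compactification_compact.
Qed.

Lemma closed_opc_None (C : set X) :
  closed C -> closed (Some @` C `|` [set None] : set Y).
Proof.
move=> cC; rewrite -openC (_ : ~` _ = Some @` (~` C)).
  exact/one_point_compactification_open_some/closed_openC.
apply/seteqP; split => [[x|]|_ [x nCx <-]] /=.
- by move=> h; exists x => // Cx; apply: h; left; exists x.
- by move=> h; exfalso; apply: h; right.
- by case=> [[y Cy [yx]]|//]; apply: nCx; rewrite -yx.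
Qed.

(** A filter on the preimage is pushed into the compact space [Y]; its cluster point lies in the
    closed set [A], hence is not the point at infinity, and it is already a cluster point in [X]. *)
Lemma compact_opc_preimage (A : set Y) :
  closed A -> ~ A None -> compact (Some @^-1` A : set X).
Proof.
move=> cA nA F PF FA.
have PF' : ProperFilter ((Some : X -> Y) @ F) by exact: fmap_proper_filter.
have [y [_ cly]] := @one_point_compactification_compact X ((Some : X -> Y) @ F) PF' filterT.
have Ay : A y.
  apply: cA => B By; have [z [? ?]] := cly _ _ FA By; by exists z.
case: y cly Ay => [x|//] cly Ax; exists x; split => // B D FB Dx.
have [|_ [[z Bz <-] [w Dw [wz]]]] := cly (Some @` B) (Some @` D) _ (one_point_compactification_some_nbhs x D Dx).
  by rewrite /nbhs/=; apply: (filterS _ FB) => u Bu /=; exists u.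
by exists z; split => //; rewrite -wz.
Qed.

(** Urysohn's lemma in the one-point compactification, which is normal: [K] is separated from the
    complement of [U], a closed set containing the point at infinity. *)
Lemma urysohn_Cc (K U : set X) : compact K -> open U -> K `<=` U ->
  exists phi : X -> R, [/\ continuous phi, forall x, 0 <= phi x <= 1,
    forall x, K x -> phi x = 1,
    compact (closure [set x | phi x != 0]) &
    closure [set x | phi x != 0] `<=` U].
Proof.
move=> cK oU KU.
have cKY : closed (Some @` K : set Y).
  apply: compact_closed; first exact: one_point_compactification_hausdorff.
  apply: (@continuous_compact X Y Some K) => //.
  exact/continuous_subspaceT/one_point_compactification_some_continuous.
have cUY : closed (~` (Some @` U) : set Y).
  exact/open_closedC/one_point_compactification_open_some.
have dj : ~` (Some @` U) `&` (Some @` K) = set0 :> set Y.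
  apply/seteqP; split => // y [nU [x Kx xy]]; apply: nU; exists x => //.
  exact: KU.
have [f [cf f0 f1 frange]] := urysohn_ext_itv opc_normal cUY cKY dj (@ltr01 R).
have f01 y : 0 <= f y <= 1.
  by have := frange (f y); rewrite /= in_itv/=; apply; exists y.
pose g : X -> R := fun x => f (Some x).
have cg : continuous g.
  by move=> x; exact: (@continuous_comp X Y R Some f x (@one_point_compactification_some_continuous X x) (cf (Some x))).
(* The support of [g] itself may leave [U]. The truncation is positive only where g > 1/2, and the
   closure of that set stays in the closed set g >= 1/2, which lies in [U] and misses infinity. *)
pose phi : X -> R := fun x => Num.max 0 (2 * g x - 1).
have cphi : continuous phi.
  move=> x; apply: (@continuous_max R X (fun=> 0) (fun x => 2 * g x - 1) x); first exact: cvg_cst.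
  by apply: cvgB; [apply: cvgMr; exact: cg|exact: cvg_cst].
pose A : set Y := f @^-1` [set r | 2^-1 <= r].
have cA : closed A by apply: (closed_comp _ (@closed_ge R 2^-1)) => y _; exact: cf.
have suppA : closure [set x | phi x != 0] `<=` Some @^-1` A.
  have cA' : closed (Some @^-1` A : set X).
    apply: (closed_comp _ (@closed_ge R 2^-1)) => y _; exact: cg.
  rewrite closure_id in cA'; rewrite cA'; apply: closureS => x /=.
  rewrite /phi /A /= /g; case: (leP (2 * f (Some x) - 1) 0) => [le0|gt0 _].
    by rewrite eqxx.
  by move: gt0; rewrite subr_gt0 => /ltW; rewrite -ler_pdivrMl// mulr1.
have AU y : A y -> (Some @` U) y.
  move=> Ay; apply: contrapT => nUy.
  have : f y = 0 by apply: f0; exists y.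
  by move: Ay; rewrite /A /= => + fy; rewrite fy leNgt invr_gt0 ltr0n.
exists phi; split => //.
- move=> x; rewrite /phi le_max lexx/= ge_max ler01/= lerBlDr.
  have /andP[_ g1] := f01 (Some x).
  by rewrite -mulr2n -[leRHS]mulr_natr mul1r ler_piMr.
- move=> x Kx; rewrite /phi /g (_ : f (Some x) = 1).
    by rewrite mulr1 (_ : 2 - 1 = 1 :> R) ?max_r//; apply/eqP; rewrite subr_eq.
  by apply: f1; exists (Some x) => //; exists x.
- apply: (@subclosed_compact _ _ _ (@closed_closure _ _) _ suppA).
  by apply: compact_opc_preimage => // /AU [].
- by move=> x /suppA /AU [z Uz [<-]].
Qed.

(** Extending [k] by 0 at infinity keeps it continuous on the closed set [A], because [k] vanishes
    on [C] outside the compact [K]. The bounded extension supplied by normality of [Y] is multiplied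
    by a cutoff equal to 1 on [K], which gives it compact support. *)
Lemma tietze_Cc (C K : set X) (k : X -> R) : closed C -> compact K ->
  {within C, continuous k} -> (forall x, C x -> ~ K x -> k x = 0) ->
  exists g : X -> R, [/\ continuous g, compact (closure [set x | g x != 0]) &
    forall x, C x -> g x = k x].
Proof.
move=> cC cK ck k0.
have cKc : closed K by exact: compact_closed.
pose A : set Y := Some @` C `|` [set None].
have cA : closed A by exact: closed_opc_None.
pose f : Y -> R := fun y => if y is Some x then k x else 0.
have ckK : compact (k @` (C `&` K)).
  apply: continuous_compact; last by rewrite setIC; exact: compact_closedI.
  by apply: continuous_subspaceW ck => x [].
have [M [_ Mk]] := compact_bounded ckK.
have [M0 M0gt M0k] : exists2 M0 : R, 0 < M0 & forall y, A y -> `|f y| <= M0.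
  exists (`|M| + 1) => [|y]; first by rewrite ltr_wpDl.
  case=> [[x Cx <-]|->]; last by rewrite /= normr0.
  have [Kx|nKx] := pselect (K x); last by rewrite /= k0// normr0.
  apply: (Mk (`|M| + 1)) => /=; last by exists x.
  by rewrite (le_lt_trans (ler_norm M))// ltrDl.
have cf : {within A, continuous f}.
  apply/subspace_continuousP => y [[x Cx <-]|->].
    move/subspace_continuousP: ck => /(_ x Cx) ckx.
    move=> B /ckx kB; rewrite /f.
    move: kB; rewrite /nbhs /= /within /= !nbhs_simpl /=.
    apply: filterS => z CB [[w Cw [wz]]|//]; apply: CB; by rewrite -wz.
  move=> B /nbhs_singleton B0.
  exists K; first by split.
  move=> z [[x nKx <-]|->] //= [[w Cw [wx]]|//].
  have kx : k x = 0 by apply: k0 => //; rewrite -wx.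
  by move: B0; rewrite /from_subspace /f kx.
have [g [gf cg _]] := @continuous_bounded_extension Y R opc_normal A cA f M0 M0gt cf M0k.
have [phi [cphi phi01 phi1 cpt _]] := @urysohn_Cc K setT cK openT (@subsetT _ K).
exists (fun x => phi x * g (Some x)); split.
- move=> x; apply: cvgM; first exact: cphi.
  exact: (@continuous_comp X Y R Some g x (@one_point_compactification_some_continuous X x) (cg (Some x))).
- apply: (compact_closureS cpt) => x /=.
  by apply: contra_neq => ->; rewrite mul0r.
- move=> x Cx; have -> : g (Some x) = k x.
    by rewrite -gf//; apply/mem_set; left; exists x.
  have [Kx|nKx] := pselect (K x); first by rewrite phi1// mul1r.
  by rewrite k0// mulr0.
Qed.

Lemma tietze_Cc_complex (C K : set X) (k : X -> Cplx R) : closed C -> compact K ->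
  {within C, continuous k} -> (forall x, C x -> ~ K x -> k x = 0) ->
  exists2 g : X -> Cplx R, Cc g & forall x, C x -> g x = k x.
Proof.
move=> cC cK /subspace_continuousP ck k0.
have [||g1 [cg1 cpt1 g1k]] := @tietze_Cc C K (fun x => complex.Re (k x)) cC cK.
- by apply/subspace_continuousP => x Cx; apply: cvg_Re; exact: ck.
- by move=> x Cx nKx /=; rewrite k0.
have [||g2 [cg2 cpt2 g2k]] := @tietze_Cc C K (fun x => complex.Im (k x)) cC cK.
- by apply/subspace_continuousP => x Cx; apply: cvg_Im; exact: ck.
- by move=> x Cx nKx /=; rewrite k0.
exists (fun x => Complex (g1 x) (g2 x)).
  split=> [x|]; first by apply: cvg_Complex; [exact: cg1|exact: cg2].
  have := compactU cpt1 cpt2; rewrite -closureU => cpt.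
  apply: (compact_closureS cpt) => x /=; have [->|] := eqVneq (g1 x) 0; last by left.
  have [->|] := eqVneq (g2 x) 0; last by right.
  by rewrite eqxx.
by move=> x Cx; rewrite g1k// g2k//=; apply: complex_eq.
Qed.

End locally_compact.

(** * Measurability and integrability of continuous functions *)

Section borel_measurability.
Variables (R : realType) (T : topologicalType) (t : T).

Lemma borel_open (U : set T) : open U -> measurable (U : set (borel t)).
Proof. by move=> oU; exact: sub_sigma_algebra. Qed.

Lemma borel_closed (C : set T) : closed C -> measurable (C : set (borel t)).
Proof.
move=> cC; rewrite -[X in measurable X]setCK; apply: measurableC.
by apply: borel_open; exact: closed_openC.
Qed.

Lemma within_continuous_borel (D : set T) (f : T -> R) :
  measurable (D : set (borel t)) -> {within D, continuous f} ->
  measurable_fun (D : set (borel t)) (f : borel t -> R).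
Proof.
move=> mD /continuousP cf; apply: (measurability _ (measurable_realfun.RGenOpens.measurableE R)).
move=> _ [_ [a [b ->] <-]].
have oab : open (`]a, b[%classic : set R) by exact: interval_open.
case/open_subspaceP : (cf _ oab) => V oV DV.
have -> : D `&` f @^-1` `]a, b[%classic = V `&` D by rewrite DV setIC.
by apply: measurableI => //; exact: borel_open.
Qed.

Lemma continuous_borel (f : T -> R) : continuous f ->
  measurable_fun ([set: T] : set (borel t)) (f : borel t -> R).
Proof.
move=> cf; apply: within_continuous_borel => //; exact: continuous_subspaceT.
Qed.

Lemma continuous_borel_map (T' : topologicalType) (t' : T') (f : T -> T') :
  continuous f -> measurable_fun [set: borel t] (f : borel t -> borel t').
Proof.
move=> /continuousP cf; apply: (@measurability _ _ (borel t) (borel t') setT f (@open T')) => //.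
by move=> _ [B oB <-]; rewrite setTI; apply: borel_open; exact: cf.
Qed.
End borel_measurability.

Section radon_integrable.
Variables (R : realType) (T : topologicalType) (t : T).
Variable m : {measure set (borel t) -> \bar R}.
Hypothesis hT : hausdorff_space T.
Hypothesis rm : radon m.

Lemma radon_compact_fin (K : set T) : compact K -> (m K < +oo)%E.
Proof. exact: radon_finite. Qed.

Lemma within_continuous_integrable (D K : set T) (f : T -> R) :
  closed D -> compact K -> {within D, continuous f} ->
  (forall x, D x -> ~ K x -> f x = 0) ->
  m.-integrable (D : set (borel t)) (fun x => (f x)%:E).
Proof.
move=> cD cK cf f0.
have mD : measurable (D : set (borel t)) by exact: borel_closed.
have mK : measurable (K : set (borel t)) by apply: borel_closed; exact: compact_closed.
have mDK : measurable (D `&` K : set (borel t)) by exact: measurableI.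
have cDK : compact (D `&` K) by rewrite setIC; exact: compact_closedI.
have cfDK : {within D `&` K, continuous f}.
  by apply: continuous_subspaceW cf => x [].
have ifK : m.-integrable (D `&` K : set (borel t)) (EFin \o f).
  apply: measurable_bounded_integrable => //.
  - exact: radon_compact_fin.
  - exact: within_continuous_borel.
  - have [M [Mr Mb]] := compact_bounded (continuous_compact cfDK cDK).
    by exists M; split => // M' MM' x DKx; apply: (Mb _ MM'); exists x.
apply/(integrable_mkcond _ mD).2.
have -> : (fun x => (f x)%:E) \_ D = (EFin \o f) \_ (D `&` K : set (borel t)).
  apply/funext => x; rewrite /patch; case: ifPn => xD; case: ifPn => xDK //.
  - have Dx := set_mem xD; rewrite f0// => Kx.
    by move/negP: xDK; apply; apply/mem_set.
  - by exfalso; move: xDK => /set_mem[Dx _]; move/negP: xD; apply; apply/mem_set.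
exact/(integrable_mkcond _ mDK).1.
Qed.
End radon_integrable.

Section Cc.
Variables (R : realType) (T : topologicalType).
Local Notation C := (Cplx R).
Implicit Types f g : T -> C.

Definition csupp f := closure [set x | f x != 0].

Lemma csuppN f x : ~ csupp f x -> f x = 0.
Proof.
move=> nx; apply: contrapT => /eqP fx; apply: nx.
exact: subset_closure.
Qed.

Lemma Cc_sub f (K : set T) : hausdorff_space T -> continuous f -> compact K ->
  (forall x, ~ K x -> f x = 0) -> Cc f.
Proof.
move=> hT cf cK f0; split => //.
apply: (@compact_closureS _ _ K).
  by rewrite -(closure_id _).1//; exact: compact_closed.
by move=> x /= fx; apply: contrapT => /f0 /eqP; apply/negP.
Qed.

Lemma Cc_lin (a : C) f g : Cc f -> Cc g -> Cc (a *: f + g).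
Proof.
move=> [cf cptf] [cg cptg]; split.
  by move=> x; apply: cvgD; [apply: cvgMr; exact: cf|exact: cg].
have := compactU cptf cptg; rewrite -closureU => cpt.
apply: (compact_closureS cpt) => x /=.
have [gx|] := eqVneq (g x) 0; last by right.
have [fx|] := eqVneq (f x) 0; last by left.
by rewrite /GRing.add/= /GRing.scale/= fx gx scaler0 addr0 eqxx.
Qed.

Lemma Cc_real f (u : T -> R) : Cc f -> continuous u ->
  (forall x, f x = 0 -> u x = 0) -> Cc (fun x => ((u x)%:C)%C : C).
Proof.
move=> [cf cptf] cu u0; split; first by move=> x; apply: cvg_real_complex; exact: cu.
apply: (compact_closureS cptf) => x /=; apply: contra_neq => /u0 ->//.
Qed.
End Cc.

(** * Linearity of complex-valued integrals *)

Section cintegral.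
Variables (R : realType) (T : topologicalType) (t : T).
Variable m : {measure set (borel t) -> \bar R}.
Variable D : set T.
Hypothesis mD : measurable (D : set (borel t)).
Local Notation C := (Cplx R).
Implicit Types f g : T -> C.

Definition cintegrable f :=
  m.-integrable (D : set (borel t)) (fun x => (complex.Re (f x))%:E) /\
  m.-integrable (D : set (borel t)) (fun x => (complex.Im (f x))%:E).

Lemma eq_cintegral f g : (forall x, D x -> f x = g x) ->
  cintegral m D f = cintegral m D g.
Proof.
move=> fg; congr Complex; congr fine; apply: eq_integral => x /set_mem Dx;
  by rewrite fg.
Qed.

Lemma fine_integral_lin (a b : R) (u v : T -> R) :
  m.-integrable (D : set (borel t)) (fun x => (u x)%:E) ->
  m.-integrable (D : set (borel t)) (fun x => (v x)%:E) ->
  m.-integrable (D : set (borel t)) (fun x => (a * u x + b * v x)%:E) /\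
  fine (\int[m]_(x in (D : set (borel t))) (a * u x + b * v x)%:E) =
  a * fine (\int[m]_(x in (D : set (borel t))) (u x)%:E) +
  b * fine (\int[m]_(x in (D : set (borel t))) (v x)%:E).
Proof.
move=> iu iv.
have iau := integrableZl mD a iu; have ibv := integrableZl mD b iv.
split; first by have := integrableD mD iau ibv.
rewrite -[X in fine X]/(integral m D (fun x => a%:E * (u x)%:E + b%:E * (v x)%:E)%E).
rewrite integralD// !integralZl// fineD ?fin_numM//;
  try (exact: integrable_fin_num).
by rewrite !fineM//; exact: integrable_fin_num.
Qed.

Lemma cintegral_lin (a : C) f g : cintegrable f -> cintegrable g ->
  cintegrable (fun x => a * f x + g x) /\
  cintegral m D (fun x => a * f x + g x) = a * cintegral m D f + cintegral m D g.
Proof.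
move=> [rf jf] [rg jg].
have [i1 e1] := fine_integral_lin (complex.Re a) (- complex.Im a) rf jf.
have [i2 e2] := fine_integral_lin (complex.Re a) (complex.Im a) jf rf.
have [i3 e3] := fine_integral_lin 1 1 i1 rg.
have [i4 e4] := fine_integral_lin 1 1 i2 jg.
have E1 : (fun x => (complex.Re (a * f x + g x))%:E) =
    (fun x : T => (1 * (complex.Re a * complex.Re (f x) + - complex.Im a * complex.Im (f x)) + 1 * complex.Re (g x))%:E).
  by apply/funext => x; rewrite cReD cReM !mul1r mulNr.
have E2 : (fun x => (complex.Im (a * f x + g x))%:E) =
    (fun x : T => (1 * (complex.Re a * complex.Im (f x) + complex.Im a * complex.Re (f x)) + 1 * complex.Im (g x))%:E).
  by apply/funext => x; rewrite cImD cImM !mul1r.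
split; first by rewrite /cintegrable E1 E2.
by rewrite /cintegral E1 E2 e3 e4 e1 e2; apply: complex_eq;
  rewrite (cReD, cImD) (cReM, cImM) /= !mul1r ?mulNr.
Qed.

Lemma cintegral0 : cintegral m D (fun=> 0) = 0.
Proof. by rewrite /cintegral/= integral0. Qed.

Lemma cintegrable0 : cintegrable (fun=> 0).
Proof. by split; exact: integrable0. Qed.

Lemma cintegralZ (a : C) f : cintegrable f ->
  cintegral m D (fun x => a * f x) = a * cintegral m D f.
Proof.
move=> fi; have [_] := cintegral_lin a fi cintegrable0.
rewrite cintegral0 addr0 => <-; apply: eq_cintegral => x _; by rewrite addr0.
Qed.

End cintegral.

(** * Square-integrable functions *)

Section l2_norm.
Variables (R : realType) (T : topologicalType) (t : T).
Variable m : {measure set (borel t) -> \bar R}.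
Variable D : set T.
Hypothesis mD : measurable (D : set (borel t)).
Local Notation C := (Cplx R).
Local Notation B := (borel t).
Implicit Types f g : T -> C.

Definition l2sq f : \bar R :=
  (\int[m]_(x in (D : set B)) ((complex.Re `|f x|) ^+ 2)%:E)%E.
Definition l2nrm f : \bar R := (l2sq f `^ 2^-1)%E.

Definition cmeas f := measurable_fun (D : set B) (fun x : B => complex.Re (f x)) /\
  measurable_fun (D : set B) (fun x : B => complex.Im (f x)).

Lemma cmeas_lin (a : C) f g : cmeas f -> cmeas g -> cmeas (a *: f + g).
Proof.
move=> [rf jf] [rg jg]; split.
  have -> : (fun x : B => complex.Re ((a *: f + g) x)) = (fun x : B =>
     (complex.Re a * complex.Re (f x) - complex.Im a * complex.Im (f x)) + complex.Re (g x)).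
    by apply/funext => x; rewrite cReD cReM.
  apply: measurable_funD => //; apply: measurable_funB; exact: measurable_funM.
have -> : (fun x : B => complex.Im ((a *: f + g) x)) = (fun x : B =>
     (complex.Re a * complex.Im (f x) + complex.Im a * complex.Re (f x)) + complex.Im (g x)).
  by apply/funext => x; rewrite cImD cImM.
by apply: measurable_funD => //; apply: measurable_funD; exact: measurable_funM.
Qed.

Lemma cmeas0 : cmeas 0.
Proof. by split; exact: measurable_cst. Qed.

Lemma cmeasZ (a : C) f : cmeas f -> cmeas (a *: f).
Proof. by move=> mf; rewrite -[a *: f]addr0; apply: cmeas_lin => //; exact: cmeas0. Qed.

Lemma cmeasD f g : cmeas f -> cmeas g -> cmeas (f + g).
Proof. by move=> mf mg; rewrite -[f]scale1r; exact: cmeas_lin. Qed.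

Lemma cmeasB f g : cmeas f -> cmeas g -> cmeas (f - g).
Proof. by move=> mf mg; rewrite addrC -scaleN1r; exact: cmeas_lin. Qed.

Lemma cmeas_norm f : cmeas f -> measurable_fun (D : set B) (fun x : B => complex.Re `|f x|).
Proof.
move=> [rf jf]; under eq_fun do rewrite Re_norm -powR12_sqrt ?addr_ge0 ?sqr_ge0//.
apply: (measurableT_comp (measurable_powR 2^-1)).
by apply: measurable_funD; under eq_fun do rewrite expr2; exact: measurable_funM.
Qed.

Lemma cmeas_sq f : cmeas f ->
  measurable_fun (D : set B) (fun x : B => ((complex.Re `|f x|) ^+ 2)%:E).
Proof.
move=> /cmeas_norm mf; apply/measurable_EFinP.
by under eq_fun do rewrite expr2; exact: measurable_funM.
Qed.

Lemma l2sq_ge0 f : (0 <= l2sq f)%E.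
Proof. by apply: integral_ge0 => x _; rewrite lee_fin sqr_ge0. Qed.

Lemma l2nrm_ge0 f : (0 <= l2nrm f)%E.
Proof. exact: poweR_ge0. Qed.

Lemma l2nrm_le f (e : R) : 0 <= e ->
  (l2nrm f <= e%:E)%E = (l2sq f <= (e ^+ 2)%:E)%E.
Proof.
move=> e0; rewrite /l2nrm poweR12_sqrt ?l2sq_ge0//.
case: (l2sq f) (l2sq_ge0 f) => [r|//|//] /=; rewrite !lee_fin => r0.
by rewrite -[LHS](@ler_pXn2r _ 2)// ?nnegrE ?sqrtr_ge0// sqr_sqrtr.
Qed.

Lemma l2nrm_lty f : (l2nrm f < +oo)%E = (l2sq f < +oo)%E.
Proof.
rewrite /l2nrm poweR12_sqrt ?l2sq_ge0//.
by case: (l2sq f) (l2sq_ge0 f) => [r|//|//] /=; rewrite !ltry.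
Qed.

Lemma l2nrm_sq f : (l2nrm f < +oo)%E -> l2sq f = ((fine (l2nrm f)) ^+ 2)%:E.
Proof.
rewrite l2nrm_lty /l2nrm poweR12_sqrt ?l2sq_ge0//.
case: (l2sq f) (l2sq_ge0 f) => [r|//|//] /=; rewrite lee_fin => r0 _.
by rewrite sqr_sqrtr.
Qed.

Lemma l2nrm0 : l2nrm 0 = 0%E.
Proof.
rewrite /l2nrm /l2sq (eq_integral (cst 0%E)) ?integral0 ?poweR0r//.
by move=> x _; rewrite normr0 expr0n.
Qed.

Let nD f : T -> R := (fun x => complex.Re `|f x|) \_ D.

(** Brings the norm on [D] into the form of an L^2 norm over the whole space, of the modulus
    extended by 0, to which Minkowski's inequality applies. *)
Lemma l2nrmE f : l2nrm f = ('N[m]_2%:E[EFin \o (nD f : B -> R)])%E.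
Proof.
rewrite unlock /l2nrm /l2sq; congr (_ `^ _)%E.
rewrite [in LHS]integral_mkcond; apply: eq_integral => x _.
rewrite /= /nD /patch; case: ifPn => _; last by rewrite normr0 powR0.
by rewrite powR_mulrn ?normr_ge0// real_normK// num_real.
Qed.

Lemma l2nrmD f g : cmeas f -> cmeas g -> (l2nrm (f + g)%R <= l2nrm f + l2nrm g)%E.
Proof.
move=> mf mg.
have mn k : cmeas k -> measurable_fun [set: B] (nD k : B -> R).
  by move=> mk; exact: (measurable_restrictT (fun x : B => complex.Re `|k x|) mD).1 (cmeas_norm mk).
rewrite [X in (_ <= X + _)%E]l2nrmE [X in (_ <= _ + X)%E]l2nrmE.
apply: le_trans (minkowski_EFin m (mn _ mf) (mn _ mg) _); last by rewrite ler1n.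
rewrite /l2nrm /l2sq unlock; apply: gt0_ler_poweR; rewrite ?invr_ge0 ?ler0n//.
- by rewrite in_itv/= l2sq_ge0 leey.
- by rewrite in_itv/= leey andbT; apply: integral_ge0 => x _; rewrite lee_fin powR_ge0.
rewrite [leLHS]integral_mkcond; apply: (@ge0_le_integral _ B R m setT measurableT) => //.
- by move=> x _; rewrite /patch; case: ifPn => // _; rewrite lee_fin sqr_ge0.
- exact: (measurable_restrictT (fun x : B => (complex.Re `|(f + g)%R x| ^+ 2)%:E) mD).1 (cmeas_sq (cmeasD mf mg)).
- apply: (measurableT_comp (measurable_poweR 2)).
  apply: measurableT_comp => //; apply/measurable_EFinP.
  by apply: measurable_funD; exact: mn.
move=> x _; rewrite /= /nD /patch; case: ifPn => _; last by rewrite addr0 normr0 powR0.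
rewrite powR_mulrn ?normr_ge0// lee_fin ler_pXn2r// ?nnegrE ?Re_norm_ge0//.
by rewrite ger0_norm ?addr_ge0 ?Re_norm_ge0// Re_normD.
Qed.

Lemma l2nrmZ (a : C) f : cmeas f ->
  l2nrm (a *: f) = ((complex.Re `|a|)%:E * l2nrm f)%E.
Proof.
move=> mf; rewrite /l2nrm /l2sq.
have -> : (\int[m]_(x in (D : set B)) (complex.Re `|(a *: f) x| ^+ 2)%:E =
   (complex.Re `|a| ^+ 2)%:E * l2sq f)%E.
  rewrite /l2sq -ge0_integralZl_EFin ?sqr_ge0//.
  - by apply: eq_integral => x _; rewrite Re_normM exprMn.
  - by move=> x _; rewrite lee_fin sqr_ge0.
  - exact: cmeas_sq.
rewrite poweRM ?l2sq_ge0 ?lee_fin ?sqr_ge0//; congr (_ * _)%E.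
by rewrite poweR12_sqrt ?lee_fin ?sqr_ge0//= sqrtr_sqr ger0_norm ?Re_norm_ge0.
Qed.

Lemma l2nrmN f : l2nrm (- f) = l2nrm f.
Proof.
by congr (_ `^ _)%E; apply: eq_integral => x _; rewrite -[(- f) x]/(- f x) normrN.
Qed.

Lemma l2nrm_dist f g : l2nrm (f - g) = l2nrm (g - f).
Proof. by rewrite -l2nrmN opprB. Qed.

Lemma l2nrmB_tri f g k : cmeas f -> cmeas g -> cmeas k ->
  (l2nrm (f - k)%R <= l2nrm (f - g)%R + l2nrm (g - k)%R)%E.
Proof.
move=> mf mg mk; rewrite -[f - k](subrKA g); exact: l2nrmD (cmeasB mf mg) (cmeasB mg mk).
Qed.

Lemma l2nrm_eq0_le f g : cmeas f -> cmeas g -> l2nrm (f - g) = 0%E ->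
  (l2nrm f <= l2nrm g)%E.
Proof.
move=> mf mg fg0; have := l2nrmD (cmeasB mf mg) mg.
by rewrite subrK fg0 add0e.
Qed.

Lemma l2nrm_eq0 f g : cmeas f -> cmeas g -> l2nrm (f - g) = 0%E ->
  l2nrm f = l2nrm g.
Proof.
move=> mf mg fg0; apply/eqP; rewrite eq_le l2nrm_eq0_le//=.
by rewrite l2nrm_eq0_le// l2nrm_dist.
Qed.
End l2_norm.

(** * Completeness of L^2 *)

Section riesz_fischer.
Variables (R : realType) (T : topologicalType) (t : T).
Variable m : {measure set (borel t) -> \bar R}.
Variable D : set T.
Hypothesis mD : measurable (D : set (borel t)).
Local Notation C := (Cplx R).
Local Notation B := (borel t).
Local Notation nrm := (l2nrm m D).

Lemma cvg_geometric_increments (u : R ^nat) (M : R) :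
  (forall n, `|u n.+1 - u n| <= M * 2^-1 ^+ n) -> cvgn u.
Proof.
move=> uM; have cs : cvgn (series (telescope u)).
  apply: normed_cvg; apply: (@series_le_cvg _ _ (geometric M 2^-1)).
  - by move=> n /=; exact: normr_ge0.
  - by move=> n /=; apply: le_trans (uM n).
  - by move=> n; exact: uM.
  - by apply: is_cvg_geometric_series; rewrite ger0_norm ?invr_ge0// invf_lt1// ltr1n.
have -> : u = (fun n => u 0%N + series (telescope u) n).
  by apply/funext => n; rewrite -eq_sum_telescope.
by apply: is_cvgD => //; exact: is_cvg_cst.
Qed.

(** Riesz-Fischer for a sequence with geometric increments: a weighted sum of the squared increments
    is integrable, hence finite almost everywhere, which forces pointwise convergence; Fatou's lemma
    then turns bounds along the sequence into bounds on the distance to the limit. *)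
Lemma l2_complete (g : nat -> T -> C) :
  (forall n, cmeas t D (g n)) ->
  (forall n, (nrm (g n.+1 - g n)%R <= (4^-1 ^+ n / 2)%:E)%E) ->
  exists2 k : T -> C, cmeas t D k &
    forall n, (nrm (k - g n)%R <= (4^-1 ^+ n)%:E)%E.
Proof.
move=> mg dg.
pose d n x := complex.Re `|(g n.+1 - g n) x|.
(* Squaring the increment bound leaves 16^-n / 4. The weight 4^n is small enough for the integrals
   to be summable and large enough to give d n x <= sqrt (W x) / 2^n wherever [W] is finite. *)
pose w n (x : B) := (4 ^+ n * d n x ^+ 2)%:E.
have w0 n x : D x -> (0 <= w n x)%E.
  by move=> _; rewrite lee_fin mulr_ge0 ?sqr_ge0// exprn_ge0.
have mw n : measurable_fun (D : set B) (w n).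
  apply/measurable_EFinP; apply: measurable_funM => //.
  by apply/measurable_EFinP; apply: cmeas_sq; exact: cmeasB.
pose W (x : B) := (\sum_(0 <= n <oo) w n x)%E.
have mW : measurable_fun (D : set B) W.
  exact: (@ge0_emeasurable_sum _ B R (D : set B) w xpredT (fun k x Dx _ => w0 k x Dx) (fun k _ => mw k)).
have W0 x : D x -> (0 <= W x)%E.
  by move=> Dx; apply: nneseries_ge0 => n _ _; exact: w0.
have iW : (\int[m]_(x in (D : set B)) W x < +oo)%E.
  rewrite integral_nneseries//.
  apply: (@le_lt_trans _ _ (\sum_(0 <= n <oo) (1 / (2 ^ (n + 1))%:R)%:E)%E); last first.
    have := @cvg_geometric_eseries_half R 1 0.
    by move=> /cvg_lim -> //; rewrite ltry.
  apply: lee_nneseries => [n _ _|n _].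
    by apply: integral_ge0 => x Dx; exact: w0.
  rewrite (_ : (\int[m]_(x in (D : set B)) w n x)%E = ((4 ^+ n)%:E * l2sq m D (g n.+1 - g n)%R)%E); last first.
    rewrite /l2sq -ge0_integralZl_EFin//.
    - by move=> x _; rewrite lee_fin sqr_ge0.
    - by apply: cmeas_sq; exact: cmeasB.
  have h4 : (0%R < (4 ^+ n)%:E :> \bar R)%E by rewrite lte_fin exprn_gt0.
  apply: (@le_trans _ _ ((4 ^+ n)%:E * ((4^-1 ^+ n / 2) ^+ 2)%:E)%E).
    by rewrite lee_pmul2l//; have := dg n; rewrite l2nrm_le// mulr_ge0// exprn_ge0.
  rewrite -EFinM lee_fin exprMn expr2 !mulrA -exprMn divff ?pnatr_eq0// expr1n mul1r.
  rewrite mul1r natrX exprD invfM expr1 -exprVn.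
  have h2 : (4^-1 : R) ^+ n <= 2^-1 ^+ n.
    by apply: lerXn2r; rewrite ?nnegrE ?invr_ge0//; rewrite lef_pV2 ?posrE// ler_nat.
  have h0 : 0 <= (4^-1 : R) ^+ n by rewrite exprn_ge0// invr_ge0.
  lra.
pose F : set B := (D : set B) `&` [set x | (W x < +oo)%E].
have mF : measurable F by exact: emeasurable_fun_infty_o.
have mDF : measurable ((D : set B) `\` F) by exact: measurableD.
have nullF : m ((D : set B) `\` F) = 0%E.
  have intW : m.-integrable (D : set B) W.
    apply/integrableP; split => //.
    by under eq_integral => x /set_mem Dx do rewrite gee0_abs ?W0//.
  have [N [mN N0 NW]] := integrable_ae mD intW.
  apply/eqP; rewrite eq_le measure_ge0 andbT -N0; apply: le_measure; rewrite ?inE//.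
  move=> x [Dx nFx]; apply: NW => /= /(_ Dx); rewrite ge0_fin_numE ?W0// => Wx.
  by apply: nFx; split.
have dW n x : F x -> d n x <= Num.sqrt (fine (W x)) * 2^-1 ^+ n.
  move=> [Dx Wx].
  have wW : (w n x <= W x)%E.
    have := @nneseries_lim_ge _ (w ^~ x) xpredT 0 n.+1 (fun k _ _ => w0 k x Dx).
    apply: le_trans; rewrite big_nat_recr//= leeDr// sume_ge0// => i _.
    exact: w0.
  have fW : (W x)%E \is a fin_num by rewrite ge0_fin_numE ?W0.
  have {}wW : 4 ^+ n * d n x ^+ 2 <= fine (W x) by rewrite -lee_fin fineK.
  have W0' : 0 <= fine (W x) by rewrite fine_ge0// W0.
  rewrite -(@ler_pXn2r _ 2)// ?nnegrE ?mulr_ge0 ?sqrtr_ge0 ?exprn_ge0 ?Re_norm_ge0 ?invr_ge0//.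
  rewrite exprMn sqr_sqrtr// -exprM mulnC exprM.
  have -> : (2^-1 : R) ^+ 2 = 4^-1 by rewrite exprVn -natrX.
  by rewrite -ler_pdivrMr ?exprn_gt0// exprVn invrK mulrC.
have cRe x : F x -> cvgn (fun n => complex.Re (g n x)).
  move=> Fx; apply: (@cvg_geometric_increments _ (Num.sqrt (fine (W x)))) => n.
  by apply: le_trans (dW n x Fx); rewrite -cReN -cReD; exact: le_Re_norm.
have cIm x : F x -> cvgn (fun n => complex.Im (g n x)).
  move=> Fx; apply: (@cvg_geometric_increments _ (Num.sqrt (fine (W x)))) => n.
  by apply: le_trans (dW n x Fx); rewrite -cImN -cImD; exact: le_Im_norm.
(* Multiplying by the indicator of the conull set [F] gives the value 0 where the sequence may
   diverge and keeps the limit measurable. *)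
pose k x : C := (((\1_F x : R)%:C)%C : C) *
  Complex (limn (fun n => complex.Re (g n x))) (limn (fun n => complex.Im (g n x))).
have kRe x : complex.Re (k x) = \1_F x * limn (fun n => complex.Re (g n x)).
  by rewrite cReM /= mul0r subr0.
have kIm x : complex.Im (k x) = \1_F x * limn (fun n => complex.Im (g n x)).
  by rewrite cImM /= mul0r addr0.
have kF x : F x -> (g n x) @[n --> \oo] --> k x.
  move=> Fx; have -> : (fun n => g n x) = (fun n => Complex (complex.Re (g n x)) (complex.Im (g n x))).
    by apply/funext => n; case: (g n x).
  have -> : k x = Complex (limn (fun n => complex.Re (g n x))) (limn (fun n => complex.Im (g n x))).
    by apply: complex_eq; rewrite ?kRe ?kIm indicE mem_set// mul1r.
  by apply: cvg_Complex; [exact: cRe|exact: cIm].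
have mk : cmeas t D k.
  have ind x (u : R ^nat) : (F x -> cvgn u) ->
      (\1_F x : R) * u n @[n --> \oo] --> \1_F x * limn u.
    move=> cu; rewrite indicE; case: (boolP (x \in F)) => [/set_mem /cu cFu|_].
      by apply: cvgMr.
    by rewrite mul0r; under eq_fun do rewrite mul0r; exact: cvg_cst.
  split.
    apply: (@measurable_realfun.measurable_fun_cvg _ _ _ _ (fun n x => \1_F x * complex.Re (g n x))).
      by move=> n; apply: measurable_funM; [exact: measurable_indic|exact: (mg n).1].
    by move=> x Dx; rewrite kRe; apply: ind; exact: cRe.
  apply: (@measurable_realfun.measurable_fun_cvg _ _ _ _ (fun n x => \1_F x * complex.Im (g n x))).
    by move=> n; apply: measurable_funM; [exact: measurable_indic|exact: (mg n).2].
  by move=> x Dx; rewrite kIm; apply: ind; exact: cIm.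
exists k => // n.
(* The subtracted term makes the induction close: one more increment costs at most 4^-(n+p) / 2,
   while the bound grows by 3/4 of 4^-(n+p). *)
have gtail p : (nrm (g (n + p)%N - g n)%R <= (4^-1 ^+ n - 4^-1 ^+ (n + p))%:E)%E.
  elim: p => [|p IH]; first by rewrite addn0 !subrr l2nrm0.
  apply: le_trans (l2nrmB_tri m mD (mg (n + p.+1)%N) (mg (n + p)%N) (mg n)) _.
  rewrite addnS; apply: le_trans (leeD (dg (n + p)%N) IH) _.
  rewrite -EFinD lee_fin addrC -addrA lerD2l exprS -lerBrDl opprK.
  set q := 4^-1 ^+ (n + p) : R; have q0 : 0 <= q by rewrite exprn_ge0.
  lra.
rewrite l2nrm_le ?exprn_ge0//.
have mkg : cmeas t D (k - g n) by exact: cmeasB.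
rewrite /l2sq (ge0_negligible_integral mDF mD)//; last 2 first.
- exact: cmeas_sq.
- by move=> x _; rewrite lee_fin sqr_ge0.
rewrite setDD setIC setIidl//; last by move=> x [].
pose f p (x : B) := ((complex.Re `|(g (n + p)%N - g n) x|) ^+ 2)%:E.
have mf p : measurable_fun (D : set B) (f p) by apply: cmeas_sq; exact: cmeasB.
(* On [F] the integrand is the pointwise limit, hence the lower limit, of the functions [f p]; this
   is the form that Fatou's lemma takes. *)
have -> : (\int[m]_(x in F) (complex.Re `|(k - g n)%R x| ^+ 2)%:E =
    \int[m]_(x in F) limn_einf (f ^~ x))%E.
  apply: eq_integral => x /set_mem Fx.
  have h : f p x @[p --> \oo] --> ((complex.Re `|(k - g n) x| ^+ 2)%:E)%E.
    apply: cvg_EFin; first by near=> p.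
    apply: (@cvg_comp _ _ _ (fun p => complex.Re `|(g (n + p)%N - g n) x|) (fun r : R => r ^+ 2) _ (nbhs (complex.Re `|(k - g n) x|))); last exact: exprn_continuous.
    apply: cvg_norm_Re; apply: cvgB; last exact: cvg_cst.
    have := kF x Fx; rewrite -(cvg_shiftn n) /=.
    by under eq_fun do rewrite addnC.
  by rewrite (cvg_limn_einf_sup h).1.
have mfF p : measurable_fun F (f p) by apply: measurable_funS (mf p) => // x [].
apply: le_trans (fatou m mF mfF _) _; first by move=> p x _; rewrite lee_fin sqr_ge0.
rewrite limn_einf_lim; apply: lime_le; first exact: is_cvg_einfs.
near=> p; apply: le_trans (_ : \int[m]_(x in F) f p x <= _)%E.
  by apply: ereal_inf_lbound; exists p => /=.
apply: (@le_trans _ _ (l2sq m D (g (n + p)%N - g n)%R)).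
  apply: ge0_subset_integral => //; last by move=> x [].
  by move=> x _; rewrite lee_fin sqr_ge0.
rewrite -l2nrm_le ?exprn_ge0//; apply: le_trans (gtail p) _.
by rewrite lee_fin gerBl exprn_ge0.
Unshelve. all: by end_near. Qed.
End riesz_fischer.

(** * Density of C_c in L^2 *)

Section Cc_dense.
Import HBSimple HBNNSimple.
Variables (R : realType) (T : topologicalType) (t : T).
Variable m : {measure set (borel t) -> \bar R}.
Variable D : set T.
Hypothesis mD : measurable (D : set (borel t)).
Hypothesis lcT : locally_compact [set: T].
Hypothesis hT : hausdorff_space T.
Hypothesis rm : radon m.
Local Notation C := (Cplx R).
Local Notation B := (borel t).
Local Notation nrm := (l2nrm m D).

Lemma Cc_cmeas (f : T -> C) : Cc f -> cmeas t D f.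
Proof.
move=> [cf _]; split; apply: measurable_funTS.
  by apply: continuous_borel => x; apply: cvg_Re; exact: cf.
by apply: continuous_borel => x; apply: cvg_Im; exact: cf.
Qed.

Lemma Cc0 : Cc (0 : T -> C).
Proof.
apply: (@Cc_sub R T 0 set0) => //; last exact: compact0.
by move=> x; exact: cvg_cst.
Qed.

(** The closure of C_c among measurable functions for the L^2 distance. It is stable under linear
    combinations and limits, so density can be reduced to indicators, simple functions and
    nonnegative functions in turn. *)
Definition Cc_approx (f : T -> C) := cmeas t D f /\
  forall e : R, 0 < e -> exists2 phi, Cc phi & (nrm (f - phi)%R <= e%:E)%E.

Lemma Cc_approx0 : Cc_approx 0.
Proof.
split; first exact: cmeas0.
by move=> e e0; exists 0; [exact: Cc0|rewrite subr0 l2nrm0 lee_fin ltW].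
Qed.

Lemma Cc_approx_lin (a : C) f g :
  Cc_approx f -> Cc_approx g -> Cc_approx (a *: f + g).
Proof.
move=> [mf af] [mg ag]; split; first exact: cmeas_lin.
move=> e e0; pose b := complex.Re `|a| + 1.
have b0 : 0 < b by rewrite ltr_wpDl// Re_norm_ge0.
have e20 : 0 < e / 2 by rewrite divr_gt0.
have [phi cphi fphi] := af (e / 2 / b) (divr_gt0 e20 b0).
have [psi cpsi gpsi] := ag (e / 2) e20.
exists (a *: phi + psi); first exact: Cc_lin.
have -> : a *: f + g - (a *: phi + psi) = a *: (f - phi) + (g - psi).
  by rewrite scalerBr opprD addrACA.
have mfp : cmeas t D (f - phi) by apply: cmeasB => //; exact: Cc_cmeas.
have mgp : cmeas t D (g - psi) by apply: cmeasB => //; exact: Cc_cmeas.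
have mz : cmeas t D (a *: (f - phi)) by exact: cmeasZ.
apply: le_trans (l2nrmD m mD mz mgp) _.
rewrite l2nrmZ// [e]splitr EFinD leeD//.
apply: (@le_trans _ _ ((complex.Re `|a|)%:E * (e / 2 / b)%:E)%E).
  by apply: lee_wpmul2l => //; rewrite lee_fin Re_norm_ge0.
rewrite -EFinM lee_fin mulrA ler_pdivrMr// mulrC ler_pM2l ?divr_gt0//.
by rewrite lerDl.
Qed.

Lemma Cc_approxD f g : Cc_approx f -> Cc_approx g -> Cc_approx (f + g).
Proof. by move=> af ag; rewrite -[f]scale1r; exact: Cc_approx_lin. Qed.

Lemma Cc_approxZ a f : Cc_approx f -> Cc_approx (a *: f).
Proof.
by move=> af; rewrite -[a *: f]addr0; apply: Cc_approx_lin => //; exact: Cc_approx0.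
Qed.

Lemma Cc_approx_lim f : cmeas t D f ->
  (forall e : R, 0 < e -> exists2 g, Cc_approx g & (nrm (f - g)%R <= e%:E)%E) ->
  Cc_approx f.
Proof.
move=> mf fg; split => // e e0; have e20 : 0 < e / 2 by rewrite divr_gt0.
have [g [mg ag] gf] := fg _ e20; have [phi cphi gphi] := ag _ e20.
exists phi => //; apply: le_trans (l2nrmB_tri m mD mf mg (Cc_cmeas cphi)) _.
by rewrite [e]splitr EFinD leeD.
Qed.

(** Outer regularity gives an open U around A with m (U \ A) <= d. Inner regularity, applied to the
    open set U, gives a compact K inside U, not necessarily inside A, with m (U \ K) <= d. For a
    cutoff phi between K and U the square of 1_A - phi is at most 1_(U \ A) + 1_(U \ K), so d = e^2
    / 2 is the right choice. *)
Lemma Cc_approx_indic (A : set B) : measurable A -> (m A < +oo)%E ->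
  Cc_approx (fun x => ((\1_A x : R)%:C)%C).
Proof.
move=> mA Afin; split.
  split => /=; first exact: measurable_indic.
  exact: measurable_cst.
move=> e e0; set d := e ^+ 2 / 2.
have d0 : 0 < d by rewrite divr_gt0// exprn_gt0.
have Af : m A \is a fin_num by rewrite ge0_fin_numE.
have [U [oU AU] mU] : exists2 U : set T, open U /\ A `<=` U & (m U < m A + d%:E)%E.
  have : (ereal_inf [set m U | U in [set U : set T | open U /\ A `<=` U]] < m A + d%:E)%E.
    by rewrite -(radon_outer rm mA) lteDl// lte_fin.
  by move=> /ereal_inf_lt[_ [U [oU AU] <-] h]; exists U.
have bU : measurable (U : set B) by exact: borel_open.
have Uf : m U \is a fin_num.
  by rewrite ge0_fin_numE// (lt_le_trans mU)// leey.
have [K [cK KU] mK] : exists2 K : set T, compact K /\ K `<=` U & (m U - d%:E < m K)%E.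
  have : (m U - d%:E < ereal_sup [set m K | K in [set K : set T | compact K /\ K `<=` U]])%E.
    rewrite -(radon_inner rm oU) lteBlDr// lteDl// lte_fin//.
  by move=> /ereal_sup_gt[_ [K [cK KU] <-] h]; exists K.
have bK : measurable (K : set B) by apply: borel_closed; exact: compact_closed.
have [phi [cphi phi01 phi1 cpt phiU]] := @urysohn_Cc R T lcT hT K U cK oU KU.
exists (fun x => ((phi x)%:C)%C : C).
  split; first by move=> x; apply: cvg_real_complex; exact: cphi.
  by apply: (compact_closureS cpt) => x /=; apply: contra_neq => ->.
rewrite l2nrm_le; last exact: ltW.
have mUA : measurable ((U : set B) `\` A) by exact: measurableD.
have mUK : measurable ((U : set B) `\` K) by exact: measurableD.
have UA : (m ((U : set B) `\` A) <= d%:E)%E.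
  rewrite measureD//; last by rewrite ltey_eq Uf.
  rewrite (setIidr AU) leeBlDl//; exact: ltW.
have UK : (m ((U : set B) `\` K) <= d%:E)%E.
  rewrite measureD//; last by rewrite ltey_eq Uf.
  rewrite (setIidr KU) leeBlDl ?(ltW)//; last first.
    have mKU : (m K <= m U)%E by apply: le_measure; rewrite ?inE.
    by rewrite ge0_fin_numE// (le_lt_trans mKU)// ltey_eq Uf.
  by move: mK; rewrite lteBlDr// => /ltW.
apply: (@le_trans _ _ (\int[m]_(x in (D : set B)) ((\1_(U `\` A) x)%:E + (\1_(U `\` K) x)%:E))%E).
  apply: ge0_le_integral => //.
  - by move=> x _; rewrite lee_fin sqr_ge0.
  - apply: cmeas_sq => //; apply: cmeasB => //.
      by split => /=; [exact: measurable_indic|exact: measurable_cst].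
    split => /=; last exact: measurable_cst.
    by apply: measurable_funTS; exact: continuous_borel.
  - by apply: emeasurable_funD; apply/measurable_EFinP; exact: measurable_indic.
  move=> x Dx; rewrite -EFinD lee_fin.
  have -> : ((fun x => ((\1_A x : R)%:C)%C : C) - (fun x => ((phi x)%:C)%C)) x = ((\1_A x - phi x)%:C)%C :> C.
    by apply: complex_eq => //=; rewrite subr0.
  rewrite norm_real_complex /= real_normK ?num_real// !indicE !in_setD.
  have /andP[p0 p1] := phi01 x.
  have [xU|xU] := boolP (x \in U); last first.
    have -> : phi x = 0.
      apply: contrapT => /eqP h; move/negP: xU; apply; apply/mem_set/phiU.
      exact: subset_closure.
    have -> : (x \in A) = false.
      by apply/negP => /set_mem /AU Ux; move/negP: xU; apply; exact/mem_set.
    by rewrite /= subr0 expr0n /= addr0.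
  have [xK|xK] := boolP (x \in K).
    rewrite (phi1 _ (set_mem xK)); case: (x \in A) => /=;
    by rewrite ?subrr ?expr0n ?sub0r ?sqrrN ?expr1n ?addr0 ?add0r.
  rewrite /=; case: (x \in A) => /=; nra.
rewrite ge0_integralD//; last 2 first.
- by apply/measurable_EFinP; exact: measurable_indic.
- by apply/measurable_EFinP; exact: measurable_indic.
rewrite !integral_indic//.
have -> : e ^+ 2 = d + d by rewrite /d -splitr.
rewrite EFinD; apply: leeD.
  by apply: le_trans UA; apply: le_measure; rewrite ?inE//; exact: measurableI.
by apply: le_trans UK; apply: le_measure; rewrite ?inE//; exact: measurableI.
Qed.

Lemma Cc_approx_sum (I : Type) (s : seq I) (f : I -> T -> C) :
  (forall i, Cc_approx (f i)) -> Cc_approx (fun x => \sum_(i <- s) f i x).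
Proof.
move=> af; have -> : (fun x => \sum_(i <- s) f i x) = \sum_(i <- s) f i.
  by apply/funext => x; rewrite fct_sumE.
elim/big_ind : _ => //; [exact: Cc_approx0|exact: Cc_approxD].
Qed.

(** Markov's inequality for the squared function shows that the level sets of nonzero values have
    finite measure; the level set of 0 may be infinite but contributes the zero function. *)
Lemma Cc_approx_nnsfun (f : {nnsfun B >-> R}) :
  (\int[m]_x ((f x) ^+ 2)%:E < +oo)%E -> Cc_approx (fun x => ((f x)%:C)%C).
Proof.
move=> fi.
have -> : (fun x => ((f x)%:C)%C : C) =
    (fun x => \sum_(y <- finmap.enum_fset (fset_set (range f))) ((y%:C)%C : C) * ((\1_(f @^-1` [set y]) x : R)%:C)%C).
  apply/funext => x; rewrite {1}(fimfunE f x) fsbig_finite//=.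
  have rD : {morph (fun r : R => (r%:C)%C : C) : a b / a + b >-> a + b}.
    by move=> a b; apply: complex_eq => //=; rewrite addr0.
  rewrite (big_morph _ rD (erefl _)); apply: eq_bigr => y _.
  by apply: complex_eq => /=; rewrite !(mul0r, mulr0, subr0, addr0).
apply: Cc_approx_sum => y.
have [->|y0] := eqVneq y 0.
  have -> : (fun x => ((0%:C)%C : C) * ((\1_(f @^-1` [set 0]) x : R)%:C)%C) = 0.
    by apply/funext => x; rewrite mul0r.
  exact: Cc_approx0.
apply: (@Cc_approxZ (y%:C)%C (fun x => ((\1_(f @^-1` [set y]) x : R)%:C)%C)).
apply: Cc_approx_indic; first exact: measurable_sfunP.
have y20 : 0 < y ^+ 2 by rewrite exprn_even_gt0.
have mf2 : measurable_fun [set: B] (fun x => ((f x) ^+ 2)%:E).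
  by apply/measurable_EFinP; apply: measurable_funX; exact: measurable_funP.
have := @le_integral_abse _ B R m setT measurableT _ _ mf2 y20.
rewrite setTI => h.
have fi' : (\int[m]_x `|((f x) ^+ 2)%:E| < +oo)%E.
  by under eq_integral => x _ do rewrite gee0_abs ?lee_fin ?sqr_ge0//.
have := le_lt_trans h fi'.
have mS : measurable [set x : B | ((y ^+ 2)%:E <= `|((f x) ^+ 2)%:E|)%E].
  have mf2a : measurable_fun [set: B] (fun x => `|((f x) ^+ 2)%:E|)%E by exact: measurableT_comp.
  have := emeasurable_fun_c_infty measurableT mf2a (y ^+ 2)%:E.
  by rewrite setTI.
move=> h2; apply: (@le_lt_trans _ _ (m [set x : B | ((y ^+ 2)%:E <= `|((f x) ^+ 2)%:E|)%E])).
  apply: le_measure; rewrite ?inE//.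
  by move=> x /= ->; rewrite lee_fin ler_norm.
move: h2; case: (m _) (measure_ge0 m [set x : B | ((y ^+ 2)%:E <= `|((f x) ^+ 2)%:E|)%E]) => [r _ _|_|//].
  by rewrite ltry.
by rewrite gt0_muley// lte_fin.
Qed.

(** Simple functions [g n] increasing to [f] converge to it in L^2 by dominated convergence, since
    (f - g n)^2 <= f^2. *)
Lemma Cc_approx_ge0 (f : T -> R) : measurable_fun (D : set B) (f : B -> R) ->
  (forall x, 0 <= f x) -> (\int[m]_(x in (D : set B)) ((f x) ^+ 2)%:E < +oo)%E ->
  Cc_approx (fun x => ((f x)%:C)%C).
Proof.
move=> mf f0 fi; pose F : B -> \bar R := (EFin \o f) \_ D.
have mF : measurable_fun [set: B] F.
  have mEf : measurable_fun (D : set B) (EFin \o f : B -> \bar R) by apply/measurable_EFinP.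
  exact: (measurable_restrictT (EFin \o f : B -> \bar R) mD).1 mEf.
have F0 x : (0 <= F x)%E by rewrite /F /patch; case: ifPn => // _; rewrite lee_fin.
pose g := nnsfun_approx measurableT mF.
have gF n x : ((g n x)%:E <= F x)%E.
  by rewrite /g nnsfun_approxE; apply: le_approx => // y _; exact: F0.
have gf n x : D x -> g n x <= f x.
  by move=> Dx; have := gF n x; rewrite /F /patch mem_set.
have cg x : D x -> g n x @[n --> \oo] --> f x.
  move=> Dx; have := @cvg_nnsfun_approx _ B R setT measurableT F mF (fun x _ => F0 x) x I.
  by rewrite {2}/F /patch mem_set//= => /fine_cvgP[].
have mfC : cmeas t D (fun x => ((f x)%:C)%C : C) by split => //=; exact: measurable_cst.
apply: Cc_approx_lim => // e e0.
have mgC n : cmeas t D (fun x => ((g n x)%:C)%C : C).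
  by split => //=; apply: measurable_funTS; exact: measurable_funP.
have nE n : l2sq m D ((fun x => ((f x)%:C)%C : C) - (fun x => ((g n x)%:C)%C)) =
    (\int[m]_(x in (D : set B)) ((f x - g n x) ^+ 2)%:E)%E.
  apply: eq_integral => x _; congr (_%:E).
  have -> : ((fun x => ((f x)%:C)%C : C) - (fun x => ((g n x)%:C)%C)) x = ((f x - g n x)%:C)%C :> C.
    by apply: complex_eq => //=; rewrite subr0.
  by rewrite norm_real_complex /= real_normK// num_real.
have mf2 : measurable_fun (D : set B) (fun x : B => ((f x) ^+ 2)%:E).
  by apply/measurable_EFinP; exact: measurable_funX.
have fi2 : m.-integrable (D : set B) (fun x : B => ((f x) ^+ 2)%:E).
  apply/integrableP; split => //.
  by under eq_integral => x _ do rewrite gee0_abs ?lee_fin ?sqr_ge0//.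
have : (\int[m]_(x in (D : set B)) ((f x - g n x) ^+ 2)%:E)%E @[n --> \oo] --> (\int[m]_(x in (D : set B)) 0%:E)%E.
  apply: (@dominated_cvg _ B R m (D : set B) mD (fun n x => ((f x - g n x) ^+ 2)%:E) _ (fun x => ((f x) ^+ 2)%:E)) => //.
  - move=> n; apply/measurable_EFinP; apply: measurable_funX.
    by apply: measurable_funB => //; apply: measurable_funTS; exact: measurable_funP.
  - move=> x Dx; apply: cvg_EFin; first by near=> n.
    rewrite (_ : 0 = (f x - f x) ^+ 2); last by rewrite subrr expr0n.
    apply: (@cvg_comp _ _ _ (fun n => f x - g n x) (fun r : R => r ^+ 2) _ (nbhs (f x - f x))); last exact: exprn_continuous.
    by apply: cvgB; [exact: cvg_cst|exact: cg].
  - move=> n x Dx; rewrite gee0_abs ?lee_fin ?sqr_ge0//.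
    rewrite ler_pXn2r ?nnegrE ?subr_ge0 ?gf//.
    by rewrite gerBl.
rewrite integral0 => /fine_cvgP[fin0 /cvgrPdist_lt /(_ (e ^+ 2))].
rewrite exprn_gt0// => /(_ isT) near0.
have [n [n1 n2]] : exists n, (\int[m]_(x in (D : set B)) ((f x - g n x) ^+ 2)%:E)%E \is a fin_num /\
   `|0 - fine (\int[m]_(x in (D : set B)) ((f x - g n x) ^+ 2)%:E)| < e ^+ 2.
  by have [n [n1 n2]] := filter_ex (filterI fin0 near0); exists n.
exists (fun x => ((g n x)%:C)%C).
  apply: Cc_approx_nnsfun; apply: le_lt_trans fi.
  rewrite [leRHS]integral_mkcond; apply: ge0_le_integral => //.
  - by move=> x _; rewrite lee_fin sqr_ge0.
  - by apply/measurable_EFinP; apply: measurable_funX; exact: measurable_funP.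
  - exact: (measurable_restrictT (fun x : B => ((f x) ^+ 2)%:E) mD).1 mf2.
  move=> x _; have := gF n x; rewrite /F /patch; case: ifPn => _ /=.
    by rewrite !lee_fin => h; rewrite ler_pXn2r ?nnegrE.
  rewrite !lee_fin => h; have -> : g n x = 0 by apply/eqP; rewrite eq_le h/=.
  by rewrite expr0n.
rewrite l2nrm_le; last exact: ltW.
rewrite nE -(fineK n1) lee_fin ltW//.
move: n2; rewrite sub0r normrN; apply: le_lt_trans; exact: ler_norm.
Unshelve. all: by end_near. Qed.

Theorem Cc_dense (f : T -> C) : cmeas t D f -> (nrm f < +oo)%E ->
  forall e : R, 0 < e -> exists2 phi, Cc phi & (nrm (f - phi)%R <= e%:E)%E.
Proof.
move=> [rf jf]; rewrite l2nrm_lty => fi.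
have pos (u : T -> R) : measurable_fun (D : set B) (u : B -> R) ->
    (forall x, u x ^+ 2 <= complex.Re `|f x| ^+ 2) ->
    Cc_approx (fun x => ((u x)%:C)%C).
  move=> mu uf.
  have part (v : T -> R) : measurable_fun (D : set B) (v : B -> R) ->
      (forall x, v x ^+ 2 <= u x ^+ 2) -> (forall x, 0 <= v x) ->
      Cc_approx (fun x => ((v x)%:C)%C).
    move=> mv vu v0; apply: Cc_approx_ge0 => //; apply: le_lt_trans fi.
    apply: ge0_le_integral => //.
    - by move=> x _; rewrite lee_fin sqr_ge0.
    - by apply/measurable_EFinP; exact: measurable_funX.
    - exact: cmeas_sq.
    - by move=> x _; rewrite lee_fin; apply: le_trans (uf x).
  have -> : (fun x => ((u x)%:C)%C : C) =
      (-1) *: (fun x => ((Num.max (- u x) 0)%:C)%C : C) + (fun x => ((Num.max (u x) 0)%:C)%C : C).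
    apply/funext => x; apply: complex_eq; rewrite ?cReD ?cImD ?cReM ?cImM /=; last first.
      by rewrite !(mulr0, mul0r, oppr0, addr0).
    rewrite oppr0 mul0r subr0 mulN1r.
    have [h|h] := leP 0 (u x).
      by rewrite max_r ?oppr_le0// oppr0 add0r.
    by rewrite max_l ?oppr_ge0 ?ltW// opprK addr0.
  apply: Cc_approx_lin; apply: part => //.
  - by apply: measurable_maxr => //; exact: measurableT_comp.
  - move=> x; have [h|h] := leP 0 (u x).
      by rewrite max_r ?oppr_le0// expr0n sqr_ge0.
    by rewrite max_l; [rewrite sqrrN|rewrite oppr_ge0 ltW].
  - by move=> x; rewrite le_max lexx orbT.
  - by apply: measurable_maxr.
  - move=> x; have [h|h] := leP 0 (u x); first by [].
    by rewrite expr0n sqr_ge0.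
  - by move=> x; rewrite le_max lexx orbT.
have sq (x : T) : complex.Re (f x) ^+ 2 <= complex.Re `|f x| ^+ 2 /\ complex.Im (f x) ^+ 2 <= complex.Re `|f x| ^+ 2.
  by rewrite sqr_Re_norm; split; [rewrite lerDl|rewrite lerDr]; exact: sqr_ge0.
have a1 := pos (fun x => complex.Re (f x)) rf (fun x => (sq x).1).
have a2 := pos (fun x => complex.Im (f x)) jf (fun x => (sq x).2).
have -> : f = ('i%C : C) *: (fun x => ((complex.Im (f x))%:C)%C : C) + (fun x => ((complex.Re (f x))%:C)%C : C).
  apply/funext => x; apply: complex_eq; rewrite ?cReD ?cImD ?cReM ?cImM /=.
    by rewrite mul0r mulr0 subr0 add0r.
  by rewrite mul0r mul1r add0r addr0.
exact: (Cc_approx_lin _ a2 a1).2.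
Qed.
End Cc_dense.

(** * Groupoids and twists *)

Section groupoid.
Variable S : lcgroupoid.
Implicit Types x y z u : S.

Lemma units_range x : units (grange x).
Proof. exact: grange_range. Qed.

Lemma units_source x : units (gsource x).
Proof. exact: grange_source. Qed.

Lemma source_unit u : units u -> gsource u = u.
Proof. by move=> uu; rewrite -[in RHS]uu -{1}uu gsource_range. Qed.

Lemma ginv_uniq x y : gsource x = grange y -> gmul x y = grange x -> y = ginv x.
Proof.
move=> xy e; have := gmulA (gsource_inv x) xy.
by rewrite e gmulVx xy gmul_range -(gsource_inv x) gmul_source.
Qed.

Lemma ginvK x : ginv (ginv x) = x.
Proof.
apply/esym/ginv_uniq; first by rewrite gsource_inv.
by rewrite gmulVx grange_inv.
Qed.

Lemma gmulVK x y : gsource x = grange y -> gmul (ginv x) (gmul x y) = y.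
Proof. by move=> xy; rewrite gmulA ?gsource_inv// gmulVx xy gmul_range. Qed.

Lemma gmulKV x y : grange x = grange y -> gmul x (gmul (ginv x) y) = y.
Proof.
by move=> xy; rewrite gmulA ?grange_inv ?gsource_inv// gmulV xy gmul_range.
Qed.

Lemma gmulK x y : gsource x = grange y -> gmul (gmul x y) (ginv y) = x.
Proof. by move=> xy; rewrite -gmulA ?grange_inv// gmulV -xy gmul_source. Qed.

(** Multiplication is continuous only within the composable pairs, so a limit of products needs
    composability along the filter as well as at the limit. *)
Lemma gmul_cvg T (F : set_system T) (FF : Filter F) (f g : T -> S) x y :
  f @ F --> x -> g @ F --> y -> gsource x = grange y ->
  (\forall t \near F, gsource (f t) = grange (g t)) ->
  gmul (f t) (g t) @[t --> F] --> gmul x y.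
Proof.
move=> fx gy xy fg.
have /subspace_continuousP/(_ (x, y) xy) c := @gmul_continuous S.
apply: cvg_trans c => B /= BW; rewrite /from_subspace /= in BW *.
have : F (fun t => nbhs (f t, g t) = nbhs (f t, g t)) by exact: filterE.
move=> _; rewrite nbhs_simpl/=.
have h : (fun t => (f t, g t)) @ F --> (x, y) by exact: cvg_pair.
have := h _ BW; rewrite nbhs_simpl /= => h2.
by apply: filterS2 fg h2 => t /= e; apply.
Qed.

Lemma grange_continuous : continuous (@grange S).
Proof.
move=> x; rewrite (_ : @grange S = (fun y => gmul y (ginv y))); last first.
  by apply/funext => y; rewrite gmulV.
apply: gmul_cvg; [exact: cvg_id|exact: ginv_continuous|by rewrite grange_inv|].
by apply: nearW => y; rewrite grange_inv.
Qed.

Lemma gsource_continuous : continuous (@gsource S).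
Proof.
move=> x; rewrite (_ : @gsource S = (fun y => grange (ginv y))); last first.
  by apply/funext => y; rewrite grange_inv.
apply: (@continuous_comp _ _ _ (@ginv S) (@grange S)); first exact: ginv_continuous.
exact: grange_continuous.
Qed.

Lemma closed_eq_continuous (X : topologicalType) (f g : X -> S) :
  continuous f -> continuous g -> closed [set x | f x = g x].
Proof.
move=> cf cg x clx; apply: (@garrow_hausdorff S) => A B fA gB.
have [y [/= e [Ay By]]] := clx _ (filterI (cf x A fA : nbhs x (f @^-1` A)) (cg x B gB : nbhs x (g @^-1` B))).
by exists (f y); split => //; rewrite e.
Qed.

Lemma closed_rfib u : closed (rfib u).
Proof.
by apply: closed_eq_continuous; [exact: grange_continuous|move=> x; exact: cvg_cst].
Qed.

Lemma closed_sfib u : closed (sfib u).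
Proof.
by apply: closed_eq_continuous; [exact: gsource_continuous|move=> x; exact: cvg_cst].
Qed.
End groupoid.
Arguments closed_rfib {S} u.
Arguments closed_sfib {S} u.

Section groupoid_morphism.
Variables (S H : lcgroupoid) (phi : S -> H).
Hypothesis hphi : groupoid_hom phi.

Lemma hom_mul x y : gsource x = grange y -> phi (gmul x y) = gmul (phi x) (phi y).
Proof. by move=> /hphi[]. Qed.

Lemma hom_comp x y : gsource x = grange y -> gsource (phi x) = grange (phi y).
Proof. by move=> /hphi[]. Qed.

(** Homomorphisms are only asked to respect composable products. A unit satisfies u u = u, so its
    image is idempotent, and cancellation shows that an idempotent of a groupoid is a unit. *)
Lemma hom_unit u : units u -> units (phi u).
Proof.
move=> uu; have su := source_unit uu.
have e : gsource u = grange u by rewrite su uu.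
have [c m] := hphi e.
have uu' : gmul u u = u by rewrite -{1}uu gmul_range.
have := gmulVK c; rewrite -m uu' gmulVx => h.
by rewrite /units /= -c h.
Qed.

Lemma hom_range x : grange (phi x) = phi (grange x).
Proof.
have c : gsource (grange x) = grange x by rewrite gsource_range.
by rewrite -(hom_comp c) source_unit//; exact/hom_unit/units_range.
Qed.

Lemma hom_source x : gsource (phi x) = phi (gsource x).
Proof.
have c : gsource x = grange (gsource x) by rewrite grange_source.
by rewrite (hom_comp c); exact/hom_unit/units_source.
Qed.

Lemma hom_inv x : phi (ginv x) = ginv (phi x).
Proof.
apply: ginv_uniq; first by rewrite hom_source hom_range grange_inv.
by rewrite -hom_mul ?grange_inv// gmulV hom_range.
Qed.
End groupoid_morphism.

(** * The action of the group on a twist *)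

Section twist.
Variables (G S : lcgroupoid) (Gam : topologicalZmodType) (E : twist G S Gam).
Implicit Types (x y z : S) (a b : Gam).
Local Notation pi := (tpi E).
Local Notation act := (tact E).
Local Notation io u a := (tiota E (u, a)).

Lemma tpi_unit x : units x -> units (pi x).
Proof. by move=> ux; apply: hom_unit => //; exact: tpi_hom. Qed.

Lemma tpi_range x : grange (pi x) = pi (grange x).
Proof. by apply: hom_range; exact: tpi_hom. Qed.

Lemma tpi_source x : gsource (pi x) = pi (gsource x).
Proof. by apply: hom_source; exact: tpi_hom. Qed.

Lemma tpi_inv x : pi (ginv x) = ginv (pi x).
Proof. by apply: hom_inv; exact: tpi_hom. Qed.

Lemma tpi_mul x y : gsource x = grange y -> pi (gmul x y) = gmul (pi x) (pi y).
Proof. by apply: hom_mul; exact: tpi_hom. Qed.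

Lemma tpi_unit_inj x y : units x -> units y -> pi x = pi y -> x = y.
Proof.
move=> ux uy e; have [[_ inj _] _] := tpi_units E.
by apply: inj; rewrite ?inE.
Qed.

Lemma tpi_unit_surj (u : G) : units u -> exists2 x : S, units x & pi x = u.
Proof.
move=> uu; have [_ im] := tpi_units E.
by move: uu; rewrite -im => -[x ux <-]; exists x.
Qed.

Lemma iota_source x a : gsource (io (pi (grange x)) a) = grange x.
Proof. exact: tcentral_l. Qed.

Lemma iota_range x a : grange (io (pi (grange x)) a) = grange x.
Proof.
have uu := tpi_unit (units_range x).
by have [<- _] := tiota_hom E (0 : Gam) a uu; rewrite iota_source.
Qed.

Lemma iota0 x : io (pi (grange x)) 0 = grange x.
Proof.
have [_ im] := tiota_units E.
have : units (io (pi (grange x)) (0 : Gam)).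
  by rewrite -im; exists (pi (grange x), 0) => //=; split => //; exact/tpi_unit/units_range.
by rewrite /units /= => <-; rewrite iota_range.
Qed.

Lemma tpi_iota x a : pi (io (pi (grange x)) a) = pi (grange x).
Proof.
have : (pi @^-1` @units G) (io (pi (grange x)) a).
  by rewrite -tiota_image; exists (pi (grange x), a) => //; exact/tpi_unit/units_range.
by rewrite /units /= => <-; rewrite tpi_range iota_range.
Qed.

Lemma range_act a x : grange (act a x) = grange x.
Proof. by rewrite /tact grange_mul ?iota_range ?iota_source. Qed.

Lemma source_act a x : gsource (act a x) = gsource x.
Proof. by rewrite /tact gsource_mul ?iota_source. Qed.

Lemma tpi_act a x : pi (act a x) = pi x.
Proof.
by rewrite /tact tpi_mul ?iota_source// tpi_iota -tpi_range gmul_range.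
Qed.

Lemma act0 x : act 0 x = x.
Proof. by rewrite /tact iota0 gmul_range. Qed.

Lemma actD a b x : act (a + b) x = act a (act b x).
Proof.
have -> : act a (act b x) = gmul (io (pi (grange x)) a) (act b x).
  by rewrite {1}/tact range_act.
rewrite {1}/tact; have [c ->] := tiota_hom E a b (tpi_unit (units_range x)).
by rewrite -gmulA ?iota_source ?iota_range.
Qed.

Lemma actNK a x : act (- a) (act a x) = x.
Proof. by rewrite -actD addNr act0. Qed.

Lemma act_mull a x y : gsource x = grange y -> gmul (act a x) y = act a (gmul x y).
Proof. by move=> xy; rewrite /tact -gmulA ?iota_source// grange_mul. Qed.

Lemma act_mulr a x y : gsource x = grange y -> gmul x (act a y) = act a (gmul x y).
Proof.
by move=> xy; rewrite -act_mull// /tact (tcentral E x a) xy -gmulA ?iota_range ?iota_source.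
Qed.

Lemma act_inv a x : ginv (act a x) = act (- a) (ginv x).
Proof.
apply/esym/ginv_uniq; first by rewrite source_act range_act grange_inv.
rewrite act_mulr ?source_act ?grange_inv// act_mull ?grange_inv// actNK.
by rewrite gmulV range_act.
Qed.

Lemma act_inj a b x : act a x = act b x -> a = b.
Proof.
rewrite /tact => e; have : io (pi (grange x)) a = io (pi (grange x)) b.
  by have := congr1 (fun z => gmul z (ginv x)) e; rewrite !gmulK ?iota_source.
have uu := tpi_unit (units_range x).
have [_ inj _] := tiota_embedding E => /inj.
by rewrite !inE => /(_ uu uu) [].
Qed.

(** The product y x^-1 lies over a unit, hence in the image of iota, and the group component of a
    preimage is the required [a]. The fibres of pi are therefore single orbits. *)
Lemma act_trans x y : pi x = pi y -> exists a, y = act a x.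
Proof.
move=> e.
have er : grange x = grange y.
  by apply: tpi_unit_inj; [exact: units_range|exact: units_range|rewrite -!tpi_range e].
have es : gsource x = gsource y.
  by apply: tpi_unit_inj; [exact: units_source|exact: units_source|rewrite -!tpi_source e].
have c : gsource y = grange (ginv x) by rewrite grange_inv.
have piz : pi (gmul y (ginv x)) = pi (grange x).
  by rewrite tpi_mul// tpi_inv -e gmulV tpi_range.
have : (pi @^-1` @units G) (gmul y (ginv x)).
  by rewrite /= piz; exact/tpi_unit/units_range.
rewrite -tiota_image => -[[u a] /= uu eu].
have [v uv vu] := tpi_unit_surj uu.
have uE : u = pi (grange x).
  by have {}vu : pi v = u by []; rewrite -piz -eu -vu -uv tpi_iota.
exists a; rewrite /tact -uE eu -gmulA//; last by rewrite gsource_inv.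
by rewrite gmulVx es gmul_source.
Qed.

Lemma act_cvg T (F : set_system T) (FF : Filter F) (f : T -> Gam) (g : T -> S) a x :
  f @ F --> a -> g @ F --> x -> act (f t) (g t) @[t --> F] --> act a x.
Proof.
move=> fa gx; rewrite /tact; apply: gmul_cvg => //; last first.
- by apply: nearW => t; rewrite iota_source.
- by rewrite iota_source.
have uu := tpi_unit (units_range x).
have [/subspace_continuousP/(_ (pi (grange x), a) uu) c _ _] := tiota_embedding E.
have gu : pi (grange (g t)) @[t --> F] --> pi (grange x).
  apply: (@cvg_comp _ _ _ (fun t => grange (g t)) pi _ (nbhs (grange x))); last exact: tpi_continuous.
  by apply: (@cvg_comp _ _ _ g (@grange S) _ (nbhs x)); last exact: grange_continuous.
have h : (fun t => (pi (grange (g t)), f t)) @ F --> (pi (grange x), a) by exact: cvg_pair.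
move=> B /c BW; have := h _ BW; rewrite !nbhs_simpl /=.
by apply: filterS => t /=; apply; exact/tpi_unit/units_range.
Qed.

Lemma act_continuous a : continuous (act a).
Proof. by move=> x; apply: act_cvg; [exact: cvg_cst|exact: cvg_id]. Qed.

(** Since [tpi E] is a quotient map, it suffices that the saturation of an open set is open; by
    transitivity on the fibres it is the union of the translates of that set. *)
Lemma tpi_open (U : set S) : open U -> open (pi @` U).
Proof.
move=> oU; apply: (@tpi_quotient _ _ _ E).
rewrite (_ : _ @^-1` _ = \bigcup_(a in [set: Gam]) (act a @^-1` U)).
  apply: bigcup_open => a _; apply: open_comp => // x _; exact: act_continuous.
apply/seteqP; split => [x [y Uy yx]|x [a _ Ux]] /=.
  have [a ay] := act_trans (esym yx); exists a => //=; by rewrite -ay.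
by exists (act a x) => //; rewrite tpi_act.
Qed.

Lemma tpi_nbhs (x : S) (M : set S) : nbhs x M -> nbhs (pi x) (pi @` M).
Proof.
rewrite !nbhsE => -[U [oU Ux] UM]; exists (pi @` U).
  by split; [exact: tpi_open|exists x].
exact: image_subset.
Qed.
End twist.

(** * Lifting cluster points, and properness of pi *)

Section twist_compact.
Variables (G S S' : lcgroupoid) (Gam Gam' : topologicalZmodType).
Variables (E : twist G S Gam) (E' : twist G S' Gam') (theta1 : S -> S').
Hypothesis theta1_pi : forall x, tpi E' (theta1 x) = tpi E x.
Hypothesis cGam' : compact [set: Gam'].

(* A limit point of [F] in [S'] lifts, up to the compact group [Gam'], along
   the open map [tpi E]. *)
Lemma twist_cluster_lift (F : set_system S') (FF : ProperFilter F) (x : S) :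
  cluster (tpi E' @ F) (tpi E x) ->
  exists b : Gam', forall A U M, F A -> nbhs b U -> nbhs x M ->
    exists b1 y, [/\ U b1, M y & A (tact E' b1 (theta1 y))].
Proof.
move=> clx.
(* For [A] in [F] and [M] near [x], openness of [tpi E] and transitivity on the fibres of [tpi E']
   give a group element carrying [theta1] of some point of [M] into [A]. The sets of such elements
   generate [P], and a cluster point of [P] is the required [b]. *)
pose P := filter_from [set AM : set S' * set S | F AM.1 /\ nbhs x AM.2]
  (fun AM => [set b | exists2 y, AM.2 y & AM.1 (tact E' b (theta1 y))]).
have PP : ProperFilter P.
  apply: filter_from_proper.
    apply: filter_from_filter; first by exists (setT, setT); split; exact: filterT.
    move=> [A1 M1] [A2 M2] [/= FA1 xM1] [/= FA2 xM2].
    exists (A1 `&` A2, M1 `&` M2); first by split; exact: filterI.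
    by move=> b /= [y [? ?] [? ?]]; split; exists y.
  move=> [A M] [/= FA xM].
  have FA' : (tpi E' @ F) (tpi E' @` A).
    rewrite /nbhs /=; apply: (@filterS _ F _ A _ _ FA) => z Az.
    by exists z.
  have [_ [[z Az <-] [y My yz]]] := clx _ _ FA' (tpi_nbhs E xM).
  have [b zb] := @act_trans _ _ _ E' (theta1 y) z (eq_trans (theta1_pi y) yz).
  by exists b; exists y => //; rewrite -zb.
have [b [_ clb]] := cGam' PP filterT.
exists b => A U M FA bU xM.
have PAM : P [set b | exists2 y, M y & A (tact E' b (theta1 y))] by exists (A, M).
by have [b1 [[y My Ay] Ub1]] := clb _ _ PAM bU; exists b1, y.
Qed.
End twist_compact.

(** Compactness of the group makes pi proper: a cluster point of the image filter lifts by
    [twist_cluster_lift], taken for a single twist and the identity map. *)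
Lemma tpi_proper (G S : lcgroupoid) (Gam : topologicalZmodType)
  (E : twist G S Gam) (L : set G) : compact [set: Gam] ->
  compact L -> compact (tpi E @^-1` L).
Proof.
move=> cGam cL F FF FL.
have PF : ProperFilter (tpi E @ F) by exact: fmap_proper_filter.
have [u [Lu clu]] := cL (tpi E @ F) PF FL.
have [x xu] := tpi_surjective E u; rewrite -xu in Lu clu.
have [a ha] := @twist_cluster_lift _ _ _ _ _ E E id (fun=> erefl) cGam F FF x clu.
exists (tact E a x); split; first by rewrite /= tpi_act.
move=> A B FA aB.
have h : tact E p.1 p.2 @[p --> (a, x)] --> tact E a x.
  by apply: act_cvg; [exact: cvg_fst|exact: cvg_snd].
have [[U M] /= [aU xM] UMB] := h _ aB.
have [b [y [Ub My Aby]]] := ha A U M FA aU xM.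
by exists (tact E b y); split => //; exact: (UMB (b, y)).
Qed.

Lemma compact_act (G S : lcgroupoid) (Gam : topologicalZmodType)
  (E : twist G S Gam) (K : set S) : compact [set: Gam] -> compact K ->
  exists L : set S, [/\ compact L, K `<=` L & forall a x, L x -> L (tact E a x)].
Proof.
move=> cGam cK; exists (tpi E @^-1` (tpi E @` K)); split.
- apply: tpi_proper => //; apply: continuous_compact => //.
  by apply: continuous_subspaceT; exact: tpi_continuous.
- by move=> x Kx; exists x.
- by move=> a x [y Ky e]; exists y => //; rewrite tpi_act.
Qed.

(** * Averaging over the compact group *)

Section cintegral_estimates.
Variables (R : realType) (T : topologicalType) (t : T).
Variable m : {measure set (borel t) -> \bar R}.
Variable D : set T.
Hypothesis mD : measurable (D : set (borel t)).
Local Notation C := (Cplx R).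
Local Notation B := (borel t).

Lemma le_fine_integral_dist (u v w : T -> R) :
  m.-integrable (D : set B) (fun x => (u x)%:E) ->
  m.-integrable (D : set B) (fun x => (v x)%:E) ->
  m.-integrable (D : set B) (fun x => (w x)%:E) ->
  (forall x, D x -> `|u x - v x| <= w x) ->
  `|fine (\int[m]_(x in (D : set B)) (u x)%:E) -
    fine (\int[m]_(x in (D : set B)) (v x)%:E)| <=
  fine (\int[m]_(x in (D : set B)) (w x)%:E).
Proof.
move=> iu iv iw uvw.
have fu := integrable_fin_num mD iu; have fv := integrable_fin_num mD iv.
have fw := integrable_fin_num mD iw.
rewrite -fineB// -integralB_EFin//.
have iuv : m.-integrable (D : set B) (fun x => ((u x)%:E - (v x)%:E)%E).
  exact: integrableB.
rewrite -fine_abse; last exact: integrable_fin_num.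
apply: fine_le => //; first by rewrite abse_fin_num; exact: integrable_fin_num.
apply: le_trans (le_abse_integral m mD (measurable_int m iuv)) _.
apply: ge0_le_integral => //.
- exact: measurableT_comp (measurable_int m iuv).
- exact: measurable_int iw.
Qed.

(** The factor 2 comes from estimating real and imaginary parts separately; it is harmless in the
    continuity proofs that this bound serves. *)
Lemma le_cintegral_dist (f g : T -> C) (w : T -> R) :
  cintegrable m D f -> cintegrable m D g ->
  m.-integrable (D : set B) (fun x => (w x)%:E) ->
  (forall x, D x -> complex.Re `|f x - g x| <= w x) ->
  complex.Re `|cintegral m D f - cintegral m D g| <=
  2 * fine (\int[m]_(x in (D : set B)) (w x)%:E).
Proof.
move=> [rf jf] [rg jg] iw fgw.
set z := cintegral m D f - cintegral m D g.
have zr : complex.Re z = fine (\int[m]_(x in (D : set B)) (complex.Re (f x))%:E) -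
    fine (\int[m]_(x in (D : set B)) (complex.Re (g x))%:E) by rewrite /z cReD cReN.
have zi : complex.Im z = fine (\int[m]_(x in (D : set B)) (complex.Im (f x))%:E) -
    fine (\int[m]_(x in (D : set B)) (complex.Im (g x))%:E) by rewrite /z cImD cImN.
clearbody z.
have -> : z = Complex (complex.Re z) 0 + Complex 0 (complex.Im z).
  by apply: complex_eq; rewrite !(cReD, cImD)/= ?addr0 ?add0r.
apply: le_trans (Re_normD _ _) _; rewrite mulr2n mulrDl mul1r lerD//.
  rewrite Re_norm /= expr0n/= addr0 sqrtr_sqr zr.
  apply: le_fine_integral_dist => // x Dx; rewrite -cReN -cReD.
  by apply: le_trans (fgw _ Dx); exact: le_Re_norm.
rewrite Re_norm /= expr0n/= add0r sqrtr_sqr zi.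
apply: le_fine_integral_dist => // x Dx; rewrite -cImN -cImD.
by apply: le_trans (fgw _ Dx); exact: le_Im_norm.
Qed.

Hypothesis hT : hausdorff_space T.
Hypothesis rm : radon m.

Lemma within_continuous_cintegrable (A K : set T) (f : T -> C) :
  closed A -> compact K -> {within A, continuous f} ->
  (forall x, A x -> ~ K x -> f x = 0) -> cintegrable m A f.
Proof.
move=> cA cK /subspace_continuousP cf f0; split.
  apply: (within_continuous_integrable hT rm cA cK).
    by apply/subspace_continuousP => x Ax; apply: cvg_Re; exact: cf.
  by move=> x Ax nKx; rewrite f0.
apply: (within_continuous_integrable hT rm cA cK).
  by apply/subspace_continuousP => x Ax; apply: cvg_Im; exact: cf.
by move=> x Ax nKx; rewrite f0.
Qed.

Lemma Cc_cintegrable (f : T -> C) : Cc f -> cintegrable m setT f.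
Proof.
move=> [cf cptf]; apply: (within_continuous_cintegrable closedT cptf).
  exact: continuous_subspaceT.
by move=> x _; exact: csuppN.
Qed.

Lemma Cc_real_integrable (u : T -> R) : Cc (fun x => ((u x)%:C)%C : C) ->
  m.-integrable setT (fun x : B => (u x)%:E).
Proof. by move=> /Cc_cintegrable[]. Qed.

Lemma cintegral_real (A : set T) (u : T -> R) :
  cintegral m A (fun x => ((u x)%:C)%C) =
  ((fine (\int[m]_(x in (A : set B)) (u x)%:E))%:C)%C.
Proof. by apply: complex_eq => //=; rewrite integral0. Qed.

Lemma cintegral_conull (f : T -> C) : m (~` D : set B) = 0%E -> Cc f ->
  cintegral m setT f = cintegral m D f.
Proof.
move=> m0 /Cc_cintegrable[rf jf].
have mCD : measurable (~` D : set B) by exact: measurableC.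
by rewrite /cintegral (negligible_integral mCD measurableT rf m0)
  (negligible_integral mCD measurableT jf m0) setTD setCK.
Qed.
End cintegral_estimates.

Section compact_group.
Variables (R : realType) (Gam : topologicalZmodType).
Hypothesis cGam : compact [set: Gam].
Hypothesis hGam : hausdorff_space Gam.
Variable h : {measure set (borel (0 : Gam)) -> \bar R}.
Hypothesis hh : normalized_haar h.
Local Notation C := (Cplx R).
Local Notation B := (borel (0 : Gam)).

Lemma haar_cintegrable (f : Gam -> C) : continuous f -> cintegrable h setT f.
Proof.
move=> cf; apply: (within_continuous_cintegrable hGam (haar_radon hh) closedT cGam) => //.
exact: continuous_subspaceT.
Qed.

Lemma haar_integral_cst (r : R) : (\int[h]_(x in [set: B]) r%:E)%E = r%:E.
Proof. by rewrite integral_cst// (haar_total hh) mule1. Qed.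

Lemma haar_cintegral_cst (c : C) : cintegral h setT (fun=> c) = c.
Proof. by rewrite /cintegral !haar_integral_cst; case: c. Qed.

(** Invariance of the measure of translated sets says that [h] is its own pushforward under
    translation; the rest is a change of variables. *)
Lemma haar_translation (f : Gam -> C) (b : Gam) : continuous f ->
  cintegral h setT (fun a => f (a + b)) = cintegral h setT f.
Proof.
move=> cf; pose tau (a : B) : B := a + b.
have ctau : continuous (tau : Gam -> Gam).
  move=> a; apply: (@cvg_comp _ _ _ (fun a => (a, b)) (fun x : Gam * Gam => x.1 + x.2) _ (nbhs (a, b))); last exact: (@add_continuous Gam (a, b)).
  by apply: cvg_pair; [exact: cvg_id|exact: cvg_cst].
have mtau : measurable_fun [set: B] tau by exact: continuous_borel_map.
have inv (A : set B) : measurable A -> A `<=` setT -> pushforward h tau A = h A.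
  move=> mA _; rewrite -(haar_invariant hh (- b) mA) /pushforward; congr (h _).
  apply/seteqP; split => [a /= Aa|_ [a Aa <-]] /=.
    by exists (tau a) => //; rewrite /tau addrC addrK.
  by rewrite /tau addrAC addNr add0r.
have shift (u : Gam -> R) : continuous u ->
    (\int[h]_(x in [set: B]) (u (x + b))%:E = \int[h]_(x in [set: B]) (u x)%:E)%E.
  move=> cu; have mu : measurable_fun [set: B] (fun x : B => (u x)%:E).
    by apply/measurable_EFinP; exact: continuous_borel.
  transitivity (\int[pushforward h tau]_(x in [set: B]) (u x)%:E)%E; last first.
    exact: eq_measure_integral.
  have cut : continuous (fun x : Gam => u (x + b)).
    by move=> x; apply: (@continuous_comp _ _ _ tau u); [exact: ctau|exact: cu].
  have iu : h.-integrable (tau @^-1` setT) ((fun x : B => (u x)%:E) \o tau).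
    apply: (@within_continuous_integrable R Gam 0 h hGam (haar_radon hh) setT setT (fun x : Gam => u (x + b)) closedT cGam) => //.
    exact: continuous_subspaceT.
  by rewrite (@integral_pushforward _ _ B B R tau mtau h setT _ mu iu measurableT).
congr Complex; congr fine.
  by rewrite (shift (fun x => complex.Re (f x)))// => x; apply: cvg_Re; exact: cf.
by rewrite (shift (fun x => complex.Im (f x)))// => x; apply: cvg_Im; exact: cf.
Qed.

(** Compactness of [Gam] turns joint continuity at the points (a, x0) into closeness of [Phi a x] to
    [Phi a x0] uniformly in [a]. As [h] has total mass 1, a uniform error e / 4 becomes at most e /
    2 under [le_cintegral_dist]. *)
Lemma haar_param_continuous (X : topologicalType) (Phi : Gam -> X -> C) (x0 : X) :
  (forall a, Phi p.1 p.2 @[p --> (a, x0)] --> Phi a x0) ->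
  (forall x, continuous (Phi ^~ x)) ->
  cintegral h setT (Phi ^~ x) @[x --> x0] --> cintegral h setT (Phi ^~ x0).
Proof.
move=> cPhi cPx; apply/(@cvg_normcP R C _ _ _) => e e0.
have e40 : 0 < e / 4 by rewrite divr_gt0.
have : \forall x \near x0, forall a, [set: Gam] a -> complex.Re `|Phi a x0 - Phi a x| < e / 4.
  move/compact_near_coveringP : cGam; apply => a _.
  have e80 : 0 < e / 8 by rewrite divr_gt0.
  have /(@cvg_normcP R C _ _ _)/(_ _ e80) h1 := cPhi a.
  have : Phi b x0 @[b --> a] --> Phi a x0 by exact: cPx.
  move=> /(@cvg_normcP R C _ _ _)/(_ _ e80) h2.
  have h3 : nbhs (a, x0) (fun p => complex.Re `|Phi a x0 - Phi p.1 x0| < e / 8).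
    by exists ([set b | complex.Re `|Phi a x0 - Phi b x0| < e / 8], setT) => [|[? ?] []//]; split => //; exact: filterT.
  have : nbhs (a, x0) (fun p => complex.Re `|Phi p.1 x0 - Phi p.1 p.2| < e / 4).
    apply: (@filterS2 _ (nbhs (a, x0)) _ _ _ _ _ h1 h3) => -[a' x'] /= k1 k2.
    rewrite -(subrKA (Phi a x0)) (le_lt_trans (Re_normD _ _))//.
    have -> : e / 4 = e / 8 + e / 8 by lra.
    by rewrite ltrD// -normrN opprB.
  by [].
apply: filterS => x hx.
have := @le_cintegral_dist R Gam 0 h setT measurableT (Phi ^~ x0) (Phi ^~ x) (fun=> e / 4)
  (haar_cintegrable (cPx x0)) (haar_cintegrable (cPx x)).
move=> /(_ _ _)/le_lt_trans; apply => //.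
- by have [] := haar_cintegrable (f := fun=> ((e / 4)%:C)%C) (fun x => cvg_cst _).
- by move=> a _; rewrite ltW// hx.
- by rewrite haar_integral_cst/=; lra.
Unshelve. all: by end_near. Qed.
End compact_group.

Section averaging.
Variables (R : realType) (G S : lcgroupoid) (Gam : topologicalZmodType).
Variable E : twist G S Gam.
Hypothesis cGam : compact [set: Gam].
Hypothesis hGam : hausdorff_space Gam.
Variable h : {measure set (borel (0 : Gam)) -> \bar R}.
Hypothesis hh : normalized_haar h.
Local Notation C := (Cplx R).
Local Notation act := (tact E).

(** The average over an orbit is constant along the orbit and so descends to [G]; the induced
    integral of [k] is the integral of this descent against [lam]. *)
Definition orbit_mean (k : S -> C) : S -> C :=
  fun x => cintegral h setT (fun a => k (act a x)).

Definition chi_mean (chi : Gam -> C) (k : S -> C) : S -> C :=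
  fun x => cintegral h setT (fun a => chi a * k (act (- a) x)).

(** Common form of the two averages: weight 1 and translation by [a] for [orbit_mean], weight chi
    and translation by -a for [chi_mean]. Supports stay in a compact set stable under the action. *)
Lemma mean_Cc (c : Gam -> C) (s : Gam -> Gam) (k : S -> C) :
  continuous c -> continuous s -> Cc k ->
  Cc (fun x => cintegral h setT (fun a => c a * k (act (s a) x))).
Proof.
move=> cc cs [ck cptk].
have [L [cL kL actL]] := compact_act E cGam cptk.
have joint a x : c p.1 * k (act (s p.1) p.2) @[p --> (a, x)] --> c a * k (act (s a) x).
  apply: cvgM.
    by apply: (@cvg_comp _ _ _ fst c _ (nbhs a)); [exact: cvg_fst|exact: cc].
  apply: (@cvg_comp _ _ _ (fun p : Gam * S => act (s p.1) p.2) k _ (nbhs (act (s a) x))); last exact: ck.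
  apply: act_cvg; last exact: cvg_snd.
  by apply: (@cvg_comp _ _ _ fst s _ (nbhs a)); [exact: cvg_fst|exact: cs].
have sep x : continuous (fun a => c a * k (act (s a) x)).
  move=> a; apply: cvgM; first exact: cc.
  apply: (@cvg_comp _ _ _ (fun a => act (s a) x) k _ (nbhs (act (s a) x))); last exact: ck.
  by apply: act_cvg; [exact: cs|exact: cvg_cst].
apply: (@Cc_sub R S _ L (@garrow_hausdorff S) _ cL).
  move=> x; exact: (haar_param_continuous cGam hGam hh (fun a => joint a x) sep).
move=> x nLx; transitivity (cintegral h setT (fun=> 0 : C)); last exact: cintegral0.
apply: eq_cintegral => a _.
rewrite (csuppN (x := act (s a) x)) ?mulr0// => kx; apply: nLx.
by rewrite -(actNK E (s a) x); apply: actL; exact: kL.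
Qed.

Lemma orbit_mean_Cc k : Cc k -> Cc (orbit_mean k).
Proof.
move=> Ck.
rewrite (_ : orbit_mean k = fun x => cintegral h setT (fun a => 1 * k (act (id a) x))).
  apply: mean_Cc => //; [by move=> x; exact: cvg_cst|by move=> x; exact: cvg_id].
by apply/funext => x; apply: eq_cintegral => a _; rewrite mul1r.
Qed.

Lemma orbit_fun_continuous (k : S -> C) x :
  continuous k -> continuous (fun a : Gam => k (act a x)).
Proof.
move=> ck a; apply: (@cvg_comp _ _ _ (fun a => act a x) k _ (nbhs (act a x))); last exact: ck.
by apply: act_cvg; [exact: cvg_id|exact: cvg_cst].
Qed.

Lemma orbit_mean_act (k : S -> C) b x : continuous k -> orbit_mean k (act b x) = orbit_mean k x.
Proof.
move=> ck; rewrite /orbit_mean -(haar_translation cGam hGam hh b (orbit_fun_continuous (x := x) ck)).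
by apply: eq_cintegral => a _; rewrite actD.
Qed.

Variable chi : Gam -> C.
Hypothesis chiP : character chi.

Lemma char0 : chi 0 = 1.
Proof.
have n0 : chi 0 != 0 by rewrite -normr_eq0 (char_norm chiP) oner_neq0.
by apply: (mulfI n0); rewrite -(char_mul chiP) addr0 mulr1.
Qed.

Lemma char_mulN a : chi a * chi (- a) = 1.
Proof. by rewrite -(char_mul chiP) subrr char0. Qed.

Lemma char_conj a : (chi a)^* = chi (- a).
Proof.
have na := char_norm chiP a.
have n0 : chi a != 0 by rewrite -normr_eq0 na oner_neq0.
by apply: (mulfI n0); rewrite char_mulN -normCK na expr1n.
Qed.

Lemma oppr_continuous_top : continuous (fun a : Gam => - a).
Proof. exact: opp_continuous. Qed.

Lemma chi_mean_Cchi k : Cc k -> Cchi E chi (chi_mean chi k).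
Proof.
move=> Ck; split.
  exact: (mean_Cc (char_continuous chiP) oppr_continuous_top Ck).
move=> x b; rewrite /chi_mean.
have cf : continuous (fun a => chi a * k (act (- a) (act b x))).
  move=> a; apply: cvgM; first exact: (char_continuous chiP).
  apply: (@cvg_comp _ _ _ (fun a => act (- a) (act b x)) k _ (nbhs (act (- a) (act b x)))); last exact: Ck.1.
  by apply: act_cvg; [exact: oppr_continuous_top|exact: cvg_cst].
(* Translating the variable by [b] cancels the [b] in the argument of [k] and releases the factor
   [chi b]. *)
rewrite -(haar_translation cGam hGam hh b cf) -cintegralZ//.
  apply: eq_cintegral => a _; rewrite (char_mul chiP) -actD opprD addrNK.
  by rewrite mulrAC mulrC mulrA.
apply: (haar_cintegrable cGam hGam hh) => a; apply: cvgM; first exact: (char_continuous chiP).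
apply: (@cvg_comp _ _ _ (fun a => act (- a) x) k _ (nbhs (act (- a) x))); last exact: Ck.1.
by apply: act_cvg; [exact: oppr_continuous_top|exact: cvg_cst].
Qed.

Lemma chi_mean_id k : Cchi E chi k -> chi_mean chi k = k.
Proof.
move=> [_ kchi]; apply/funext => x; rewrite /chi_mean -[RHS](haar_cintegral_cst hh).
by apply: eq_cintegral => a _; rewrite kchi mulrA char_mulN mul1r.
Qed.
End averaging.

Lemma within_continuous_comp_on (X Y Z : topologicalType) (A : set X) (B : set Y)
    (f : X -> Y) (g : Y -> Z) (k : X -> Z) : continuous f ->
  (forall x, A x -> B (f x)) -> {within B, continuous g} ->
  (forall x, A x -> k x = g (f x)) -> {within A, continuous k}.
Proof.
move=> cf fAB /subspace_continuousP cg kgf; apply/subspace_continuousP => x Ax.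
move=> W; rewrite /from_subspace (kgf _ Ax) => /(cg _ (fAB _ Ax)) /cf.
rewrite /within /= !nbhs_simpl /=; apply: filterS => y /= h Ay.
by rewrite (kgf _ Ay); apply: h; exact: fAB.
Qed.

(** * The induced Haar system: null sets and continuity *)

Section induced_measure.
Variables (R : realType) (G S : lcgroupoid) (Gam : topologicalZmodType).
Variable E : twist G S Gam.
Hypothesis cGam : compact [set: Gam].
Hypothesis hGam : hausdorff_space Gam.
Variable lam : forall u : G, {measure set (borel u) -> \bar R}.
Hypothesis lamP : haar_system lam.
Variable h : {measure set (borel (0 : Gam)) -> \bar R}.
Hypothesis hh : normalized_haar h.
Variable mu : forall x : S, {measure set (borel x) -> \bar R}.
Hypothesis muP : induced_haar E lam h mu.
Local Notation C := (Cplx R).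
Local Notation act := (tact E).

Lemma tpi_section : exists sec : G -> S, cancel sec (tpi E).
Proof. by have [sec secP] := choice (tpi_surjective E); exists sec. Qed.

(** By inner regularity it is enough to treat a compact [K] off the fibre. Each of its points lies
    outside the support, so has an open null neighbourhood, and compactness leaves finitely many of
    them. *)
Lemma haar_system_conull (u : G) : units u -> lam u (~` rfib u : set (borel u)) = 0%E.
Proof.
move=> uu; have ru := haar_system_radon lamP uu.
have oC : open (~` rfib u) by apply: closed_openC; exact: closed_rfib.
rewrite (radon_inner ru oC); apply/eqP; rewrite eq_le; apply/andP; split; last first.
  by apply: ereal_sup_ubound; exists set0; [split; [exact: compact0|exact: sub0set]|exact: measure0].
apply: ge_ereal_sup => _ [K [cK KC] <-].
have mK : measurable (K : set (borel u)).
  by apply: borel_closed; apply: compact_closed => //; exact: garrow_hausdorff.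
have nullU (x : G) : K x -> exists U : set G, [/\ open U, U x & lam u U = 0%E].
  move=> /KC; rewrite -(haar_system_support lamP uu) => nx.
  apply: contrapT => hU; apply: nx => U oU Ux.
  rewrite lt_neqAle measure_ge0 andbT; apply/eqP => U0.
  by apply: hU; exists U.
pose nullo (N : set G) := open N /\ lam u N = 0%E.
(* The finite subcover is expressed by a filter on sets: open null sets are directed by union, [F]
   is generated by their upward cones, and the covering form of compactness yields one open null set
   containing [K]. *)
pose F := filter_from nullo (fun N => [set N' | N `<=` N' /\ nullo N']).
have PF : ProperFilter F.
  apply: filter_from_proper; last by move=> N ?; exists N; split.
  apply: filter_from_filter; first by exists set0; split; [exact: open0|exact: measure0].
  move=> A A' [oA A0] [oA' A'0]; exists (A `|` A').
    split; first exact: openU.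
    by apply/eqP; rewrite measureU0//; [apply/eqP|exact: borel_open|exact: borel_open].
  move=> N [AN nN]; split; split => // x Ax; apply: AN; [by left|by right].
have : \forall N \near F, forall x, K x -> N x.
  move/compact_near_coveringP : (cK); apply => x Kx.
  have [U [oU Ux U0]] := nullU x Kx.
  exists (U, [set N' | U `<=` N' /\ nullo N']); last by move=> [y N] /= [Uy [UN _]]; exact: UN.
  by split => /=; [exact: open_nbhs_nbhs|exists U].
have Fnull : F nullo.
  by exists set0; [split; [exact: open0|exact: measure0]|move=> N [_]].
move=> KF; have [N [KN [oN N0]]] := filter_ex (filterI KF Fnull).
by rewrite -N0; apply: le_measure; rewrite ?inE//; exact: borel_open.
Qed.

Lemma sec_range (sec : G -> S) (x : S) (y : G) : cancel sec (tpi E) -> units x ->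
  grange y = tpi E x -> grange (sec y) = x.
Proof.
move=> secK ux yx; apply: (@tpi_unit_inj _ _ _ E) => //; first exact: units_range.
by rewrite -tpi_range secK.
Qed.

(** For a compact [K] off the fibre, a cutoff equal to 1 on [K] and supported off the fibre has
    integral 0 by the induced integral formula, since the orbits of the section over [tpi E x] stay
    in the fibre. This cutoff dominates the indicator of [K]. *)
Lemma induced_conull (x : S) : units x -> mu x (~` rfib x : set (borel x)) = 0%E.
Proof.
move=> ux; have rx := induced_radon muP ux.
have oC : open (~` rfib x) by apply: closed_openC; exact: closed_rfib.
rewrite (radon_inner rx oC); apply/eqP; rewrite eq_le; apply/andP; split; last first.
  by apply: ereal_sup_ubound; exists set0; [split; [exact: compact0|exact: sub0set]|exact: measure0].
apply: ge_ereal_sup => _ [K [cK KC] <-].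
have mK : measurable (K : set (borel x)).
  by apply: borel_closed; apply: compact_closed => //; exact: garrow_hausdorff.
have [phi [cphi phi01 phi1 cpt phiC]] :=
  @urysohn_Cc R S (@garrow_locally_compact S) (@garrow_hausdorff S) K (~` rfib x) cK oC KC.
have Cphi : Cc (fun y => ((phi y)%:C)%C : C).
  split; first by move=> y; apply: cvg_real_complex; exact: cphi.
  by apply: (compact_closureS cpt) => y /=; apply: contra_neq => ->.
have [sec secK] := tpi_section.
have := induced_integral muP secK ux Cphi.
rewrite [RHS](@eq_cintegral _ _ _ _ _ _ (fun=> 0)); last first.
  move=> y yx; rewrite -[RHS](@cintegral0 R Gam 0 h setT); apply: eq_cintegral => a _.
  have -> : phi (act a (sec y)) = 0; last by [].
  apply: contrapT => /eqP h0.
  have := phiC _ (@subset_closure _ _ (act a (sec y)) h0).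
  by apply; rewrite /rfib /= range_act (sec_range secK ux).
rewrite cintegral0 cintegral_real => -[i0].
have iphi := Cc_real_integrable (@garrow_hausdorff S) rx Cphi.
have phi0 : (\int[mu x]_(y in [set: borel x]) (phi y)%:E)%E = 0%E.
  by rewrite -(fineK (integrable_fin_num measurableT iphi)) i0.
rewrite -phi0 -[K in mu x K](setIT (K : set (borel x))) -(integral_indic (mu x) measurableT mK).
apply: ge0_le_integral => //.
- by apply/measurable_EFinP; exact: measurable_indic.
- exact: measurable_int iphi.
move=> y _; rewrite lee_fin indicE; case: (boolP (y \in K)) => [/set_mem/phi1 ->//|_].
by have /andP[] := phi01 y.
Qed.

(** The orbit mean of [k] descends to a function in C_c(G), whose integrals against [lam] vary
    continuously by the axiom of Haar systems; composing with [tpi E] carries this over to the units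
    of [S]. *)
Lemma induced_cintegral_continuous (k : S -> C) : Cc k ->
  {within @units S, continuous (fun u => cintegral (mu u) setT k)}.
Proof.
move=> Ck; have [sec secK] := tpi_section.
have Cm := orbit_mean_Cc E cGam hGam hh Ck.
pose phi y := orbit_mean E h k (sec y).
have phiE : phi \o tpi E = orbit_mean E h k.
  apply/funext => x; have [a xa] := act_trans (secK (tpi E x)).
  rewrite /phi /= [in RHS]xa; symmetry.
  exact: (@orbit_mean_act R G S Gam E cGam hGam h hh k a (sec (tpi E x)) (proj1 Ck)).
have Cphi : Cc phi.
  apply: (@Cc_sub R G phi (tpi E @` csupp (orbit_mean E h k)) (@garrow_hausdorff G)).
  - apply/continuousP => U oU; apply: (@tpi_quotient _ _ _ E).
    rewrite -comp_preimage phiE; move/continuousP : (proj1 Cm); exact.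
  - apply: continuous_compact; last exact: (proj2 Cm).
    exact/continuous_subspaceT/tpi_continuous.
  - move=> y ny; rewrite /phi; apply: csuppN => h1; apply: ny.
    by exists (sec y).
apply: (within_continuous_comp_on (f := tpi E) (g := fun w => cintegral (lam w) setT phi) (B := @units G)).
- exact: tpi_continuous.
- exact: tpi_unit.
- exact: (haar_system_continuous lamP Cphi).
move=> u uu; rewrite (induced_integral muP secK uu Ck).
have uu' := tpi_unit E uu.
rewrite [RHS](@cintegral_conull R G (tpi E u) (lam (tpi E u)) (rfib (tpi E u)) _ (@garrow_hausdorff G) (haar_system_radon lamP uu') _ (haar_system_conull uu') Cphi); first by [].
by apply: borel_closed; exact: closed_rfib.
Qed.
End induced_measure.

Lemma measurable_rfib (S : lcgroupoid) (x : S) : measurable (rfib x : set (borel x)).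
Proof. by apply: borel_closed; exact: closed_rfib. Qed.
Arguments measurable_rfib {S} x.

(** * Convolution *)

Section convolution_Cc.
Variables (R : realType) (S : lcgroupoid).
Variable mu : forall x : S, {measure set (borel x) -> \bar R}.
Hypothesis mu_radon : forall x, units x -> radon (mu x).
Hypothesis mu_conull : forall x, units x -> mu x (~` rfib x : set (borel x)) = 0%E.
Hypothesis mu_cont : forall k : S -> Cplx R, Cc k ->
  {within @units S, continuous (fun u => cintegral (mu u) setT k)}.
Local Notation C := (Cplx R).
Implicit Types (f g k : S -> C) (x y : S).

Lemma cintegral_rfib x k : units x -> Cc k ->
  cintegral (mu x) setT k = cintegral (mu x) (rfib x) k.
Proof.
move=> ux Ck; exact: (cintegral_conull (measurable_rfib x) (@garrow_hausdorff S) (mu_radon ux) (mu_conull ux) Ck).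
Qed.

Lemma range_cintegral_continuous k : Cc k ->
  continuous (fun x => cintegral (mu (grange x)) setT k).
Proof.
move=> Ck; apply/continuous_subspace_setT.
apply: (@within_continuous_comp_on S S C setT (@units S) (@grange S) (fun u => cintegral (mu u) setT k)).
- exact: grange_continuous.
- by move=> x _; exact: units_range.
- exact: mu_cont.
- by [].
Qed.

(** A function of the pair, so that joint continuity can be stated; it is meaningful along pairs of
    equal range. *)
Definition conv_integrand f g (p : S * S) : C := f p.1 * g (gmul (ginv p.1) p.2).

Lemma conv_integrand_cvg f g (p : S * S) : continuous f -> continuous g ->
  grange p.1 = grange p.2 ->
  conv_integrand f g q @[q --> within [set q : S * S | grange q.1 = grange q.2] (nbhs p)] -->
  conv_integrand f g p.
Proof.
move=> cf cg pr; apply: cvgM.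
  apply: cvg_within_filter.
  by apply: (@cvg_comp _ _ _ fst f _ (nbhs p.1)); [exact: cvg_fst|exact: cf].
apply: (@cvg_comp _ _ _ (fun q : S * S => gmul (ginv q.1) q.2) g _ (nbhs (gmul (ginv p.1) p.2))); last exact: cg.
apply: gmul_cvg.
- apply: cvg_within_filter.
  by apply: (@cvg_comp _ _ _ fst (@ginv S) _ (nbhs p.1)); [exact: cvg_fst|exact: ginv_continuous].
- by apply: cvg_within_filter; exact: cvg_snd.
- by rewrite gsource_inv.
- by apply: filterS (withinT _ (nbhs_filter p)) => q /= e; rewrite gsource_inv.
Qed.

Lemma conv_integrand_within f g x : continuous f -> continuous g ->
  {within rfib (grange x), continuous (fun y => conv_integrand f g (y, x))}.
Proof.
move=> cf cg; apply/subspace_continuousP => y yx.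
have h := @conv_integrand_cvg f g (y, x) cf cg yx.
apply: (@cvg_comp _ _ _ (fun y' => (y', x)) (conv_integrand f g) _ _ _ _ h).
move=> B /= [[B1 B2] /= [yB1 xB2] BB]; rewrite /within /=.
have : nbhs y B1 := yB1; apply: filterS => z B1z zx; apply: (BB (z, x)) => //.
by split => //; exact: (nbhs_singleton xB2).
Qed.

(* The induced Haar system only integrates functions of C_c(S), whereas the
   convolution integrand is meaningful on the fibre over the range of x only;
   Tietze's theorem supplies an extension. *)
Lemma conv_extension f g x : Cc f -> continuous g ->
  exists2 k, Cc k & forall y, rfib (grange x) y -> k y = f y * g (gmul (ginv y) x).
Proof.
move=> Cf cg; have w := @conv_integrand_within f g x (proj1 Cf) cg.
apply: (tietze_Cc_complex (@garrow_locally_compact S) (@garrow_hausdorff S) (closed_rfib (grange x)) (proj2 Cf) w).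
by move=> y _ ny; rewrite /conv_integrand (csuppN ny) mul0r.
Qed.

Lemma conv_cintegrable f g x : Cc f -> continuous g ->
  cintegrable (mu (grange x)) (rfib (grange x)) (fun y => f y * g (gmul (ginv y) x)).
Proof.
move=> Cf cg; have w := @conv_integrand_within f g x (proj1 Cf) cg.
apply: (within_continuous_cintegrable (@garrow_hausdorff S) (mu_radon (units_range x)) (closed_rfib (grange x)) (proj2 Cf) w).
by move=> y _ ny; rewrite /conv_integrand (csuppN ny) mul0r.
Qed.

Lemma gconv_lin f (a : C) g1 g2 : Cc f -> continuous g1 -> continuous g2 ->
  gconv mu f (a *: g1 + g2) = a *: gconv mu f g1 + gconv mu f g2.
Proof.
move=> Cf c1 c2; apply/funext => x; rewrite /gconv.
have [_ e] := cintegral_lin (measurable_rfib (grange x)) a (conv_cintegrable x Cf c1) (conv_cintegrable x Cf c2).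
etransitivity; last exact: e.
by apply: eq_cintegral => y _; rewrite mulrDr; congr (_ + _); rewrite mulrCA.
Qed.

Lemma gconv_supp f g x :
  (forall y, csupp f y -> csupp g (gmul (ginv y) x) -> grange y <> grange x) ->
  gconv mu f g x = 0.
Proof.
move=> nx; transitivity (cintegral (mu (grange x)) (rfib (grange x)) (fun=> 0 : C)); last exact: cintegral0.
apply: eq_cintegral => y yx; apply/eqP; rewrite mulf_eq0; apply/orP.
have [fy|nfy] := pselect (csupp f y); last by left; rewrite (csuppN nfy).
have [gy|ngy] := pselect (csupp g (gmul (ginv y) x)); last by right; rewrite (csuppN ngy).
by case: (nx y fy gy yx).
Qed.

Lemma compact_gmul (K L : set S) : compact K -> compact L ->
  compact [set gmul p.1 p.2 | p in [set p : S * S | [/\ K p.1, L p.2 & gsource p.1 = grange p.2]]].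
Proof.
move=> cK cL; pose Z := [set p : S * S | gsource p.1 = grange p.2].
have cZ : closed Z.
  apply: closed_eq_continuous => p.
    by apply: (@cvg_comp _ _ _ fst (@gsource S) _ (nbhs p.1)); [exact: cvg_fst|exact: gsource_continuous].
  by apply: (@cvg_comp _ _ _ snd (@grange S) _ (nbhs p.2)); [exact: cvg_snd|exact: grange_continuous].
have -> : [set p : S * S | [/\ K p.1, L p.2 & gsource p.1 = grange p.2]] = (K `*` L) `&` Z.
  by apply/seteqP; split => [p [? ? ?]|p [[? ?] ?]]; split.
apply: continuous_compact; last by apply: compact_closedI => //; exact: compact_setX.
by apply: continuous_subspaceW (@gmul_continuous S) => p [].
Qed.

(** The integrands for [x] near [x0] live on varying fibres. They are all compared with one [k] in
    C_c(S) that extends the integrand at [x0]: the integral of [k] varies continuously with the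
    fibre, and the difference from [k] is uniformly small on the compact [K]. *)
Lemma gconv_continuous f g : Cc f -> continuous g -> continuous (gconv mu f g).
Proof.
move=> Cf cg x0; have [k Ck kE] := conv_extension x0 Cf cg.
pose K := csupp f `|` csupp k.
have cK : compact K by apply: compactU; [exact: (proj2 Cf)|exact: (proj2 Ck)].
have [psi [cpsi psi01 psi1 cpt _]] :=
  @urysohn_Cc R S (@garrow_locally_compact S) (@garrow_hausdorff S) K setT cK openT (@subsetT _ K).
have Cpsi : Cc (fun y => ((psi y)%:C)%C : C).
  split; first by move=> y; apply: cvg_real_complex; exact: cpsi.
  by apply: (compact_closureS cpt) => y /=; apply: contra_neq => ->.
pose I (u : S) : C := cintegral (mu u) setT (fun y => ((psi y)%:C)%C : C).
(* The integral of [psi] over the fibre of [x] stays below [M] near [x0]. With d = e / (4 M), the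
   error of at most d psi on the fibre contributes 2 d M = e / 2, and moving the integral of [k]
   contributes e / 4. *)
pose M := complex.Re `|I (grange x0)| + 1.
have M0 : 0 < M by rewrite ltr_wpDl// Re_norm_ge0.
apply/(@cvg_normcP R C _ _ _) => e e0.
pose d := e / 4 / M; have d0 : 0 < d by rewrite !divr_gt0.
have nearF : \forall x \near x0, forall y, K y -> grange y = grange x ->
    complex.Re `|conv_integrand f g (y, x) - k y| < d.
  move/compact_near_coveringP : cK; apply => y0 _.
  (* If the ranges of [y0] and [x0] differ, they differ for all nearby pairs, and there is nothing
     to compare. *)
  have [r0|nr0] := pselect (grange y0 = grange x0); last first.
    pose Z := [set p : S * S | grange p.1 = grange p.2].
    have cZ : closed Z.
      apply: closed_eq_continuous => p.
        by apply: (@cvg_comp _ _ _ fst (@grange S) _ (nbhs p.1)); [exact: cvg_fst|exact: grange_continuous].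
      by apply: (@cvg_comp _ _ _ snd (@grange S) _ (nbhs p.2)); [exact: cvg_snd|exact: grange_continuous].
    have : nbhs (y0, x0) (~` Z).
      by apply: open_nbhs_nbhs; split => //; exact: closed_openC.
    by apply: filterS => -[y x] /= h1 h2; case: h1.
  have := @conv_integrand_cvg f g (y0, x0) (proj1 Cf) cg r0.
  have d20 : 0 < d / 2 by rewrite divr_gt0.
  move=> /(@cvg_normcP R C _ _ _)/(_ _ d20) h1.
  have /(@cvg_normcP R C _ _ _)/(_ _ d20) h2 := proj1 Ck y0.
  have h3 : nbhs (y0, x0) (fun p => complex.Re `|k y0 - k p.1| < d / 2).
    by exists ([set b | complex.Re `|k y0 - k b| < d / 2], setT) => [|[? ?] []//]; split => //; exact: filterT.
  have : nbhs (y0, x0) (fun p => grange p.1 = grange p.2 -> complex.Re `|conv_integrand f g (p.1, p.2) - k p.1| < d).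
    apply: (@filterS2 _ (nbhs (y0, x0)) _ _ _ _ _ h1 h3) => -[y x] /= k1 k2 yx.
    have {}k1 := k1 yx.
    have e1 : conv_integrand f g (y0, x0) = k y0 by rewrite kE.
    rewrite -(subrKA (k y0)) (le_lt_trans (Re_normD _ _))// [ltRHS]splitr ltrD//.
    by rewrite -normrN opprB -e1.
  by [].
have d40 : 0 < e / 4 by rewrite divr_gt0.
have /(@cvg_normcP R C _ _ _)/(_ _ d40) nearI := range_cintegral_continuous Ck (x := x0).
have /(@cvg_normcP R C _ _ _)/(_ _ ltr01) nearPsi := range_cintegral_continuous Cpsi (x := x0).
have conv0 : gconv mu f g x0 = cintegral (mu (grange x0)) setT k.
  rewrite (cintegral_rfib (units_range x0) Ck); apply: eq_cintegral => y yx.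
  by rewrite kE.
near=> x.
have hF : forall y, K y -> grange y = grange x ->
    complex.Re `|conv_integrand f g (y, x) - k y| < d by near: x.
have hI : complex.Re `|cintegral (mu (grange x0)) setT k - cintegral (mu (grange x)) setT k| < e / 4 by near: x.
have hP : complex.Re `|I (grange x0) - I (grange x)| < 1 by near: x.
rewrite conv0 -(subrKA (cintegral (mu (grange x)) setT k)).
rewrite (le_lt_trans (Re_normD _ _))//.
have ux := units_range x.
have ik : cintegrable (mu (grange x)) (rfib (grange x)) k.
  apply: (within_continuous_cintegrable (@garrow_hausdorff S) (mu_radon ux) (closed_rfib (grange x)) (proj2 Ck)).
    exact: (continuous_subspaceT (proj1 Ck)).
  by move=> y _; exact: csuppN.
have iw : (mu (grange x)).-integrable (rfib (grange x) : set (borel (grange x))) (fun y => (d * psi y)%:E).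
  apply: (within_continuous_integrable (f := fun y => d * psi y) (@garrow_hausdorff S) (mu_radon ux) (closed_rfib (grange x)) cpt).
    by apply: continuous_subspaceT => y; apply: cvgMr; exact: cpsi.
  move=> y _ ny; have -> : psi y = 0; last by rewrite mulr0.
  by apply: contrapT => /eqP py; apply: ny; exact: subset_closure.
have key : complex.Re `|cintegral (mu (grange x)) (rfib (grange x)) k - gconv mu f g x| <=
    2 * fine (\int[mu (grange x)]_(y in (rfib (grange x) : set (borel (grange x)))) (d * psi y)%:E).
  apply: (le_cintegral_dist (measurable_rfib (grange x)) ik (conv_cintegrable x Cf cg) iw) => y yx.
  have [Ky|nKy] := pselect (K y).
    rewrite (psi1 _ Ky) mulr1 -normrN opprB ltW//; exact: hF.
  have -> : k y = 0 by apply: csuppN => h1; apply: nKy; right.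
  have -> : f y = 0 by apply: csuppN => h1; apply: nKy; left.
  rewrite mul0r subr0 normr0 mulr_ge0 ?(ltW d0)//.
  by have /andP[] := psi01 y.
rewrite (cintegral_rfib ux Ck) in hI *.
have e2 : fine (\int[mu (grange x)]_(y in (rfib (grange x) : set (borel (grange x)))) (d * psi y)%:E) =
    d * complex.Re (I (grange x)).
  rewrite /I (cintegral_rfib ux Cpsi).
  have [ip _] := Cc_cintegrable (@garrow_hausdorff S) (mu_radon ux) Cpsi.
  have ip' := integrableS measurableT (measurable_rfib (grange x)) (@subsetT _ _) ip.
  have [_] := fine_integral_lin (measurable_rfib (grange x)) d 0 ip' ip'.
  rewrite mul0r addr0 => <-; congr fine; apply: eq_integral => y _.
  by rewrite mul0r addr0.
have IM : complex.Re (I (grange x)) <= M.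
  apply: le_trans (ler_norm _) _; apply: le_trans (le_Re_norm _) _.
  rewrite -(subrK (I (grange x0)) (I (grange x))).
  apply: le_trans (Re_normD _ _) _; rewrite addrC lerD//.
  by rewrite -normrN opprB ltW.
have h4 : d * complex.Re (I (grange x)) <= e / 4.
  by rewrite /d -mulrA ler_piMr ?(ltW d40)// mulrC ler_pdivrMr// mul1r.
rewrite e2 in key.
have -> : e = e / 4 + 3 * (e / 4) by lra.
apply: ltr_leD => //; apply: (le_trans key); lra.
Unshelve. all: by end_near. Qed.

Lemma gconv_Cc f g : Cc f -> Cc g -> Cc (gconv mu f g).
Proof.
move=> Cf Cg.
apply: (@Cc_sub R S _ _ (@garrow_hausdorff S) (gconv_continuous Cf (proj1 Cg)) (compact_gmul (proj2 Cf) (proj2 Cg))).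
move=> x nx; apply: gconv_supp => y fy gy yx; apply: nx.
exists (y, gmul (ginv y) x) => /=; last by rewrite gmulKV.
by split => //; rewrite grange_mul ?gsource_inv// grange_inv.
Qed.
End convolution_Cc.

Lemma gstar_Cc (R : realType) (S : lcgroupoid) (f : S -> Cplx R) : Cc f -> Cc (gstar f).
Proof.
move=> Cf; apply: (@Cc_sub R S _ (@ginv S @` csupp f) (@garrow_hausdorff S)).
- move=> x; apply: cvg_conj.
  apply: (@cvg_comp _ _ _ (@ginv S) f _ (nbhs (ginv x))); first exact: ginv_continuous.
  exact: (proj1 Cf).
- apply: continuous_compact; last exact: (proj2 Cf).
  exact/continuous_subspaceT/ginv_continuous.
- move=> x nx; rewrite /gstar; have -> : f (ginv x) = 0; last by rewrite conjC0.
  by apply: csuppN => h1; apply: nx; exists (ginv x) => //; rewrite ginvK.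
Qed.

Lemma continuous_sqr (R : realType) (T : topologicalType) (u : T -> R) :
  continuous u -> continuous (fun x => u x ^+ 2).
Proof.
move=> cu; rewrite (_ : (fun x => _) = (fun x => u x * u x)).
  by move=> x; apply: cvgM; exact: cu.
by apply/funext => x; rewrite expr2.
Qed.

Lemma Cc_norm (R : realType) (T : topologicalType) (f : T -> Cplx R) : Cc f -> Cc (fun y => ((complex.Re `|f y|)%:C)%C : Cplx R).
Proof.
move=> Cf; apply: (Cc_real Cf).
  by move=> x; apply: cvg_norm_Re; exact: (proj1 Cf).
by move=> x ->; rewrite normr0.
Qed.

Lemma Cc_norm2 (R : realType) (T : topologicalType) (f : T -> Cplx R) : Cc f -> Cc (fun y => ((complex.Re `|f y| ^+ 2)%:C)%C : Cplx R).
Proof.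
move=> Cf; apply: (Cc_real Cf).
  apply: (@continuous_sqr R T (fun y => complex.Re `|f y|)) => x.
  by apply: cvg_norm_Re; exact: (proj1 Cf).
by move=> x ->; rewrite normr0 expr0n.
Qed.

(** * The measures on the source fibres *)

Section source_measure.
Variables (R : realType) (S : lcgroupoid).
Variable mu : forall x : S, {measure set (borel x) -> \bar R}.

Lemma ginv_measurable (u : S) :
  measurable_fun [set: borel u] (@ginv S : borel u -> borel u).
Proof. by apply: continuous_borel_map; exact: ginv_continuous. Qed.
Arguments ginv_measurable u : clear implicits.

(** [mu_source] bundled as a measure. The underlying set function is the same, so [L2norm] agrees
    with [l2nrm] by conversion. *)
Definition source_measure (u : S) : {measure set (borel u) -> \bar R} :=
  measure_function_pushforward__canonical__measure_function_Measure (mu u)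
    (ginv_measurable u).

Lemma ginv_image_preimage (A : set S) : @ginv S @` A = @ginv S @^-1` A.
Proof.
apply/seteqP; split => [_ [x Ax <-]|x Ax] /=; first by rewrite ginvK.
by exists (ginv x) => //; rewrite ginvK.
Qed.

Lemma ginv_open (U : set S) : open U -> open (@ginv S @^-1` U).
Proof. by move=> oU; apply: open_comp => // x _; exact: ginv_continuous. Qed.

Lemma ginv_compact (K : set S) : compact K -> compact (@ginv S @^-1` K).
Proof.
move=> cK; rewrite -ginv_image_preimage; apply: continuous_compact => //.
exact/continuous_subspaceT/ginv_continuous.
Qed.

Lemma source_measure_radon u : radon (mu u) -> radon (source_measure u).
Proof.
move=> rm; have invK (A : set S) : @ginv S @^-1` (@ginv S @^-1` A) = A.
  by apply/seteqP; split => x /=; rewrite ginvK.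
split.
- by move=> K cK; apply: (radon_finite rm); exact: ginv_compact.
- move=> A mA.
  have mA' : measurable (@ginv S @^-1` A : set (borel u)).
    by have := ginv_measurable u measurableT _ mA; rewrite setTI.
  rewrite /source_measure /= /pushforward (radon_outer rm mA'); congr ereal_inf.
  apply/seteqP; split => [_ [U [oU AU] <-]|_ [U [oU AU] <-]].
    exists (@ginv S @^-1` U); last by rewrite invK.
    split; first exact: ginv_open.
    by move=> x Ax /=; apply: AU => /=; rewrite ginvK.
  by exists (@ginv S @^-1` U) => //; split; [exact: ginv_open|move=> x /= /AU].
- move=> U oU; rewrite /source_measure /= /pushforward (radon_inner rm (ginv_open oU)).
  congr ereal_sup; apply/seteqP; split => [_ [K [cK KU] <-]|_ [K [cK KU] <-]].
    exists (@ginv S @^-1` K); last by rewrite invK.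
    split; first exact: ginv_compact.
    by move=> x /= /KU /=; rewrite ginvK.
  by exists (@ginv S @^-1` K) => //; split; [exact: ginv_compact|move=> x /= /KU].
Qed.

Lemma measurable_sfib (u : S) : measurable (sfib u : set (borel u)).
Proof. by apply: borel_closed; exact: closed_sfib. Qed.
Arguments measurable_sfib u : clear implicits.

Lemma sfib_ginv (u : S) : @ginv S @^-1` (sfib u) = rfib u.
Proof. by apply/seteqP; split => x /=; rewrite /sfib /rfib /= gsource_inv. Qed.

Lemma L2normE u g : L2norm mu u g = l2nrm (source_measure u) (sfib u) g.
Proof. by []. Qed.

Lemma L2E u g : L2 mu u g <->
  cmeas u (sfib u) g /\ (l2nrm (source_measure u) (sfib u) g < +oo)%E.
Proof. by split => [[]|[[]]]. Qed.

Lemma ge0_cintegral_E (u : S) (w : S -> R) : radon (mu u) ->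
  Cc (fun y => ((w y)%:C)%C : Cplx R) ->
  (\int[mu u]_(y in [set: borel u]) (w y)%:E)%E =
  (complex.Re (cintegral (mu u) setT (fun y => ((w y)%:C)%C : Cplx R)))%:E.
Proof.
move=> rm Cw; rewrite cintegral_real /= fineK//; apply: integrable_fin_num => //.
exact: (Cc_real_integrable (@garrow_hausdorff S) rm Cw).
Qed.
End source_measure.

(** * Twisted functions integrated along a section *)

Section twisted_functions.
Variables (R : realType) (G S : lcgroupoid) (Gam : topologicalZmodType).
Variable E : twist G S Gam.
Hypothesis cGam : compact [set: Gam].
Hypothesis hGam : hausdorff_space Gam.
Variable lam : forall u : G, {measure set (borel u) -> \bar R}.
Hypothesis lamP : haar_system lam.
Variable h : {measure set (borel (0 : Gam)) -> \bar R}.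
Hypothesis hh : normalized_haar h.
Variable mu : forall x : S, {measure set (borel x) -> \bar R}.
Hypothesis muP : induced_haar E lam h mu.
Variable chi : Gam -> Cplx R.
Hypothesis chiP : character chi.
Variable sec : G -> S.
Hypothesis secK : cancel sec (tpi E).
Local Notation C := (Cplx R).
Local Notation act := (tact E).
Local Notation A := (Cchi E chi).

Let mu_radon := fun x (ux : units x) => induced_radon muP ux.
Let mu_conull := fun x (ux : units x) => induced_conull muP ux.
Let mu_cont (k : S -> C) (Ck : Cc k) :
    {within @units S, continuous (fun u => cintegral (mu u) setT k)} :=
  @induced_cintegral_continuous R G S Gam E cGam hGam lam lamP h hh mu muP k Ck.

Lemma Cchi_lin (a : C) f g : A f -> A g -> A (a *: f + g).
Proof.
move=> [Cf ef] [Cg eg]; split; first exact: Cc_lin.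
move=> x b; rewrite -![(a *: f + g) _]/(a * f _ + g _) ef eg mulrDr.
by congr (_ + _); rewrite mulrCA.
Qed.

Lemma gconv_act f g x b : (forall y a, g (act a y) = chi a * g y) ->
  Cc f -> Cc g -> gconv mu f g (act b x) = chi b * gconv mu f g x.
Proof.
move=> eg Cf Cg; rewrite /gconv range_act -cintegralZ.
- apply: eq_cintegral => y yx; rewrite act_mulr ?gsource_inv ?yx// eg.
  by rewrite mulrCA.
- exact: measurable_rfib.
- exact: (conv_cintegrable mu_radon x Cf (proj1 Cg)).
Qed.

Lemma Cchi_conv f g : A f -> A g -> A (gconv mu f g).
Proof.
move=> [Cf ef] [Cg eg]; split.
  exact: (gconv_Cc mu_radon mu_conull mu_cont Cf Cg).
by move=> x b; exact: gconv_act.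
Qed.

Lemma Cchi_star f : A f -> A (gstar f).
Proof.
move=> [Cf ef]; split; first exact: gstar_Cc.
move=> x a; rewrite /gstar act_inv ef rmorphM; congr (_ * _).
by have := char_conj chiP (- a); rewrite opprK.
Qed.

Lemma section_fibre x a y : units x -> rfib (tpi E x) y ->
  rfib x (act a (sec y)).
Proof. by move=> ux yx; rewrite /rfib /= range_act (sec_range secK ux). Qed.

Lemma induced_invariant (k : S -> C) x : units x -> Cc k ->
  (forall y a, k (act a y) = k y) ->
  cintegral (mu x) setT k =
  cintegral (lam (tpi E x)) (rfib (tpi E x)) (fun y => k (sec y)).
Proof.
move=> ux Ck ek; rewrite (induced_integral muP secK ux Ck).
apply: eq_cintegral => y _; rewrite -[RHS](haar_cintegral_cst hh).
by apply: eq_cintegral => a _; exact: ek.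
Qed.

(** At the point a . sec y equivariance of [f] produces [chi a], and inversion moves -a onto the
    argument of [g]; the inner integral over [Gam] is then [chi_mean] of [g]. Only [f] is twisted
    here, and this is where the projection onto twisted functions originates. *)
Lemma gconv_section f g x : A f -> Cc g ->
  gconv mu f g x =
  cintegral (lam (tpi E (grange x))) (rfib (tpi E (grange x)))
    (fun y => f (sec y) * chi_mean E h chi g (gmul (ginv (sec y)) x)).
Proof.
move=> [Cf ef] Cg.
have [k Ck kE] := conv_extension x Cf (proj1 Cg).
have ux := units_range x.
transitivity (cintegral (mu (grange x)) setT k).
  rewrite (cintegral_rfib mu_radon mu_conull ux Ck); apply: eq_cintegral => y yx.
  by rewrite kE.
rewrite (induced_integral muP secK ux Ck); apply: eq_cintegral => y yx.
have sy : gsource (ginv (sec y)) = grange x by rewrite gsource_inv (sec_range secK ux).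
rewrite /chi_mean -cintegralZ//.
  apply: eq_cintegral => a _; rewrite kE; last exact: section_fibre.
  rewrite ef act_inv act_mull//.
  by rewrite mulrA (mulrC (f _)).
apply: (haar_cintegrable cGam hGam hh) => a; apply: cvgM; first exact: (char_continuous chiP).
apply: (@cvg_comp _ _ _ (fun a => act (- a) _) g _ (nbhs (act (- a) (gmul (ginv (sec y)) x)))); last exact: (proj1 Cg).
by apply: act_cvg; [exact: oppr_continuous_top|exact: cvg_cst].
Qed.

(** The two convolutions have the same integral along a section, because [chi_mean] is the identity
    on twisted functions and hence idempotent. *)
Lemma gconv_chi_mean f g : A f -> Cc g ->
  gconv mu f g = gconv mu f (chi_mean E h chi g).
Proof.
move=> Af Cg; have Am := chi_mean_Cchi E cGam hGam hh chiP Cg.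
apply/funext => x; rewrite (gconv_section x Af Cg) (gconv_section x Af (proj1 Am)).
by rewrite (chi_mean_id hh chiP Am).
Qed.

Lemma chi_norm1 a : complex.Re `|chi a| = 1.
Proof. by rewrite (char_norm chiP). Qed.

Lemma Cchi_norm_act f x a : A f -> complex.Re `|f (act a x)| = complex.Re `|f x|.
Proof. by move=> [_ ef]; rewrite ef Re_normM chi_norm1 mul1r. Qed.

Lemma Cc_inv (f : S -> C) : Cc f -> Cc (fun y => f (ginv y)).
Proof.
move=> Cf; apply: (@Cc_sub R S _ (@ginv S @^-1` csupp f) (@garrow_hausdorff S)).
- move=> x; apply: (@cvg_comp _ _ _ (@ginv S) f _ (nbhs (ginv x))); first exact: ginv_continuous.
  exact: (proj1 Cf).
- by apply: ginv_compact; exact: (proj2 Cf).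
- by move=> x nx; apply: csuppN.
Qed.

Lemma abs_integral_section f x : A f -> units x ->
  abs_integral (mu x) f =
  (complex.Re (cintegral (lam (tpi E x)) (rfib (tpi E x))
    (fun y => ((complex.Re `|f (sec y)|)%:C)%C)))%:E.
Proof.
move=> Af ux; rewrite /abs_integral.
have Cn := Cc_norm (proj1 Af).
rewrite (ge0_cintegral_E (mu_radon ux) Cn) (induced_invariant ux Cn)//.
by move=> y a; rewrite Cchi_norm_act.
Qed.

Lemma abs_integral_source_section f x : A f -> units x ->
  abs_integral (mu_source mu (u := x)) f =
  (complex.Re (cintegral (lam (tpi E x)) (rfib (tpi E x))
    (fun y => ((complex.Re `|f (ginv (sec y))|)%:C)%C)))%:E.
Proof.
move=> Af ux; rewrite /abs_integral /mu_source.
have Cn := Cc_norm (Cc_inv (proj1 Af)).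
have mf : measurable_fun [set: borel x] (fun y : borel x => (complex.Re `|f y|)%:E).
  apply/measurable_EFinP; apply: continuous_borel => y.
  by apply: cvg_norm_Re; exact: (proj1 (proj1 Af)).
rewrite (ge0_integral_pushforward (@ginv_measurable S x) (mu x) measurableT mf); last first.
  by move=> y _; rewrite lee_fin Re_norm_ge0.
rewrite preimage_setT (ge0_cintegral_E (mu_radon ux) Cn) (induced_invariant ux Cn)//.
by move=> y a; rewrite act_inv Cchi_norm_act.
Qed.

(** Inversion turns the source fibre into the range fibre, off which [mu x] is null. The result is
    an integral over the whole space, to which the induced formula applies. *)
Lemma l2sq_source_Cc f x : Cc f -> units x ->
  l2sq (source_measure mu x) (sfib x) f =
  (complex.Re (cintegral (mu x) setT (fun y => ((complex.Re `|f (ginv y)| ^+ 2)%:C)%C)))%:E.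
Proof.
move=> Cf ux; rewrite /l2sq.
have Cn := Cc_norm2 (Cc_inv Cf).
have mf : measurable_fun (sfib x : set (borel x)) (fun y : borel x => (complex.Re `|f y| ^+ 2)%:E).
  by apply: cmeas_sq; exact: Cc_cmeas.
rewrite (ge0_integral_pushforward (@ginv_measurable S x) (mu x) (@measurable_sfib S x) mf); last first.
  by move=> y _; rewrite lee_fin sqr_ge0.
rewrite sfib_ginv -(ge0_cintegral_E (mu_radon ux) Cn).
have [ip _] := Cc_cintegrable (@garrow_hausdorff S) (mu_radon ux) Cn.
have mC : measurable (~` rfib x : set (borel x)) by apply: measurableC; exact: measurable_rfib.
by rewrite (negligible_integral mC measurableT ip (mu_conull ux)) setTD setCK.
Qed.

Lemma l2sq_source_section f x : A f -> units x ->
  l2sq (source_measure mu x) (sfib x) f =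
  (complex.Re (cintegral (lam (tpi E x)) (rfib (tpi E x))
    (fun y => ((complex.Re `|f (ginv (sec y))| ^+ 2)%:C)%C)))%:E.
Proof.
move=> Af ux; rewrite (l2sq_source_Cc (proj1 Af) ux) (induced_invariant ux (Cc_norm2 (Cc_inv (proj1 Af))))//.
by move=> y a; rewrite act_inv Cchi_norm_act.
Qed.

(** Jensen's inequality for the square on a probability space: the integral of (u - c)^2 is
    nonnegative, with c the mean of u. *)
Lemma haar_jensen_real (u : Gam -> R) : continuous u ->
  (fine (\int[h]_(a in [set: borel (0 : Gam)]) (u a)%:E)) ^+ 2 <=
  fine (\int[h]_(a in [set: borel (0 : Gam)]) (u a ^+ 2)%:E).
Proof.
move=> cu; set c := fine _.
have cu2 : continuous (fun a => u a ^+ 2).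
  exact: continuous_sqr.
have intg (v : Gam -> R) : continuous v -> h.-integrable [set: borel (0 : Gam)] (fun a => (v a)%:E).
  move=> cv; apply: (@within_continuous_integrable R Gam 0 h hGam (haar_radon hh) setT setT v closedT cGam) => //.
  exact: continuous_subspaceT.
have [i1 e1] := fine_integral_lin measurableT 1 (- (2 * c)) (intg _ cu2) (intg _ cu).
have c1 : continuous (fun _ : Gam => 1 : R) by move=> a; exact: cvg_cst.
have i0 := intg _ c1.
have [i2 e2] := fine_integral_lin measurableT 1 (c ^+ 2) i1 i0.
have : 0 <= fine (\int[h]_(a in [set: borel (0 : Gam)]) (1 * (1 * u a ^+ 2 + - (2 * c) * u a) + c ^+ 2 * 1)%:E).
  apply/fine_ge0/integral_ge0 => a _; rewrite lee_fin.
  rewrite (_ : _ + _ = (u a - c) ^+ 2); first exact: sqr_ge0.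
  by move: (u a) => r; ring.
rewrite e2 e1 (haar_integral_cst hh)/= -/c; nra.
Qed.

Lemma haar_jensen (f : Gam -> C) : continuous f ->
  complex.Re `|cintegral h setT f| ^+ 2 <=
  fine (\int[h]_(a in [set: borel (0 : Gam)]) (complex.Re `|f a| ^+ 2)%:E).
Proof.
move=> cf; rewrite sqr_Re_norm /=.
have cr : continuous (fun a => complex.Re (f a)) by move=> a; apply: cvg_Re; exact: cf.
have ci : continuous (fun a => complex.Im (f a)) by move=> a; apply: cvg_Im; exact: cf.
apply: le_trans (lerD (haar_jensen_real cr) (haar_jensen_real ci)) _.
have sq (v : Gam -> R) : continuous v -> continuous (fun a => v a ^+ 2).
  exact: continuous_sqr.
have intg (v : Gam -> R) : continuous v -> h.-integrable [set: borel (0 : Gam)] (fun a => (v a)%:E).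
  move=> cv; apply: (@within_continuous_integrable R Gam 0 h hGam (haar_radon hh) setT setT v closedT cGam) => //.
  exact: continuous_subspaceT.
have [_] := fine_integral_lin measurableT 1 1 (intg _ (sq _ cr)) (intg _ (sq _ ci)).
rewrite !mul1r => <-; rewrite le_eqVlt; apply/orP; left; apply/eqP; congr fine.
by apply: eq_integral => a _; rewrite !mul1r sqr_Re_norm.
Qed.

Lemma descend_Cc (k : S -> C) : Cc k -> (forall y a, k (act a y) = k y) ->
  Cc (fun y => k (sec y)).
Proof.
move=> Ck ek; pose phi y := k (sec y).
have phiE : phi \o tpi E = k.
  apply/funext => x; have [a xa] := act_trans (secK (tpi E x)).
  by rewrite /phi /= [in RHS]xa ek.
apply: (@Cc_sub R G phi (tpi E @` csupp k) (@garrow_hausdorff G)).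
- apply/continuousP => U oU; apply: (@tpi_quotient _ _ _ E).
  rewrite -comp_preimage phiE; move/continuousP : (proj1 Ck); exact.
- apply: continuous_compact; last exact: (proj2 Ck).
  exact/continuous_subspaceT/tpi_continuous.
- move=> y ny; rewrite /phi; apply: csuppN => h1; apply: ny.
  by exists (sec y).
Qed.

(** Since chi has modulus 1, Jensen's inequality on each orbit bounds the squared modulus of the
    average by the average of the squared modulus. Integration against [lam] yields the two L^2
    norms; for [f], whose modulus may vary along orbits, the induced formula brings in the orbit
    mean [orbit_mean E h w]. *)
Lemma l2sq_chi_mean f x : Cc f -> units x ->
  (l2sq (source_measure mu x) (sfib x) (chi_mean E h chi f) <=
   l2sq (source_measure mu x) (sfib x) f)%E.
Proof.
move=> Cf ux; have Am := chi_mean_Cchi E cGam hGam hh chiP Cf.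
rewrite (l2sq_source_section Am ux) (l2sq_source_Cc Cf ux) lee_fin.
have Cn := Cc_norm2 (Cc_inv Cf).
have Com := orbit_mean_Cc E cGam hGam hh Cn.
set w := (fun y => _) in Cn Com *.
have iw y : orbit_mean E h w y = ((complex.Re (orbit_mean E h w y))%:C)%C.
  by rewrite /orbit_mean /w cintegral_real.
have act_w y a : orbit_mean E h w (act a y) = orbit_mean E h w y.
  exact: (@orbit_mean_act R G S Gam E cGam hGam h hh w a y (proj1 Cn)).
have -> : cintegral (mu x) setT w =
    cintegral (lam (tpi E x)) (rfib (tpi E x)) (fun y => ((complex.Re (orbit_mean E h w (sec y)))%:C)%C).
  rewrite (induced_integral muP secK ux Cn); apply: eq_cintegral => y _.
  by rewrite -iw.
have ReC (r : R) : complex.Re (r%:C)%C = r by [].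
rewrite !cintegral_real !ReC.
(* Both orbit-invariant integrands descend to functions in C_c(G), which makes them integrable
   against [lam]. *)
have C1 := descend_Cc (Cc_norm2 (Cc_inv (proj1 Am))).
have {}C1 := C1 (fun y a => congr1 (fun r => ((r ^+ 2)%:C)%C) (etrans (congr1 (fun z => complex.Re `|chi_mean E h chi f z|) (act_inv E a y)) (Cchi_norm_act _ _ Am))).
have C2 := descend_Cc Com act_w.
have uu := tpi_unit E ux.
have hG := @garrow_hausdorff G.
have rl := haar_system_radon lamP uu.
have sub := @subsetT _ (rfib (tpi E x)).
have I1 := integrableS measurableT (measurable_rfib (tpi E x)) sub (proj1 (Cc_cintegrable hG rl C1)).
have I2 := integrableS measurableT (measurable_rfib (tpi E x)) sub (proj1 (Cc_cintegrable hG rl C2)).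
apply: fine_le.
- exact: (integrable_fin_num (measurable_rfib (tpi E x)) I1).
- exact: (integrable_fin_num (measurable_rfib (tpi E x)) I2).
apply: (le_integral (measurable_rfib (tpi E x)) I1 I2) => y /set_mem yx; rewrite lee_fin.
have cf : continuous (fun a => chi a * f (act (- a) (ginv (sec y)))).
  move=> a; apply: cvgM; first exact: (char_continuous chiP).
  apply: (@cvg_comp _ _ _ (fun a => act (- a) _) f _ (nbhs (act (- a) (ginv (sec y))))); last exact: (proj1 Cf).
  by apply: act_cvg; [exact: oppr_continuous_top|exact: cvg_cst].
have := haar_jensen cf; rewrite -/(chi_mean E h chi f (ginv (sec y))) => /le_trans; apply.
rewrite /orbit_mean /w cintegral_real /= le_eqVlt; apply/orP; left; apply/eqP.
congr fine; apply: eq_integral => a _.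
rewrite act_inv; congr ((_ ^+ 2)%:E).
by apply: etrans (Re_normM _ _) _; rewrite chi_norm1 mul1r.
Qed.
End twisted_functions.

Lemma exists_geometric_le (R : realType) (e : R) : 0 < e ->
  exists n, (4^-1 : R) ^+ n <= e.
Proof.
move=> e0; exists (Num.truncn (e^-1)).
rewrite exprVn invf_ple ?posrE ?exprn_gt0//.
have /andP[_ /ltW h] := truncn_itv (ltW (eq_ind_r is_true e0 (invr_gt0 e))).
apply: (le_trans h); rewrite -natrX ler_nat; exact: ltn_expl.
Qed.

Lemma ex2_and (T : Type) (P Q : T -> Prop) : (exists2 x, P x & Q x) -> exists x, P x /\ Q x.
Proof. by case=> x; exists x. Qed.

(** * The reduced norm *)

Section bounded_extension.
Variables (R : realType) (T : topologicalType) (t : T).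
Variable m : {measure set (borel t) -> \bar R}.
Variable D : set T.
Hypothesis mD : measurable (D : set (borel t)).
Hypothesis lcT : locally_compact [set: T].
Hypothesis hT : hausdorff_space T.
Hypothesis rm : radon m.
Local Notation C := (Cplx R).
Local Notation nrm := (l2nrm m D).
Local Notation meas := (cmeas t D).

Lemma Cc_l2nrm_lty (f : T -> C) : Cc f -> (nrm f < +oo)%E.
Proof.
move=> Cf; rewrite l2nrm_lty.
have I := integrableS measurableT mD (@subsetT _ D) (Cc_real_integrable hT rm (Cc_norm2 Cf)).
by have := integrable_fin_num mD I; rewrite fin_numE => /andP[_]; rewrite -ltey.
Qed.

Lemma l2nrm_tri (f g : T -> C) : meas f -> meas g ->
  (nrm f <= nrm (f - g)%R + nrm g)%E.
Proof.
by move=> mf mg; rewrite -{1}(subrK g f); apply: l2nrmD => //; exact: cmeasB.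
Qed.

Lemma l2nrm_lin_le (a : C) (f g : T -> C) (d : R) : meas f -> meas g ->
  (nrm f <= d%:E)%E -> (nrm g <= d%:E)%E ->
  (nrm (a *: f + g)%R <= ((complex.Re `|a| + 1) * d)%:E)%E.
Proof.
move=> mf mg fd gd; apply: le_trans (l2nrmD m mD (cmeasZ a mf) mg) _.
rewrite l2nrmZ// mulrDl mul1r EFinD EFinM; apply: leeD => //.
by apply: lee_wpmul2l => //; rewrite lee_fin Re_norm_ge0.
Qed.

Variable L : (T -> C) -> T -> C.
Hypothesis L_Cc : forall f, Cc f -> Cc (L f).
Hypothesis L_lin : forall (a : C) f g, Cc f -> Cc g -> L (a *: f + g) = a *: L f + L g.

Definition op_bound (b : R) : Prop :=
  0 <= b /\ forall f, Cc f -> (nrm (L f) <= b%:E * nrm f)%E.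

(** The closure in L^2 x L^2 of the graph of [L] on C_c: [k] is a value at [g] of the continuous
    extension of [L]. As a relation it avoids representatives of L^2 classes; for bounded [L] it is
    single-valued up to null functions. *)
Definition graph_closure (g k : T -> C) : Prop :=
  meas k /\ forall e : R, 0 < e -> exists f,
    [/\ Cc f, (nrm (g - f)%R <= e%:E)%E & (nrm (k - L f)%R <= e%:E)%E].

Lemma graph_closure_Cc f : Cc f -> graph_closure f (L f).
Proof.
move=> Cf; split; first exact/Cc_cmeas/L_Cc.
by move=> e e0; exists f; split => //; rewrite subrr l2nrm0 lee_fin ltW.
Qed.

Lemma graph_closure_lin (a : C) g1 k1 g2 k2 : meas g1 -> meas g2 ->
  graph_closure g1 k1 -> graph_closure g2 k2 ->
  graph_closure (a *: g1 + g2) (a *: k1 + k2).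
Proof.
move=> mg1 mg2 [mk1 G1] [mk2 G2]; split; first exact: cmeas_lin.
move=> e e0; have a0 := Re_norm_ge0 a; pose d := e / (complex.Re `|a| + 1).
have p0 : 0 < complex.Re `|a| + 1 by rewrite ltr_wpDl.
have d0 : 0 < d by rewrite divr_gt0.
have ed : e = (complex.Re `|a| + 1) * d by rewrite /d mulrC divfK// gt_eqF.
have [f1 [C1 gf1 kf1]] := G1 _ d0; have [f2 [C2 gf2 kf2]] := G2 _ d0.
have sub (u1 u2 v1 v2 : T -> C) :
    (a *: u1 + u2) - (a *: v1 + v2) = a *: (u1 - v1) + (u2 - v2).
  by rewrite scalerBr opprD addrACA.
exists (a *: f1 + f2); split; first exact: Cc_lin.
- rewrite sub ed; apply: l2nrm_lin_le => //; apply: cmeasB => //; exact: Cc_cmeas.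
- rewrite (L_lin a C1 C2) sub ed; apply: l2nrm_lin_le => //; apply: cmeasB => //; exact/Cc_cmeas/L_Cc.
Qed.

Lemma graph_closure_bound b g k : op_bound b -> meas g -> (nrm g < +oo)%E ->
  graph_closure g k -> (nrm k <= b%:E * nrm g)%E.
Proof.
move=> [b0 bL] mg fg [mk G]; apply/lee_addgt0Pr => e e0.
have b1 : 0 < b + 1 by rewrite ltr_wpDl.
pose d := e / (b + 1); have d0 : 0 < d by rewrite divr_gt0.
have ed : e = d * (b + 1) by rewrite /d divfK// gt_eqF.
have [f [Cf gf kf]] := G _ d0.
have mf := Cc_cmeas t D Cf; have mLf := Cc_cmeas t D (L_Cc Cf).
have gE : nrm g = (fine (nrm g))%:E by rewrite fineK// ge0_fin_numE// l2nrm_ge0.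
have fE : (nrm f <= (d + fine (nrm g))%:E)%E.
  apply: le_trans (l2nrm_tri mf mg) _; rewrite EFinD -gE.
  by apply: leeD => //; rewrite l2nrm_dist.
apply: le_trans (l2nrm_tri mk mLf) _.
apply: (@le_trans _ _ (d%:E + b%:E * (d + fine (nrm g))%:E)%E).
  apply: leeD => //; apply: le_trans (bL _ Cf) _.
  by apply: lee_wpmul2l => //; rewrite lee_fin.
rewrite gE -!EFinM -!EFinD lee_fin ed; lra.
Qed.

(** By linearity the difference of two values at [g] is a value at 0, and the bound forces such a
    value to have norm 0. *)
Lemma graph_closure_uniq b g k1 k2 : op_bound b -> meas g ->
  graph_closure g k1 -> graph_closure g k2 -> nrm (k1 - k2)%R = 0%E.
Proof.
move=> bL mg G1 G2; have := graph_closure_lin (-1) mg mg G2 G1.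
rewrite !scaleN1r addrC subrr addrC => G.
apply/eqP; rewrite eq_le l2nrm_ge0 andbT.
have := graph_closure_bound bL (cmeas0 R t D) _ G.
by rewrite l2nrm0 mule0; apply; rewrite ltry.
Qed.

Lemma graph_closure_ex b g : op_bound b -> meas g -> (nrm g < +oo)%E ->
  exists k, graph_closure g k.
Proof.
move=> [b0 bL] mg fg.
have b1 : 0 < b + 1 by rewrite ltr_wpDl.
(* Chosen so that b * (2 * d n) = (4^-n / 2) * (b / (b + 1)), within the increments allowed by
   [l2_complete]; b + 1 keeps the denominator positive when b = 0. *)
pose d n : R := 4^-1 ^+ n / (4 * (b + 1)).
have q0 n : 0 < (4^-1 : R) ^+ n by rewrite exprn_gt0.
have d0 n : 0 < d n by rewrite divr_gt0// mulr_gt0.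
have [phi phiP] := choice (fun n => ex2_and (Cc_dense mD lcT hT rm mg fg (d0 n))).
have Cphi n := proj1 (phiP n).
have dphi n : (nrm (phi n.+1 - phi n)%R <= (2 * d n)%:E)%E.
  apply: le_trans (l2nrmB_tri m mD (Cc_cmeas t D (Cphi n.+1)) mg (Cc_cmeas t D (Cphi n))) _.
  rewrite mulr_natl mulr2n EFinD; apply: leeD; last exact: (proj2 (phiP n)).
  rewrite l2nrm_dist; apply: le_trans (proj2 (phiP n.+1)) _.
  rewrite lee_fin /d ler_pM2r ?invr_gt0 ?mulr_gt0// exprS.
  by rewrite ger_pMl//; lra.
have LB n : L (phi n.+1) - L (phi n) = L (phi n.+1 - phi n).
  have := L_lin (-1) (Cphi n) (Cphi n.+1).
  by rewrite !scaleN1r ![- _ + _]addrC => ->.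
have CB n : Cc (phi n.+1 - phi n).
  by have := Cc_lin (-1) (Cphi n) (Cphi n.+1); rewrite scaleN1r addrC.
have LE n : (nrm (L (phi n.+1) - L (phi n))%R <= (4^-1 ^+ n / 2)%:E)%E.
  rewrite LB; apply: le_trans (bL _ (CB n)) _.
  apply: (@le_trans _ _ (b%:E * (2 * d n)%:E)%E).
    by apply: lee_wpmul2l => //; rewrite lee_fin.
  rewrite -EFinM lee_fin (_ : b * (2 * d n) = (4^-1 ^+ n / 2) * (b / (b + 1))).
    rewrite ger_pMr ?divr_gt0// ler_pdivrMr// mul1r; lra.
  by rewrite /d; field; rewrite gt_eqF.
have [k mk kP] := l2_complete mD (fun n => Cc_cmeas t D (L_Cc (Cphi n))) LE.
exists k; split => // e e0; have [n ne] := exists_geometric_le e0.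
exists (phi n); split => //.
- apply: le_trans (proj2 (phiP n)) _; rewrite lee_fin; apply: le_trans ne.
  rewrite /d ler_pdivrMr ?mulr_gt0// ler_peMr ?(ltW (q0 n))//; lra.
- by apply: le_trans (kP n) _; rewrite lee_fin.
Qed.
End bounded_extension.

(** * The operators Ind delta_u and their norms *)

Section ind_delta.
Variables (R : realType) (S : lcgroupoid).
Variable mu : forall x : S, {measure set (borel x) -> \bar R}.
Hypothesis mu_radon : forall x, units x -> radon (mu x).
Hypothesis mu_conull : forall x, units x -> mu x (~` rfib x : set (borel x)) = 0%E.
Hypothesis mu_cont : forall k : S -> Cplx R, Cc k ->
  {within @units S, continuous (fun u => cintegral (mu u) setT k)}.
Variables (u : S) (f : S -> Cplx R).
Hypothesis uu : units u.
Hypothesis Cf : Cc f.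
Local Notation C := (Cplx R).
Local Notation m := (source_measure mu u).
Local Notation nrm := (l2nrm (source_measure mu u) (sfib u)).
Local Notation meas := (cmeas u (sfib u)).

Definition Ind_bound (b : R) : Prop := op_bound m (sfib u) (gconv mu f) b.

Let mD := @measurable_sfib S u.
Let lcS := @garrow_locally_compact S.
Let hS := @garrow_hausdorff S.
Let rm := source_measure_radon (mu_radon uu).
Let conv_Cc g (Cg : Cc g) : Cc (gconv mu f g) := gconv_Cc mu_radon mu_conull mu_cont Cf Cg.
Let conv_lin (a : C) g1 g2 (C1 : Cc g1) (C2 : Cc g2) :
    gconv mu f (a *: g1 + g2) = a *: gconv mu f g1 + gconv mu f g2 :=
  gconv_lin mu_radon a Cf (proj1 C1) (proj1 C2).
Local Notation graph := (graph_closure m (sfib u) (gconv mu f)).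

Lemma Cc_L2 g : Cc g -> L2 mu u g.
Proof. by move=> Cg; apply/L2E; split; [exact: Cc_cmeas|exact: (Cc_l2nrm_lty mD hS rm Cg)]. Qed.

Lemma L2_lin (a : C) g1 g2 : L2 mu u g1 -> L2 mu u g2 -> L2 mu u (a *: g1 + g2).
Proof.
move=> /L2E[m1 f1] /L2E[m2 f2]; apply/L2E; split; first exact: cmeas_lin.
apply: le_lt_trans (l2nrmD m mD (cmeasZ a m1) m2) _.
rewrite l2nrmZ//; apply: lte_add_pinfty => //.
rewrite -(@fineK _ (nrm g1)) ?ge0_fin_numE ?l2nrm_ge0//.
by rewrite -EFinM ltry.
Qed.

(** A value of the closed graph is chosen at each square-integrable function. The choices are linear
    and agree with convolution only up to null functions, which is what [is_Ind_delta] requires. *)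
Lemma Ind_exists b : Ind_bound b -> exists Top, is_Ind_delta mu u f Top.
Proof.
move=> bL.
have ex g : exists k, L2 mu u g -> graph g k.
  have [Lg|nLg] := pselect (L2 mu u g); last by exists 0.
  have [mg fg] := (L2E _ _ _).1 Lg.
  by have [k kP] := graph_closure_ex mD lcS hS rm conv_Cc conv_lin bL mg fg; exists k.
have [Top TopP] := choice ex; exists Top.
have bound g : L2 mu u g -> (nrm (Top g) <= b%:E * nrm g)%E.
  move=> Lg; have [mg fg] := (L2E _ _ _).1 Lg.
  exact: (graph_closure_bound mD conv_Cc bL mg fg (TopP _ Lg)).
split.
- move=> g Lg; have [mk _] := TopP _ Lg; have [mg fg] := (L2E _ _ _).1 Lg.
  apply/L2E; split => //; apply: le_lt_trans (bound _ Lg) _.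
  by rewrite -(@fineK _ (nrm g)) ?ge0_fin_numE ?l2nrm_ge0// -EFinM ltry.
- move=> a g1 g2 L1 L2'; have [m1 _] := (L2E _ _ _).1 L1; have [m2 _] := (L2E _ _ _).1 L2'.
  rewrite /L2eq L2normE.
  apply: (graph_closure_uniq mD conv_Cc conv_lin bL (cmeas_lin a m1 m2)).
    exact/TopP/L2_lin.
  by apply: (graph_closure_lin mD conv_Cc conv_lin) => //; exact: TopP.
- by exists b => g Lg; rewrite !L2normE; exact: bound.
- move=> g Cg; rewrite /L2eq L2normE.
  apply: (graph_closure_uniq mD conv_Cc conv_lin bL (Cc_cmeas u (sfib u) Cg)).
    exact/TopP/Cc_L2.
  exact: graph_closure_Cc.
Qed.

Lemma Ind_bounded_ge0 Top : is_Ind_delta mu u f Top ->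
  exists2 c : R, 0 <= c & forall g, L2 mu u g -> (nrm (Top g) <= c%:E * nrm g)%E.
Proof.
move=> TP; have [c cP] := Ind_bounded TP; exists (Num.max c 0); first by rewrite le_max lexx orbT.
move=> g Lg; apply: le_trans (cP _ Lg) _; rewrite L2normE.
by apply: lee_wpmul2r; rewrite ?l2nrm_ge0// lee_fin le_max lexx.
Qed.

Lemma Ind_conv_nrm Top g : is_Ind_delta mu u f Top -> Cc g ->
  nrm (Top g) = nrm (gconv mu f g).
Proof.
move=> TP Cg; have [mT _] := (L2E _ _ _).1 (Ind_L2 TP (Cc_L2 Cg)).
apply: (l2nrm_eq0 mD mT); last exact: (Ind_conv TP Cg).
exact/Cc_cmeas/conv_Cc.
Qed.

Lemma Ind_has_bound Top : is_Ind_delta mu u f Top -> exists b, Ind_bound b.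
Proof.
move=> TP; have [c c0 cP] := Ind_bounded_ge0 TP; exists c; split => // g Cg.
by rewrite -(Ind_conv_nrm TP Cg); exact/cP/Cc_L2.
Qed.

(** By density of C_c and boundedness, every realisation of Ind delta_u (f) takes its values in the
    closed graph of convolution, so estimates on C_c control all realisations at once. *)
Lemma Ind_graph Top g : is_Ind_delta mu u f Top -> L2 mu u g -> graph g (Top g).
Proof.
move=> TP Lg; have [mg fg] := (L2E _ _ _).1 Lg.
have [mT _] := (L2E _ _ _).1 (Ind_L2 TP Lg); split => // e e0.
have [c c0 cP] := Ind_bounded_ge0 TP.
have c1 : 0 < c + 1 by rewrite ltr_wpDl.
pose d := e / (c + 1); have d0 : 0 < d by rewrite divr_gt0.
have ed : e = d * (c + 1) by rewrite /d divfK// gt_eqF.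
have [phi Cphi gphi] := Cc_dense mD lcS hS rm mg fg d0.
have Lphi := Cc_L2 Cphi.
have [mTphi _] := (L2E _ _ _).1 (Ind_L2 TP Lphi).
have mLphi := Cc_cmeas u (sfib u) (conv_Cc Cphi).
exists phi; split => //.
  by apply: le_trans gphi _; rewrite lee_fin ed; apply: ler_peMr; [exact: ltW|lra].
apply: le_trans (l2nrmB_tri m mD mT mTphi mLphi) _.
have := Ind_conv TP Cphi; rewrite /L2eq L2normE => ->; rewrite adde0.
have Lsub := L2_lin (-1) Lphi Lg.
have [mTs _] := (L2E _ _ _).1 (Ind_L2 TP Lsub).
have lin := Ind_linear TP (-1) Lphi Lg; rewrite /L2eq L2normE in lin.
have := l2nrm_eq0 mD mTs (cmeas_lin (-1) mTphi mT) lin.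
rewrite !scaleN1r [- Top phi + _]addrC => <-.
have := cP _ Lsub; rewrite !scaleN1r => /le_trans; apply.
rewrite [- phi + _]addrC; apply: (@le_trans _ _ (c%:E * d%:E)%E).
  by apply: lee_wpmul2l => //; rewrite lee_fin.
rewrite -EFinM lee_fin ed mulrC ler_pM2l//; lra.
Qed.

Lemma Ind_delta_norm_le b : Ind_bound b -> (Ind_delta_norm mu u f <= b%:E)%E.
Proof.
move=> bL; apply: ub_ereal_sup => _ [->|[Top [g [TP Lg g1 ->]]]].
  by rewrite lee_fin; case: bL.
have [mg fg] := (L2E _ _ _).1 Lg; rewrite !L2normE in g1 *.
apply: le_trans (graph_closure_bound mD conv_Cc bL mg fg (Ind_graph TP Lg)) _.
by rewrite -[leRHS]mule1; apply: lee_wpmul2l => //; rewrite lee_fin; case: bL.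
Qed.

Lemma Ind_delta_norm_ge0 : (0 <= Ind_delta_norm mu u f)%E.
Proof. by apply: ereal_sup_ubound; left. Qed.

(** A function of nonzero norm is scaled to norm 1, where the supremum applies; for a function of
    norm 0 the given bound [b] already makes the convolution null. The bound [b] also ensures that
    the supremum is finite and that an operator exists. *)
Lemma Ind_delta_norm_bound b : Ind_bound b ->
  Ind_bound (fine (Ind_delta_norm mu u f)).
Proof.
move=> bL; have [Top TP] := Ind_exists bL.
have N0 := Ind_delta_norm_ge0.
have NE : Ind_delta_norm mu u f = (fine (Ind_delta_norm mu u f))%:E.
  rewrite fineK// ge0_fin_numE//.
  by apply: le_lt_trans (Ind_delta_norm_le bL) _; rewrite ltry.
split; first exact: fine_ge0.
move=> g Cg; rewrite -NE.
have fg := Cc_l2nrm_lty mD hS rm Cg.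
have mg := Cc_cmeas u (sfib u) Cg.
have gE : nrm g = (fine (nrm g))%:E by rewrite fineK// ge0_fin_numE// l2nrm_ge0.
have [g0|g0] := eqVneq (nrm g) 0%E.
  by have := (proj2 bL) _ Cg; rewrite g0 !mule0.
have r0 : 0 < fine (nrm g).
  by rewrite -lte_fin -gE lt_neqAle eq_sym g0 l2nrm_ge0.
pose s : R := (fine (nrm g))^-1.
have s0 : 0 < s by rewrite invr_gt0.
pose a : C := ((s)%:C)%C.
have aE : complex.Re `|a| = s by rewrite /a norm_real_complex gtr0_norm.
have C0 := Cc0 R hS.
have Ca : Cc (a *: g) by have := Cc_lin a Cg C0; rewrite addr0.
have conv0 : gconv mu f 0 = 0.
  by have := conv_lin (-1) C0 C0; rewrite !scaleN1r oppr0 addr0 addNr.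
have aL : gconv mu f (a *: g) = a *: gconv mu f g.
  by have := conv_lin a Cg C0; rewrite !addr0 conv0 addr0.
have : (nrm (gconv mu f (a *: g)) <= Ind_delta_norm mu u f)%E.
  rewrite -(Ind_conv_nrm TP Ca); apply: ereal_sup_ubound; right.
  exists Top, (a *: g); split => //; first exact: Cc_L2.
  by rewrite L2normE l2nrmZ// aE gE -EFinM mulVf// gt_eqF.
rewrite aL l2nrmZ//; last exact/Cc_cmeas/conv_Cc.
rewrite aE gE NE => h.
have fL := Cc_l2nrm_lty mD hS rm (conv_Cc Cg).
move: h; rewrite -(@fineK _ (nrm (gconv mu f g))) ?ge0_fin_numE ?l2nrm_ge0//.
by rewrite -!EFinM !lee_fin /s mulrC ler_pdivrMr.
Qed.

(** Every realisation of the operator supplies a bound, so here the supremum ranges over no operator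
    and takes its default value 0. *)
Lemma Ind_delta_norm_no_bound : ~ (exists b, Ind_bound b) -> Ind_delta_norm mu u f = 0%E.
Proof.
move=> nb; apply/eqP; rewrite eq_le Ind_delta_norm_ge0 andbT.
apply: ub_ereal_sup => c [->//|[Top [g [TP _ _ _]]]].
by exfalso; apply: nb; exact: Ind_has_bound TP.
Qed.

(** The norm is thus a function of the set of bounds alone, and comparing reduced norms comes down
    to comparing these sets. *)
Lemma Ind_delta_normE :
  Ind_delta_norm mu u f =
  if pselect (exists b, Ind_bound b) then ereal_inf [set b%:E | b in Ind_bound] else 0%E.
Proof.
case: pselect => [[b bL]|/Ind_delta_norm_no_bound//].
apply/eqP; rewrite eq_le; apply/andP; split.
  by apply: le_ereal_inf_tmp => _ [c cL <-]; exact: Ind_delta_norm_le.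
apply: ereal_inf_lbound; exists (fine (Ind_delta_norm mu u f)).
  exact: Ind_delta_norm_bound bL.
rewrite fineK// ge0_fin_numE ?Ind_delta_norm_ge0//.
by apply: le_lt_trans (Ind_delta_norm_le bL) _; rewrite ltry.
Qed.
End ind_delta.

Section ind_twisted.
Variables (R : realType) (G S : lcgroupoid) (Gam : topologicalZmodType).
Variable E : twist G S Gam.
Hypothesis cGam : compact [set: Gam].
Hypothesis hGam : hausdorff_space Gam.
Variable lam : forall u : G, {measure set (borel u) -> \bar R}.
Hypothesis lamP : haar_system lam.
Variable h : {measure set (borel (0 : Gam)) -> \bar R}.
Hypothesis hh : normalized_haar h.
Variable mu : forall x : S, {measure set (borel x) -> \bar R}.
Hypothesis muP : induced_haar E lam h mu.
Variable chi : Gam -> Cplx R.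
Hypothesis chiP : character chi.
Local Notation A := (Cchi E chi).
Local Notation nrm u := (l2nrm (source_measure mu u) (sfib u)).

Lemma l2nrm_chi_mean f u : Cc f -> units u ->
  (nrm u (chi_mean E h chi f) <= nrm u f)%E.
Proof.
move=> Cf uu; have [sec secK] := tpi_section E.
have fg := Cc_l2nrm_lty (@measurable_sfib S u) (@garrow_hausdorff S)
  (source_measure_radon (induced_radon muP uu)) Cf.
rewrite -(@fineK _ (nrm u f)) ?ge0_fin_numE ?l2nrm_ge0//.
rewrite l2nrm_le ?fine_ge0 ?l2nrm_ge0// -l2nrm_sq//.
exact: (l2sq_chi_mean cGam hGam lamP hh muP chiP secK Cf uu).
Qed.

Lemma Ind_bound_twisted f u b : A f -> units u ->
  Ind_bound mu u f b <->
  0 <= b /\ forall g, A g -> (nrm u (gconv mu f g) <= b%:E * nrm u g)%E.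
Proof.
move=> Af uu; have [sec secK] := tpi_section E; split=> -[b0 bL]; split => // g.
  by move=> [Cg _]; exact: bL.
move=> Cg; rewrite (gconv_chi_mean cGam hGam hh muP chiP secK Af Cg).
apply: le_trans (bL _ (chi_mean_Cchi E cGam hGam hh chiP Cg)) _.
by apply: lee_wpmul2l; [rewrite lee_fin|exact: l2nrm_chi_mean].
Qed.

Lemma Ind_delta_norm_inf f u : A f -> units u ->
  Ind_delta_norm mu u f =
  if pselect (exists b, Ind_bound mu u f b)
  then ereal_inf [set b%:E | b in Ind_bound mu u f] else 0%E.
Proof.
move=> [Cf _] uu.
have mu_radon x (ux : units x) := induced_radon muP ux.
have mu_conull x (ux : units x) := induced_conull muP ux.
have mu_cont (k : S -> Cplx R) (Ck : Cc k) :
    {within @units S, continuous (fun u => cintegral (mu u) setT k)} :=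
  @induced_cintegral_continuous R G S Gam E cGam hGam lam lamP h hh mu muP k Ck.
exact: (Ind_delta_normE mu_radon mu_conull mu_cont uu Cf).
Qed.
End ind_twisted.

(** * Morphisms of twists *)

Section twist_morphism.
Variables (R : realType) (G S S' : lcgroupoid) (Gam Gam' : topologicalZmodType).
Variables (E : twist G S Gam) (E' : twist G S' Gam').
Variables (theta : {additive Gam -> Gam'}) (theta1 : S -> S').
Hypothesis cGam : compact [set: Gam].
Hypothesis cGam' : compact [set: Gam'].
Hypothesis theta1_continuous : continuous theta1.
Hypothesis theta1_hom : groupoid_hom theta1.
Hypothesis theta1_iota : forall (u : G) (a : Gam), units u ->
  theta1 (tiota E (u, a)) = tiota E' (u, theta a).
Hypothesis theta1_pi : forall x, tpi E' (theta1 x) = tpi E x.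
Variable chi' : Gam' -> Cplx R.
Hypothesis chi'P : character chi'.
Local Notation C := (Cplx R).
Local Notation chi := (chi' \o theta : Gam -> C).
Local Notation A := (Cchi E chi).
Local Notation A' := (Cchi E' chi').

Lemma comp_character : continuous theta -> character chi.
Proof.
move=> ct; split.
- move=> a; apply: (@cvg_comp _ _ _ theta chi' _ (nbhs (theta a))); first exact: ct.
  exact: (char_continuous chi'P).
- by move=> a; exact: (char_norm chi'P).
- by move=> a b /=; rewrite raddfD (char_mul chi'P).
Qed.

Lemma theta1_act a x : theta1 (tact E a x) = tact E' (theta a) (theta1 x).
Proof.
rewrite /tact (hom_mul theta1_hom) ?(tcentral_l E)//.
rewrite theta1_iota; last exact/tpi_unit/units_range.
by rewrite (hom_range theta1_hom) theta1_pi.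
Qed.

Lemma twist_lift (x' : S') : exists p : Gam' * S, x' = tact E' p.1 (theta1 p.2).
Proof.
have [x xx'] := tpi_surjective E (tpi E' x').
have [b ->] := @act_trans _ _ _ E' (theta1 x) x' (etrans (theta1_pi x) xx').
by exists (b, x).
Qed.

Lemma units_lift (u' : S') : units u' -> exists2 u : S, units u & theta1 u = u'.
Proof.
move=> uu'; have [u uu e] := tpi_unit_surj E (tpi_unit E' uu').
exists u => //; apply: (@tpi_unit_inj _ _ _ E') => //; last by rewrite theta1_pi.
exact: (hom_unit theta1_hom).
Qed.

Definition transfer (f : S -> C) (x' : S') : C :=
  let p := projT1 (cid (twist_lift x')) in chi' p.1 * f p.2.

(** Independence of the chosen lift: two presentations b . theta1 x = c . theta1 y have base points
    in one orbit, y = a . x; freeness of the action on [S'] gives b = c + theta a, and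
    [chi' (theta a)] is exactly the factor by which [f] changes from [x] to [y]. *)
Lemma transferE f b x : A f -> transfer f (tact E' b (theta1 x)) = chi' b * f x.
Proof.
move=> [_ ef]; rewrite /transfer; case: cid => -[c y] /= e.
have xy : tpi E x = tpi E y.
  by have := congr1 (tpi E') e; rewrite !tpi_act !theta1_pi.
have [a ya] := act_trans xy.
move: e; rewrite ya theta1_act -actD => /act_inj ->.
by rewrite ef (char_mul chi'P) mulrA.
Qed.

Lemma transfer_comp f : A f -> transfer f \o theta1 = f.
Proof.
move=> Af; apply/funext => x /=.
by rewrite -[theta1 x](act0 E') transferE// (char0 chi'P) mul1r.
Qed.

Lemma transfer_act f x' c : A f -> transfer f (tact E' c x') = chi' c * transfer f x'.
Proof.
move=> Af; have [[b x] /= ->] := twist_lift x'.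
by rewrite -actD !transferE// (char_mul chi'P) mulrA.
Qed.

Lemma lift_cvg b x :
  tact E' p.1 (theta1 p.2) @[p --> (b, x)] --> tact E' b (theta1 x).
Proof.
apply: act_cvg; first exact: cvg_fst.
apply: (@cvg_comp _ _ _ snd theta1 _ (nbhs x)); first exact: cvg_snd.
exact: theta1_continuous.
Qed.

(** Lifts of points near [x'0] cannot be chosen continuously. Instead, for a closed [Z] and [x'0]
    adherent to its preimage, lifts of points with values in [Z] cluster at one lift of [x'0], and
    there continuity of [chi'] and [f] puts the value in [Z]. *)
Lemma transfer_continuous f : A f -> continuous (transfer f).
Proof.
move=> Af; have cf := proj1 (proj1 Af); apply/continuous_closedP => Z cZ x'0 clx.
have [[b0 x] /= e0] := twist_lift x'0.
set P := _ @^-1` Z in clx *; pose F := within P (nbhs x'0).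
have PF : ProperFilter F by exact: within_nbhs_proper.
have e0' : tpi E' x'0 = tpi E x by rewrite e0 tpi_act theta1_pi.
have cl : cluster (tpi E' @ F) (tpi E x).
  move=> M N FM Nx; apply: (@filter_ex _ (tpi E' @ F)).
  apply: filterI => //; apply: (@cvg_within _ (nbhs x'0) _ P).
  by apply: (@tpi_continuous _ _ _ E' x'0); rewrite e0'.
have [b bP] := twist_cluster_lift theta1_pi cGam' PF cl.
(* The cluster lift may differ from the presentation (b0, x). It still represents [x'0], since lifts
   close to (b, x) fall into every neighbourhood of [x'0] and [S'] is Hausdorff. *)
have ex : tact E' b (theta1 x) = x'0.
  apply: (@garrow_hausdorff S') => M N Mx Nx.
  have [[U V] /= [Ub Vx] UVM] := lift_cvg Mx.
  have FN : F N by exact: (@cvg_within _ (nbhs x'0) _ P).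
  have [b1 [y [Ub1 Vy Ny]]] := bP _ _ _ FN Ub Vx.
  by exists (tact E' b1 (theta1 y)); split => //; exact: (UVM (b1, y)).
rewrite /P /= -ex transferE//; apply: cZ => N Nx.
have cv : (fun p : Gam' * S => chi' p.1 * f p.2) p @[p --> (b, x)] --> chi' b * f x.
  apply: cvgM.
    apply: (@cvg_comp _ _ _ fst chi' _ (nbhs b)); first exact: cvg_fst.
    exact: (char_continuous chi'P).
  apply: (@cvg_comp _ _ _ snd f _ (nbhs x)); first exact: cvg_snd.
  exact: cf.
have [[U V] /= [Ub Vx] UVN] := cv _ Nx.
have FP : F P by apply: withinT; exact: nbhs_filter.
have [b1 [y [Ub1 Vy Py]]] := bP _ _ _ FP Ub Vx.
exists (transfer f (tact E' b1 (theta1 y))); split => //.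
by rewrite transferE//; exact: (UVN (b1, y)).
Qed.

Lemma transfer_Cchi f : A f -> A' (transfer f).
Proof.
move=> Af; split; last by move=> x c; exact: transfer_act.
have ck : compact (tpi E' @^-1` (tpi E @` csupp f)).
  apply: (@tpi_proper _ _ _ E' _ cGam'); apply: continuous_compact.
    by apply: continuous_subspaceT; exact: tpi_continuous.
  exact: (proj2 (proj1 Af)).
apply: (Cc_sub (@garrow_hausdorff S') (transfer_continuous Af) ck) => x' nx'.
have [[b x] /= e] := twist_lift x'.
rewrite e transferE// (_ : f x = 0) ?mulr0//.
apply: csuppN => sx; apply: nx'; exists x => //.
by rewrite e tpi_act theta1_pi.
Qed.

(** Compactness of the support does not come from [theta1] directly: the support of the pullback is
    enclosed in the preimage under [tpi E] of the image of the support in [G], and [tpi E] is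
    proper. *)
Lemma pull_Cchi f' : A' f' -> A (f' \o theta1).
Proof.
move=> [Cf' ef']; split; last by move=> x a /=; rewrite theta1_act ef'.
have ck : compact (tpi E @^-1` (tpi E' @` csupp f')).
  apply: (@tpi_proper _ _ _ E _ cGam); apply: continuous_compact.
    by apply: continuous_subspaceT; exact: tpi_continuous.
  exact: (proj2 Cf').
have cc : continuous (f' \o theta1).
  move=> x; apply: (@cvg_comp _ _ _ theta1 f' _ (nbhs (theta1 x))).
    exact: theta1_continuous.
  exact: (proj1 Cf').
apply: (Cc_sub (@garrow_hausdorff S) cc ck) => x nx.
by rewrite -[LHS]/(f' (theta1 x)); apply: csuppN => sx; apply: nx; exists (theta1 x).
Qed.

Lemma pull_inj f' g' : A' f' -> A' g' -> f' \o theta1 = g' \o theta1 -> f' = g'.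
Proof.
move=> [_ ef] [_ eg] e; apply/funext => x'; have [[b x] /= ->] := twist_lift x'.
by rewrite ef eg; congr (_ * _); exact: (congr1 (@^~ x) e).
Qed.

Lemma transfer_pull f' : A' f' -> transfer (f' \o theta1) = f'.
Proof.
move=> Af'; apply: pull_inj => //; first exact/transfer_Cchi/pull_Cchi.
by rewrite transfer_comp//; exact: pull_Cchi.
Qed.

Lemma transfer_lin (a : C) f g : A f -> A g ->
  transfer (a *: f + g) = a *: transfer f + transfer g.
Proof.
move=> Af Ag; apply/funext => x'; rewrite /transfer.
rewrite -[RHS]/(a * (_ * _) + _ * _) -[in LHS]/(a * f _ + g _).
by rewrite mulrDr mulrCA.
Qed.

Lemma pull_star (f' : S' -> C) : gstar f' \o theta1 = gstar (f' \o theta1).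
Proof. by apply/funext => x; rewrite /gstar /= (hom_inv theta1_hom). Qed.

Hypothesis hGam : hausdorff_space Gam.
Hypothesis hGam' : hausdorff_space Gam'.
Hypothesis theta_continuous : continuous theta.
Variable lam : forall u : G, {measure set (borel u) -> \bar R}.
Hypothesis lamP : haar_system lam.
Variable h : {measure set (borel (0 : Gam)) -> \bar R}.
Hypothesis hh : normalized_haar h.
Variable mu : forall x : S, {measure set (borel x) -> \bar R}.
Hypothesis muP : induced_haar E lam h mu.
Variable h' : {measure set (borel (0 : Gam')) -> \bar R}.
Hypothesis hh' : normalized_haar h'.
Variable mu' : forall x : S', {measure set (borel x) -> \bar R}.
Hypothesis mu'P : induced_haar E' lam h' mu'.

Let chiP := comp_character theta_continuous.

Lemma theta1_section (sec : G -> S) : cancel sec (tpi E) ->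
  cancel (theta1 \o sec) (tpi E').
Proof. by move=> secK y; rewrite /= theta1_pi secK. Qed.

Lemma pull_conv f' g' : A' f' -> A' g' ->
  gconv mu' f' g' \o theta1 = gconv mu (f' \o theta1) (g' \o theta1).
Proof.
move=> Af' Ag'; have [sec secK] := tpi_section E.
apply/funext => x /=.
have Ap := pull_Cchi Af'; have Aq := pull_Cchi Ag'.
rewrite (gconv_section cGam hGam hh muP chiP secK x Ap (proj1 Aq)).
rewrite (gconv_section cGam' hGam' hh' mu'P chi'P (theta1_section secK) (theta1 x) Af' (proj1 Ag')).
rewrite (chi_mean_id hh chiP Aq) (chi_mean_id hh' chi'P Ag').
rewrite (hom_range theta1_hom) theta1_pi; apply: eq_cintegral => y yx /=.
rewrite -(hom_inv theta1_hom) -(hom_mul theta1_hom)//.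
rewrite gsource_inv; exact: (sec_range secK (units_range x) yx).
Qed.

(** Deduced from [pull_conv] by injectivity of the pullback, since [transfer] itself rests on a
    choice of lifts. *)
Lemma transfer_conv f g : A f -> A g ->
  transfer (gconv mu f g) = gconv mu' (transfer f) (transfer g).
Proof.
move=> Af Ag; apply: pull_inj.
- exact/transfer_Cchi/(Cchi_conv cGam hGam lamP hh muP Af Ag).
- exact: (Cchi_conv cGam' hGam' lamP hh' mu'P (transfer_Cchi Af) (transfer_Cchi Ag)).
- rewrite (pull_conv (transfer_Cchi Af) (transfer_Cchi Ag)) !transfer_comp//.
  exact: (Cchi_conv cGam hGam lamP hh muP Af Ag).
Qed.

Lemma transfer_star f : A f -> transfer (gstar f) = gstar (transfer f).
Proof.
move=> Af; apply: pull_inj.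
- exact/transfer_Cchi/(Cchi_star chiP Af).
- exact: (Cchi_star chi'P (transfer_Cchi Af)).
- by rewrite pull_star !transfer_comp//; exact: (Cchi_star chiP Af).
Qed.

Lemma transfer_bij : set_bij A A' transfer.
Proof.
split.
- by move=> f; exact: transfer_Cchi.
- by move=> f g /set_mem Af /set_mem Ag e; rewrite -(transfer_comp Af) e transfer_comp.
- move=> f' Af'; exists (f' \o theta1); first exact: pull_Cchi.
  exact: transfer_pull.
Qed.

Lemma transfer_star_iso :
  star_iso_on (gconv mu) (@gstar R S) (gconv mu') (@gstar R S') A A' transfer.
Proof.
split; first exact: transfer_bij.
split; [exact: transfer_lin|exact: transfer_conv|exact: transfer_star].
Qed.

Lemma pull_abs_integral f' u : A' f' -> units u ->
  abs_integral (mu u) (f' \o theta1) = abs_integral (mu' (theta1 u)) f'.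
Proof.
move=> Af' uu; have [sec secK] := tpi_section E.
rewrite (abs_integral_section hh muP chiP secK (pull_Cchi Af') uu).
rewrite (abs_integral_section hh' mu'P chi'P (theta1_section secK) Af' (hom_unit theta1_hom uu)).
by rewrite theta1_pi.
Qed.

Lemma pull_abs_integral_source f' u : A' f' -> units u ->
  abs_integral (@mu_source R S mu u) (f' \o theta1) =
  abs_integral (@mu_source R S' mu' (theta1 u)) f'.
Proof.
move=> Af' uu; have [sec secK] := tpi_section E.
rewrite (abs_integral_source_section hh muP chiP secK (pull_Cchi Af') uu).
rewrite (abs_integral_source_section hh' mu'P chi'P (theta1_section secK) Af' (hom_unit theta1_hom uu)).
rewrite theta1_pi /=; do 3 congr (_ _).
by apply/funext => y; rewrite (hom_inv theta1_hom).
Qed.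

Lemma pull_l2nrm f' u : A' f' -> units u ->
  l2nrm (source_measure mu u) (sfib u) (f' \o theta1) =
  l2nrm (source_measure mu' (theta1 u)) (sfib (theta1 u)) f'.
Proof.
move=> Af' uu; have [sec secK] := tpi_section E.
suff e : l2sq (source_measure mu u) (sfib u) (f' \o theta1) =
    l2sq (source_measure mu' (theta1 u)) (sfib (theta1 u)) f'.
  by rewrite /l2nrm e.
rewrite (l2sq_source_section hh muP chiP secK (pull_Cchi Af') uu).
rewrite (l2sq_source_section hh' mu'P chi'P (theta1_section secK) Af' (hom_unit theta1_hom uu)).
rewrite theta1_pi /=; do 3 congr (_ _).
by apply/funext => y; rewrite (hom_inv theta1_hom).
Qed.

(** The map [theta1] carries the units of [S] onto those of [S'], so suprema over units can be
    compared one unit at a time. *)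
Lemma image_units (T : Type) (F : S -> T) (F' : S' -> T) :
  (forall u, units u -> F u = F' (theta1 u)) ->
  [set F u | u in @units S] = [set F' u | u in @units S'].
Proof.
move=> FF'; apply/seteqP; split => [_ [u uu <-]|_ [u' /units_lift[u uu <-] <-]].
  by rewrite FF'//; exists (theta1 u) => //; exact: (hom_unit theta1_hom).
by exists u => //; exact: FF'.
Qed.

Lemma pull_Inorm f' : A' f' -> Inorm mu (f' \o theta1) = Inorm mu' f'.
Proof.
move=> Af'; rewrite /Inorm /Inorm_r /Inorm_s; congr (maxe (esup0 _) (esup0 _)).
  by apply: image_units => u; exact: pull_abs_integral_source.
by apply: image_units => u; exact: pull_abs_integral.
Qed.

Lemma pull_full_norm f' : A' f' ->
  full_norm mu A (f' \o theta1) = full_norm mu' A' f'.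
Proof.
move=> Af'; congr esup0; apply/seteqP; split => c [H [L [rL bL ->]]].
  exists H, (fun g' => L (g' \o theta1)); split => //.
    split.
    - by move=> g Ag; apply: (star_rep_operator rL); exact: pull_Cchi.
    - by move=> g Ag; apply: (star_rep_bounded rL); exact: pull_Cchi.
    - move=> a g k Ag Ak x; exact: (star_rep_linear rL a (pull_Cchi Ag) (pull_Cchi Ak) x).
    - move=> g k Ag Ak x; rewrite (pull_conv Ag Ak).
      exact: (star_rep_mul rL (pull_Cchi Ag) (pull_Cchi Ak) x).
    - move=> g Ag x y; rewrite pull_star; exact: (star_rep_star rL (pull_Cchi Ag) x y).
  by move=> g Ag; rewrite -(pull_Inorm Ag); apply: bL; exact: pull_Cchi.
exists H, (fun g => L (transfer g)); split => //.
- split.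
  + by move=> g Ag; apply: (star_rep_operator rL); exact: transfer_Cchi.
  + by move=> g Ag; apply: (star_rep_bounded rL); exact: transfer_Cchi.
  + move=> a g k Ag Ak x; rewrite (transfer_lin a Ag Ak).
    exact: (star_rep_linear rL a (transfer_Cchi Ag) (transfer_Cchi Ak) x).
  + move=> g k Ag Ak x; rewrite (transfer_conv Ag Ak).
    exact: (star_rep_mul rL (transfer_Cchi Ag) (transfer_Cchi Ak) x).
  + move=> g Ag x y; rewrite (transfer_star Ag).
    exact: (star_rep_star rL (transfer_Cchi Ag) x y).
- move=> g Ag; rewrite -[in leRHS](transfer_comp Ag) (pull_Inorm (transfer_Cchi Ag)).
  by apply: bL; exact: transfer_Cchi.
- by rewrite (transfer_pull Af').
Qed.

Lemma pull_Ind_bound f' u b : A' f' -> units u ->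
  Ind_bound mu u (f' \o theta1) b <-> Ind_bound mu' (theta1 u) f' b.
Proof.
move=> Af' uu; have uu' := hom_unit theta1_hom uu.
rewrite (Ind_bound_twisted cGam hGam lamP hh muP chiP b (pull_Cchi Af') uu).
rewrite (Ind_bound_twisted cGam' hGam' lamP hh' mu'P chi'P b Af' uu').
split=> -[b0 bL]; split => // g Ag.
  rewrite -(pull_l2nrm Ag uu) -(pull_l2nrm _ uu).
    by rewrite (pull_conv Af' Ag); apply: bL; exact: pull_Cchi.
  exact: (Cchi_conv cGam' hGam' lamP hh' mu'P Af' Ag).
have Ag' := transfer_Cchi Ag.
rewrite -(transfer_comp Ag) -(pull_conv Af' Ag') (pull_l2nrm Ag' uu) (pull_l2nrm _ uu).
  exact: bL.
exact: (Cchi_conv cGam' hGam' lamP hh' mu'P Af' Ag').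
Qed.

Lemma pull_reduced_norm f' : A' f' ->
  reduced_norm mu (f' \o theta1) = reduced_norm mu' f'.
Proof.
move=> Af'; congr esup0; apply: image_units => u uu.
rewrite (Ind_delta_norm_inf cGam hGam lamP hh muP (pull_Cchi Af') uu).
rewrite (Ind_delta_norm_inf cGam' hGam' lamP hh' mu'P Af' (hom_unit theta1_hom uu)).
suff -> : Ind_bound mu u (f' \o theta1) = Ind_bound mu' (theta1 u) f' by [].
by apply/funext => b; apply/propext; exact: pull_Ind_bound.
Qed.

End twist_morphism.

(** * Completions *)

Section real_norm.
Variables (R : realType) (V : normedModType (Cplx R)).
Local Notation C := (Cplx R).
Local Notation rn x := (complex.Re `|x|).

Lemma rnE (x : V) : `|x| = ((rn x)%:C)%C.
Proof.
by move: (normr_ge0 x); rewrite lecE => /andP[/eqP/= i0 _]; apply: complex_eq.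
Qed.

Lemma rn_ge0 (x : V) : 0 <= rn x.
Proof. by move: (normr_ge0 x); rewrite lecE => /andP[]. Qed.

Lemma rnD (x y : V) : rn (x + y) <= rn x + rn y.
Proof. by have := ler_normD x y; rewrite lecE cReD => /andP[]. Qed.

Lemma rn_dist (x y : V) : rn (x - y) = rn (y - x).
Proof. by rewrite distrC. Qed.

Lemma rnZ (a : C) (x : V) : rn (a *: x) = rn a * rn x.
Proof. by rewrite normrZ cReM (rnE x) /= mulr0 subr0. Qed.

Lemma rn_tri (x y z : V) : rn (x - z) <= rn (x - y) + rn (y - z).
Proof. by rewrite -{1}(subrK y x) -addrA; exact: rnD. Qed.

Lemma rn_eq0 (x y : V) : rn (x - y) = 0 -> x = y.
Proof. by move=> h; apply/eqP; rewrite -subr_eq0 -normr_eq0 rnE h. Qed.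

Lemma rn_ball (x y : V) (e : R) : rn (x - y) < e -> ball x ((e%:C)%C : C) y.
Proof. by move=> xy; rewrite -ball_normE /= rnE ltcR. Qed.
End real_norm.

Section cstar.
Variables (R : realType) (B : cstarAlgebra R).
Local Notation rn x := (complex.Re `|x|).
Implicit Types x y : B.

Lemma rn_mul x y : rn (amul x y) <= rn x * rn y.
Proof.
have := anormM x y; rewrite lecE cReM (rnE x) (rnE y) /= => /andP[_].
by rewrite mulr0 subr0.
Qed.

Lemma amulBl x y z : amul (x - y) z = amul x z - amul y z.
Proof.
by rewrite addrC -scaleN1r amul_linear_l scaleN1r addrC.
Qed.

Lemma amulBr x y z : amul z (x - y) = amul z x - amul z y.
Proof.
by rewrite addrC -scaleN1r amul_linear_r scaleN1r addrC.
Qed.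

Lemma astarB x y : astar (x - y) = astar x - astar y.
Proof.
by rewrite addrC -scaleN1r astar_linear rmorphN rmorph1 scaleN1r addrC.
Qed.

Lemma rn_star x : rn (astar x) = rn x.
Proof.
suff le (z : B) : rn z <= rn (astar z) by apply: le_anti; rewrite le -{2}(astarK x) le.
have := rn_mul (astar z) z; rewrite anorm_star.
rewrite (_ : complex.Re (`|z| ^+ 2) = rn z * rn z); last first.
  by rewrite expr2 cReM (rnE z) /= mulr0 subr0.
have := rn_ge0 z; rewrite le_eqVlt => /orP[/eqP <- _|z0]; first exact: rn_ge0.
by rewrite ler_pM2r.
Qed.

(** Continuity of the product with a constant depending only on the limits [x] and [y]; the
    condition d <= 1 absorbs the approximant through |x0| <= |x| + 1. *)
Lemma rn_mul_dist x y x0 y0 (d : R) : rn (x - x0) < d -> rn (y - y0) < d -> d <= 1 ->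
  rn (amul x y - amul x0 y0) <= d * (rn x + rn y + 1).
Proof.
move=> xd yd d1.
have -> : amul x y - amul x0 y0 = amul (x - x0) y + amul x0 (y - y0).
  by rewrite amulBl amulBr addrA subrK.
have nx0 : rn x0 <= rn x + 1.
  have := rnD (x0 - x) x; rewrite subrK rn_dist; lra.
apply: le_trans (rnD _ _) _.
have := rn_mul (x - x0) y; have := rn_mul x0 (y - y0).
have := rn_ge0 y; have := rn_ge0 x0; have := rn_ge0 x.
have := rn_ge0 (x - x0); have := rn_ge0 (y - y0).
nra.
Qed.
End cstar.

(** * Extension of isometric maps to completions *)

Section isometric_extension.
Variables (R : realType) (M : lmodType (Cplx R)) (mulM : M -> M -> M) (starM : M -> M).
Variables (A : set M) (B B' : cstarAlgebra R) (i : M -> B) (j : M -> B').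
Local Notation C := (Cplx R).
Local Notation rn x := (complex.Re `|x|).
Hypothesis A_lin : forall (a : C) x y, A x -> A y -> A (a *: x + y).

(** The closure in B x B' of the pairs (i f, j f). The relation is symmetric in [i] and [j], so
    injectivity and surjectivity of the extension follow from uniqueness and existence with the
    roles exchanged. *)
Definition limit_rel (b : B) (b' : B') : Prop := forall e : R, 0 < e ->
  exists2 f, A f & rn (b - i f) < e /\ rn (b' - j f) < e.

Hypothesis i_hom : star_hom_on mulM starM (@amul R B) (@astar R B) A i.
Hypothesis j_hom : star_hom_on mulM starM (@amul R B') (@astar R B') A j.
Hypothesis ij_norm : forall f, A f -> rn (i f) = rn (j f).

Lemma isometric_dist f g : A f -> A g -> rn (i f - i g) = rn (j f - j g).
Proof.
move=> Af Ag; have e := ij_norm (A_lin (-1) Ag Af).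
rewrite (star_hom_linear i_hom)// (star_hom_linear j_hom)// !scaleN1r in e.
by rewrite ![_ - _]addrC.
Qed.

Hypothesis i_dense : dense (i @` A).

Lemma dense_approx (b : B) (e : R) : 0 < e -> exists2 f, A f & rn (b - i f) < e.
Proof.
move=> e0; have := @i_dense (ball b ((e%:C)%C : C))°.
case.
- exists b; apply: nbhs_singleton; apply: nbhs_interior; apply: nbhsx_ballx.
  exact: real_complex_gt0.
- exact: open_interior.
- move=> x [/interior_subset bf [f Af fx]]; exists f => //.
  by move: bf; rewrite -fx; rewrite -ball_normE /= rnE ltcR.
Qed.

Lemma limit_rel_ex b : exists b', limit_rel b b'.
Proof.
have n0 n : 0 < (n.+1%:R^-1 : R) by rewrite invr_gt0.
have [phi phiP] := choice (fun n => ex2_and (dense_approx b (n0 n))).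
pose y n := j (phi n).
have cy : cauchy (y @ \oo).
  apply: cauchy_exP => _ /complex_gt0P[e e0 ->].
  have e2 : 0 < e / 2 by rewrite divr_gt0.
  have [n _ nP] := near_infty_natSinv_lt (PosNum e2).
  exists (y n), n => //= k nk; apply: rn_ball.
  have [An bn] := phiP n; have [Ak bk] := phiP k.
  rewrite /y -isometric_dist//; apply: le_lt_trans (rn_tri _ b _) _.
  rewrite rn_dist; have /= := nP n (leqnn n); have /= := nP k nk.
  by move: bn bk; move: (n.+1%:R^-1) (k.+1%:R^-1) => p q; lra.
have /cauchy_cvgP/cvg_ex[b' yb'] := cy.
exists b' => e e0.
have near1 : \forall n \near \oo, rn (b' - y n) < e.
  by move/(@cvg_normcP R B' _ _ _) : yb' => /(_ e e0).
have near2 := near_infty_natSinv_lt (PosNum e0).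
have [n [h1 /= h2]] := filter_ex (filterI near1 near2).
have [An bn] := phiP n.
by exists (phi n) => //; split => //; exact: lt_trans h2.
Qed.

Lemma limit_rel_uniq b b1 b2 : limit_rel b b1 -> limit_rel b b2 -> b1 = b2.
Proof.
move=> r1 r2; apply: rn_eq0; apply/eqP; rewrite eq_le rn_ge0 andbT.
apply/ler_addgt0Pr => e e0; rewrite add0r.
have e4 : 0 < e / 4 by rewrite divr_gt0.
have [f Af [bf b1f]] := r1 _ e4; have [g Ag [bg b2g]] := r2 _ e4.
apply: le_trans (rn_tri _ (j f) _) _.
have := rn_tri (j f) (j g) b2; rewrite -isometric_dist// (rn_dist (j g) b2).
have := rn_tri (i f) b (i g); rewrite (rn_dist (i f) b).
by move: bf b1f bg b2g; lra.
Qed.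

Lemma limit_rel_incl f : A f -> limit_rel (i f) (j f).
Proof. by move=> Af e e0; exists f => //; rewrite !subrr !normr0. Qed.

Lemma limit_rel_lin (a : C) b1 b1' b2 b2' : limit_rel b1 b1' -> limit_rel b2 b2' ->
  limit_rel (a *: b1 + b2) (a *: b1' + b2').
Proof.
move=> r1 r2 e e0; have a0 := Re_norm_ge0 a; pose d := e / (rn a + 1).
have p0 : 0 < rn a + 1 by rewrite ltr_wpDl.
have d0 : 0 < d by rewrite divr_gt0.
have ed : e = (rn a + 1) * d by rewrite /d mulrC divfK// gt_eqF.
have [f Af [bf bf']] := r1 _ d0; have [g Ag [bg bg']] := r2 _ d0.
have est (V : normedModType C) (u1 u2 v1 v2 : V) : rn (u1 - v1) < d -> rn (u2 - v2) < d ->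
    rn ((a *: u1 + u2) - (a *: v1 + v2)) < e.
  move=> h1 h2; rewrite opprD addrACA -scalerBr.
  apply: le_lt_trans (rnD _ _) _; rewrite rnZ ed mulrDl mul1r.
  by apply: ler_ltD => //; apply: ler_wpM2l => //; exact: ltW.
exists (a *: f + g); first exact: A_lin.
by rewrite (star_hom_linear i_hom)// (star_hom_linear j_hom)//; split; exact: est.
Qed.

Hypothesis A_mul : forall x y, A x -> A y -> A (mulM x y).
Hypothesis A_star : forall x, A x -> A (starM x).

Lemma limit_rel_mul b1 b1' b2 b2' : limit_rel b1 b1' -> limit_rel b2 b2' ->
  limit_rel (amul b1 b2) (amul b1' b2').
Proof.
move=> r1 r2 e e0.
(* [K] exceeds the factor of [d] in [rn_mul_dist] for either algebra, so d * K <= e leaves strict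
   inequalities on both sides. *)
pose K := (rn b1 + rn b2 + 1) + (rn b1' + rn b2' + 1) + 1.
have k1 := rn_ge0 b1; have k2 := rn_ge0 b2; have k3 := rn_ge0 b1'; have k4 := rn_ge0 b2'.
have K0 : 0 < K by rewrite /K; lra.
pose d := Num.min 1 (e / K).
have d0 : 0 < d by rewrite lt_min ltr01 divr_gt0.
have d1 : d <= 1 by rewrite ge_min lexx.
have dK : d * K <= e by rewrite -ler_pdivlMr// ge_min lexx orbT.
have [f Af [bf bf']] := r1 _ d0; have [g Ag [bg bg']] := r2 _ d0.
exists (mulM f g); first exact: A_mul.
rewrite (star_hom_mul i_hom)// (star_hom_mul j_hom)//; split.
  apply: le_lt_trans (rn_mul_dist bf bg d1) _; apply: lt_le_trans dK.
  by rewrite ltr_pM2l// /K; lra.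
apply: le_lt_trans (rn_mul_dist bf' bg' d1) _; apply: lt_le_trans dK.
by rewrite ltr_pM2l// /K; lra.
Qed.

Lemma limit_rel_star b b' : limit_rel b b' -> limit_rel (astar b) (astar b').
Proof.
move=> r e e0; have [f Af [bf bf']] := r _ e0.
exists (starM f); first exact: A_star.
by rewrite (star_hom_star i_hom)// (star_hom_star j_hom)// -!astarB !rn_star.
Qed.
End isometric_extension.

Lemma limit_rel_sym (R : realType) (M : lmodType (Cplx R)) (A : set M)
    (B B' : cstarAlgebra R) (i : M -> B) (j : M -> B') b b' :
  limit_rel A i j b b' -> limit_rel A j i b' b.
Proof. by move=> r e /r[f Af [? ?]]; exists f. Qed.

Lemma isometric_extension (R : realType) (M : lmodType (Cplx R))
    (mulM : M -> M -> M) (starM : M -> M) (A : set M)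
    (B B' : cstarAlgebra R) (i : M -> B) (j : M -> B') :
  (forall (a : Cplx R) x y, A x -> A y -> A (a *: x + y)) ->
  (forall x y, A x -> A y -> A (mulM x y)) ->
  (forall x, A x -> A (starM x)) ->
  star_hom_on mulM starM (@amul R B) (@astar R B) A i ->
  star_hom_on mulM starM (@amul R B') (@astar R B') A j ->
  (forall f, A f -> complex.Re `|i f| = complex.Re `|j f|) ->
  dense (i @` A) -> dense (j @` A) ->
  exists2 Phi : B -> B', cstar_iso Phi & forall f, A f -> Phi (i f) = j f.
Proof.
move=> A_lin A_mul A_star ih jh ij di dj.
have ji f (Af : A f) := esym (ij f Af).
have [Phi PhiP] := choice (limit_rel_ex A_lin ih jh ij di).
have uniq := limit_rel_uniq A_lin ih jh ij.
have uniq' := limit_rel_uniq A_lin jh ih ji.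
exists Phi; last by move=> f Af; apply: uniq (PhiP _) _; exact: limit_rel_incl.
split.
  split.
  - by [].
  - move=> x y _ _ e; apply: (uniq' (Phi x)); apply: limit_rel_sym => //.
    by rewrite e.
  - move=> b' _; have [b bb'] := limit_rel_ex A_lin jh ih ji dj b'.
    by exists b => //; apply: uniq (PhiP _) _; exact: limit_rel_sym.
split.
- by move=> a x y _ _; apply: uniq (PhiP _) _; apply: (limit_rel_lin A_lin ih jh).
- by move=> x y _ _; apply: uniq (PhiP _) _; apply: (limit_rel_mul ih jh).
- by move=> x _; apply: uniq (PhiP _) _; apply: (limit_rel_star ih jh).
Qed.

(** The maps [i] and [i' \o Ups] send the same algebra densely into the two completions with equal
    norms, so the isometric extension applies to this pair. It serves the full and the reduced norm
    alike. *)
Lemma completion_iso (R : realType) (M M' : lmodType (Cplx R))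
    (mulM : M -> M -> M) (starM : M -> M) (mulM' : M' -> M' -> M') (starM' : M' -> M')
    (A : set M) (A' : set M') (N : M -> \bar R) (N' : M' -> \bar R)
    (Ups : M -> M') (B B' : cstarAlgebra R) (i : M -> B) (i' : M' -> B') :
  (forall (a : Cplx R) x y, A x -> A y -> A (a *: x + y)) ->
  (forall x y, A x -> A y -> A (mulM x y)) ->
  (forall x, A x -> A (starM x)) ->
  star_iso_on mulM starM mulM' starM' A A' Ups ->
  (forall f, A f -> N f = N' (Ups f)) ->
  completion mulM starM A N i -> completion mulM' starM' A' N' i' ->
  exists2 Phi : B -> B', cstar_iso Phi & forall f, A f -> Phi (i f) = i' (Ups f).
Proof.
move=> A_lin A_mul A_star [[UA' _ Usurj] Uh] NN' ci ci'.
have i'h := completion_hom ci'.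
apply: (@isometric_extension R M mulM starM A B B' i (i' \o Ups)) => //.
- exact: (completion_hom ci).
- split.
  + move=> a x y Ax Ay /=; rewrite (star_hom_linear Uh)// (star_hom_linear i'h)//; exact: UA'.
  + move=> x y Ax Ay /=; rewrite (star_hom_mul Uh)// (star_hom_mul i'h)//; exact: UA'.
  + move=> x Ax /=; rewrite (star_hom_star Uh)// (star_hom_star i'h)//; exact: UA'.
- move=> f Af /=; apply: EFin_inj.
  rewrite (completion_norm ci Af) (completion_norm ci' (UA' _ Af)); exact: NN'.
- exact: (completion_dense ci).
- have := completion_dense ci'; rewrite (_ : i' @` A' = (i' \o Ups) @` A)//.
  apply/seteqP; split => [_ [f' /Usurj[f Af <-] <-]|_ [f Af <-]]; first by exists f.
  by exists (Ups f) => //; exact: UA'.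
Qed.

Theorem theorem6p4 (R : realType)
    (Gam Gam' : topologicalZmodType)
    (Gam_compact : compact [set: Gam]) (Gam_hausdorff : hausdorff_space Gam)
    (Gam'_compact : compact [set: Gam']) (Gam'_hausdorff : hausdorff_space Gam')
    (G : lcgroupoid)
    (lam : forall u : G, {measure set (borel u) -> \bar R})
    (lam_haar : haar_system lam)
    (S S' : lcgroupoid) (E : twist G S Gam) (E' : twist G S' Gam')
    (h : {measure set (borel (0 : Gam)) -> \bar R})
    (h_haar : normalized_haar h)
    (h' : {measure set (borel (0 : Gam')) -> \bar R})
    (h'_haar : normalized_haar h')
    (mu : forall x : S, {measure set (borel x) -> \bar R})
    (mu_haar : induced_haar E lam h mu)
    (mu' : forall x : S', {measure set (borel x) -> \bar R})
    (mu'_haar : induced_haar E' lam h' mu')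
    (theta : {additive Gam -> Gam'}) (theta_continuous : continuous theta)
    (theta1 : S -> S') (theta1_continuous : continuous theta1)
    (theta1_hom : groupoid_hom theta1)
    (theta1_iota : forall (u : G) (a : Gam), units u ->
       theta1 (tiota E (u, a)) = tiota E' (u, theta a))
    (theta1_pi : tpi E' \o theta1 = tpi E)
    (chi' : Gam' -> Cplx R) (chi'_char : character chi') :
  let chi : Gam -> Cplx R := chi' \o theta in
  let A := Cchi E chi in
  let A' := Cchi E' chi' in
  [/\ character chi,
      forall f : S -> Cplx R, A f ->
        exists! f' : S' -> Cplx R, A' f' /\ f' \o theta1 = f &
      exists Ups : (S -> Cplx R) -> S' -> Cplx R,
        [/\ forall f, A f -> A' (Ups f) /\ Ups f \o theta1 = f,
            star_iso_on (gconv mu) (@gstar R S) (gconv mu') (@gstar R S')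
              A A' Ups,
            forall (B B' : cstarAlgebra R)
              (i : (S -> Cplx R) -> B) (i' : (S' -> Cplx R) -> B'),
              completion (gconv mu) (@gstar R S) A (full_norm mu A) i ->
              completion (gconv mu') (@gstar R S') A' (full_norm mu' A') i' ->
              exists2 Phi : B -> B', cstar_iso Phi &
                forall f, A f -> Phi (i f) = i' (Ups f) &
            forall (B B' : cstarAlgebra R)
              (i : (S -> Cplx R) -> B) (i' : (S' -> Cplx R) -> B'),
              completion (gconv mu) (@gstar R S) A (reduced_norm mu) i ->
              completion (gconv mu') (@gstar R S') A' (reduced_norm mu') i' ->
              exists2 Phi : B -> B', cstar_iso Phi &
                forall f, A f -> Phi (i f) = i' (Ups f)]].
Proof.
move=> chi A A'.
have pi1 x : tpi E' (theta1 x) = tpi E x by exact: (congr1 (@^~ x) theta1_pi).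
have chiP := comp_character chi'_char theta_continuous.
have transfer_A f := transfer_Cchi Gam'_compact theta1_continuous theta1_hom
  theta1_iota pi1 chi'_char (f := f).
have transfer_theta1 f := transfer_comp theta1_hom theta1_iota pi1 chi'_char (f := f).
have iso := transfer_star_iso Gam_compact Gam'_compact theta1_continuous
  theta1_hom theta1_iota pi1 chi'_char Gam_hausdorff Gam'_hausdorff
  theta_continuous lam_haar h_haar mu_haar h'_haar mu'_haar.
have A_mul f g : A f -> A g -> A (gconv mu f g).
  exact: (Cchi_conv Gam_compact Gam_hausdorff lam_haar h_haar mu_haar).
have A_star f : A f -> A (gstar f) by exact: (Cchi_star chiP).
split=> //.
- move=> f Af; exists (transfer pi1 chi' f); split.
    by split; [exact: transfer_A|exact: transfer_theta1].
  move=> f' [Af' e]; apply: (pull_inj pi1 (transfer_A _ Af) Af').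
  by rewrite e; exact: transfer_theta1.
- exists (transfer pi1 chi'); split.
  + by move=> f Af; split; [exact: transfer_A|exact: transfer_theta1].
  + exact: iso.
  + move=> B B' i i'; apply: (completion_iso _ A_mul A_star iso) => [a f g|f Af].
      exact: Cchi_lin.
    (* Writing [f] as the pullback of its transfer brings the goal into the form of the norm
       comparison for pullbacks. *)
    rewrite -[in LHS](transfer_theta1 f Af).
    exact: (pull_full_norm Gam_compact Gam'_compact theta1_continuous
      theta1_hom theta1_iota pi1 chi'_char Gam_hausdorff Gam'_hausdorff
      theta_continuous lam_haar h_haar mu_haar h'_haar mu'_haar (transfer_A f Af)).
  + move=> B B' i i'; apply: (completion_iso _ A_mul A_star iso) => [a f g|f Af].
      exact: Cchi_lin.
    rewrite -[in LHS](transfer_theta1 f Af).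
    exact: (pull_reduced_norm Gam_compact Gam'_compact theta1_continuous
      theta1_hom theta1_iota pi1 chi'_char Gam_hausdorff Gam'_hausdorff
      theta_continuous lam_haar h_haar mu_haar h'_haar mu'_haar (transfer_A f Af)).
Qed.
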